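(* In Euclidean 3-space, the only analytic ruled surfaces with a constant nonzero ratio of (Euclidean) principal curvatures are the ruled minimal surfaces, i.e., (subsets of) helicoids.
   Context: A surface is an embedded connected 2-dimensional submanifold of $\mathbb{R}^3$, possibly with boundary and possibly non-compact. An analytic ruled surface is a real-analytic surface covered by an analytic one-parameter family of line segments. A surface has a constant nonzero ratio of principal curvatures if there is a real $a\neq0$ such that its Gaussian curvature is nonzero and ($\kappa_1/\kappa_2=a$ or $\kappa_2/\kappa_1=a$) at each point, where $\kappa_1,\kappa_2$ are the usual Euclidean principal curvatures. A helicoid is a surface similar (in the Euclidean sense) to $(u,v)\mapsto(u\cos v,u\sin v,v)$. *)

(* Defs.v *)
From HB Require Import structures.
From mathcomp Require Import all_boot all_order all_algebra.
From mathcomp Require Import all_classical all_reals all_analysis.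

Set Implicit Arguments.
Unset Strict Implicit.
Unset Printing Implicit Defensive.

Import Order.TTheory GRing.Theory Num.Theory.
Import numFieldNormedType.Exports.

Local Open Scope classical_set_scope.
Local Open Scope ring_scope.

Section Defs.
Variable R : realType.

Local Notation plane := 'rV[R]_2.
Local Notation space := 'rV[R]_3.
Implicit Types (I : set R) (U M : set plane) (S H : set space).

(* Real-analyticity relative to I: when I contains an endpoint, the power
   series there is required to represent f on the one side lying in I, i.e.
   f extends analytically across the endpoint. *)
Definition analytic_within I (f : R -> R) (t0 : R) : Prop :=
  exists (c : R ^nat) (r : R), 0 < r /\
    forall t, I t -> `|t - t0| < r ->
      series (fun k => c k * (t - t0) ^+ k) @ \oo --> f t.

Definition analytic_curve I (g : R -> space) : Prop :=
  forall t0, I t0 -> forall k : 'I_3, analytic_within I (fun t => g t 0 k) t0.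

(* The double power series \sum_(i, j) c i j * h0 ^+ i * h1 ^+ j is summed by
   total degree; this is harmless since it is absolutely convergent on the
   polydisc of radius r. *)
Definition analytic_at2 (f : plane -> R) (x0 : plane) : Prop :=
  exists (c : nat -> nat -> R) (r : R),
    [/\ 0 < r,
        cvgn (series (fun k : nat =>
          \sum_(i < k.+1) `|c i (k - i)%N| * r ^+ k)) &
        forall x : plane,
          `|x 0 0 - x0 0 0| < r -> `|x 0 1 - x0 0 1| < r ->
          series (fun k : nat => \sum_(i < k.+1)
            c i (k - i)%N * (x 0 0 - x0 0 0) ^+ i
                          * (x 0 1 - x0 0 1) ^+ (k - i)) @ \oo --> f x].

Definition analytic_map U (phi : plane -> space) : Prop :=
  forall x, U x -> forall k : 'I_3, analytic_at2 (fun y => phi y 0 k) x.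

Definition vec3 (x y z : R) : space := \row_(k < 3) [:: x; y; z]`_k.

Definition dot (u v : space) : R := \sum_k u 0 k * v 0 k.

Definition cross (u v : space) : space :=
  vec3 (u 0 1 * v 0 2%:R - u 0 2%:R * v 0 1)
       (u 0 2%:R * v 0 0 - u 0 0 * v 0 2%:R)
       (u 0 0 * v 0 1 - u 0 1 * v 0 0).

Definition partial (i : 'I_2) (phi : plane -> space) (x : plane) : space :=
  'D_(delta_mx 0 i) phi x.

Definition half_plane : set plane := [set x | 0 <= x 0 1].

(* phi restricts to a homeomorphism from U `&` M onto a relatively open subset
   of S; M is the half-plane for charts meeting the boundary, in which case phi
   is an analytic immersion on a full neighbourhood U. *)
Definition analytic_chart S U M (phi : plane -> space) : Prop :=
  [/\ open U, M = setT \/ M = half_plane,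
      analytic_map U phi,
      forall x, U x -> row_free (\matrix_(i < 2) partial i phi x) &
      exists (V : set space) (psi : space -> plane),
        [/\ open V,
            phi @` (U `&` M) = S `&` V,
            forall x, (U `&` M) x -> psi (phi x) = x &
            {within S `&` V, continuous psi}]].

Definition analytic_surface S : Prop :=
  connected S /\
  forall p, S p -> exists U M phi x,
    [/\ analytic_chart S U M phi, (U `&` M) x & phi x = p].

(* An analytic family of lines t |-> c t + <e t>, together with a
   nondegenerate interval J t selecting a segment in each line; segments may be
   open, closed, half-open or unbounded, so that a whole helicoid, or an open
   piece of one, is covered by its rulings. *)
Definition ruled S : Prop :=
  exists (I : set R) (J : R -> set R) (c e : R -> space),
    [/\ is_interval I, analytic_curve I c, analytic_curve I e,
        forall t, I t -> [/\ e t != 0, is_interval (J t) &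
          exists u v, [/\ J t u, J t v & u != v]] &
        S = \bigcup_(t in I) [set c t + u *: e t | u in J t]].

Definition analytic_ruled_surface S : Prop := analytic_surface S /\ ruled S.

Definition first_form (phi : plane -> space) (x : plane) : 'M[R]_2 :=
  \matrix_(i, j) dot (partial i phi x) (partial j phi x).

Definition unit_normal (phi : plane -> space) (x : plane) : space :=
  let w := cross (partial 0 phi x) (partial 1 phi x) in
  (Num.sqrt (dot w w))^-1 *: w.

Definition second_form (phi : plane -> space) (x : plane) : 'M[R]_2 :=
  \matrix_(i, j) dot (partial j (partial i phi) x) (unit_normal phi x).

(* Matrix of the shape operator, acting on row vectors, in the basis
   (partial 0 phi x, partial 1 phi x). *)
Definition shape_operator (phi : plane -> space) (x : plane) : 'M[R]_2 :=
  second_form phi x *m invmx (first_form phi x).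

(* k1 and k2 are the eigenvalues, with multiplicity, of the shape operator of S
   at p; the unordered pair is determined up to the simultaneous change of sign
   that comes with the choice of the unit normal. *)
Definition principal_curvatures S (p : space) (k1 k2 : R) : Prop :=
  exists U M phi x,
    [/\ analytic_chart S U M phi, (U `&` M) x, phi x = p &
        char_poly (shape_operator phi x) = ('X - k1%:P) * ('X - k2%:P)].

(* k1 * k2 is the Gaussian curvature. *)
Definition constant_curvature_ratio S : Prop :=
  exists2 a : R, a != 0 &
    forall p, S p -> exists k1 k2,
      [/\ principal_curvatures S p k1 k2, k1 * k2 != 0 &
          k1 / k2 = a \/ k2 / k1 = a].

Definition minimal S : Prop :=
  forall p, S p -> exists k1 k2,
    principal_curvatures S p k1 k2 /\ (k1 + k2) / 2 = 0.

(* Similarities x |-> l *: (x *m Q) + b are allowed to reverse orientation, so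
   helicoids of both handednesses are included. *)
Definition helicoid H : Prop :=
  exists (l : R) (Q : 'M[R]_3) (b : space),
    [/\ 0 < l, Q *m Q^T = 1%:M &
        H = [set p | exists u v : R,
               p = l *: (vec3 (u * cos v) (u * sin v) v *m Q) + b]].

End Defs.

(* Main.v *)
Require Import Defs.
From HB Require Import structures.
From mathcomp Require Import all_boot all_order all_algebra.
From mathcomp Require Import all_classical all_reals all_analysis.
From mathcomp Require Import ring lra.

Set Implicit Arguments.
Unset Strict Implicit.
Unset Printing Implicit Defensive.

Import Order.TTheory GRing.Theory Num.Theory.
Import numFieldNormedType.Exports.

Local Open Scope classical_set_scope.
Local Open Scope ring_scope.

(** Write the surface as [c t + u *: e t].  Along a ruling put
    [N u = (c' + u e') x e = X + u Y] with [X = c' x e] and [Y = e' x e].  The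
    ruling is an asymptotic direction, so the Gaussian curvature is governed by
    [e' . N u], which is a constant [m] along the ruling, and the mean curvature by
    [P u = |e|^2 ((c'' + u e'') . N u) - 2 ((c' + u e') . e) m], a quadratic
    polynomial in [u].  Principal curvatures of ratio [a] satisfy
    [(k1 + k2)^2 = A k1 k2] with [A = (a + 1)^2 / a], which becomes
      [P u ^+ 2 = - A m ^+ 2 |N u|^2]
    on an interval of values of [u], hence identically ([ruling_coefficients]).  The
    quadratic polynomial [|X|^2 + 2 (X . Y) u + |Y|^2 u^2 = |N u|^2] has Gram
    determinant [|e|^2 m^2]; when [m] is nonzero it is therefore not a square up to
    a constant, and [A = 0], [a = -1], [P = 0].  When [m = 0] the Gaussian curvature
    can be nonzero only if [N u = 0], so that [X = Y = 0].

    If [X] and [Y] vanish for all parameters, all rulings lie in one line, which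
    contains no surface ([ruling_in_line], [surface_not_in_line]).  Otherwise the
    surface is minimal and the three coefficients of [P] vanish for all parameters
    ([ruled_dichotomy]); Catalan's theorem is then derived from them
    ([ruling_in_helicoid]): that of [u^2] forces the rulings to be parallel to a
    fixed plane, that of [u] makes the angle of the ruling an affine function of the
    height, the constant one makes all rulings meet a fixed axis.

    Two points make the above less immediate than it looks.  The parametrization by
    [t] and [u] need not be regular, and the curvatures are those of charts bearing
    no relation to it.  The inverse of a chart being merely continuous, a curve
    drawn on the surface is compared with a chart through the notion [osculates]:
    its velocity and acceleration have the form forced by the 2-jet of the chart
    ([chart_curve_jet]).  This is enough to read both fundamental forms on any two
    directions ([forms_pullback]).  Moreover the segments selected on the rulings
    may vary without any regularity in [t], so that a ruling need not be
    accompanied by neighbouring points on the surface.  For all but countably many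
    [t], however, there are parameters accumulating at [t] whose segments share with
    that of [t] an interval with rational endpoints ([condensation_ruling]), and
    derivatives can be computed along such parameters; the resulting equations
    extend by continuity.

    Conversely a surface contained in a helicoid has its charts osculated by the
    chart of the helicoid, so that the numerators of its mean and Gaussian
    curvatures are those of the helicoid up to a common positive factor
    ([subsurface_forms], [helicoid_part_ratio]). *)

(** * Taylor estimates and the identity theorem *)

Section TaylorEstimate.
Variable R : realType.
Implicit Types (I D : set R) (f g : R -> R).

(** The terms of a series convergent at K are bounded, so the tail at x is
    dominated by a geometric series of ratio |x| / |K| <= 1/2. *)
Lemma pseries_tail_le (c : R ^nat) (K : R) : K != 0 -> cvgn (pseries c K) ->
  exists2 C, 0 <= C & forall n x, `|x| <= `|K| / 2 ->
    `|limn (pseries c x) - \sum_(k < n) c k * x ^+ k| <= C * (`|x| / `|K|) ^+ n.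
Proof.
move=> K0 cK; have [B [_ BP]] := cvg_series_bounded cK.
have cB k : `|c k| * `|K| ^+ k <= `|B| + 1.
  rewrite -normrX -normrM; apply: BP => //.
  by rewrite (le_lt_trans (ler_norm B))// ltrDl.
have K_gt0 : 0 < `|K| by rewrite normr_gt0.
have B0 : 0 <= `|B| + 1 by rewrite addr_ge0.
exists ((`|B| + 1) * 2) => [|n x xK]; first by rewrite mulr_ge0.
have xK1 : `|x| < `|K| by rewrite (le_lt_trans xK)// gtr_pMr// invf_lt1// ltr1n.
set q := `|x| / `|K|.
have q0 : 0 <= q by rewrite divr_ge0.
have q2 : q <= 2^-1 by rewrite /q ler_pdivrMr// mulrC.
have q1 : q < 1 by rewrite (le_lt_trans q2)// invf_lt1// ltr1n.
have cx := is_cvg_pseries_inside cK xK1.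
have : `|pseries c x m - \sum_(k < n) c k * x ^+ k| @[m --> \oo] -->
       `|limn (pseries c x) - \sum_(k < n) c k * x ^+ k|.
  by apply: cvg_norm; apply: cvgB => //; exact: cvg_cst.
move/cvgr_to_le; apply; exists n => // m /= nm.
rewrite /pseries /series /= -(big_mkord predT (fun k => c k * x ^+ k)).
rewrite (big_cat_nat (n := n))//= [X in X - _]addrC addrK.
rewrite (le_trans (ler_norm_sum _ _ _))//.
apply: (@le_trans _ _ (\sum_(n <= k < m) (`|B| + 1) * q ^+ k)).
  apply: ler_sum => k _; rewrite normrM normrX.
  rewrite -(divfK (lt0r_neq0 K_gt0) `|x|) -/q exprMn [q ^+ k * _]mulrC mulrA.
  by rewrite ler_wpM2r// exprn_ge0.
rewrite -mulr_sumr -mulrA ler_wpM2l//.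
have h1q : 2^-1 <= 1 - q by lra.
have -> : \sum_(n <= k < m) q ^+ k = (q ^+ n - q ^+ m) / (1 - q).
  rewrite -(subnKC nm); elim: (m - n)%N => [|d IH].
    by rewrite addn0 big_geq// subrr mul0r.
  rewrite addnS big_nat_recr ?leq_addr//= IH.
  by rewrite exprS; field; rewrite subr_eq0 gt_eqF.
rewrite ler_pdivrMr; last by rewrite subr_gt0.
have qn : 0 <= q ^+ n by rewrite exprn_ge0.
have qm : 0 <= q ^+ m by rewrite exprn_ge0.
nra.
Qed.

(** Geometric bounds on all Taylor remainders relative to D.  This form of
    analyticity is stable under products by a direct estimate, makes sense at the
    endpoints of an interval, and implies the identity theorem. *)
Definition taylorable D f t0 := exists (a : R ^nat) (C r : R), 0 < r /\
  forall n t, D t -> `|t - t0| < r ->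
    `|f t - \sum_(k < n) a k * (t - t0) ^+ k| <= C * (`|t - t0| / r) ^+ n.

(** Relative to an isolated point of D the expansion would not have to converge
    anywhere else, whence the accumulation hypothesis: it provides a point of
    convergence distinct from the centre. *)
Lemma analytic_taylorable D f t0 : (forall r, 0 < r -> exists t, [/\ D t, t != t0 & `|t - t0| < r]) ->
  analytic_within D f t0 -> taylorable D f t0.
Proof.
move=> Dt0 [c [r [r0 fE]]]; have [t1 [Dt1 t1t0 t1r]] := Dt0 _ r0.
have K0 : t1 - t0 != 0 by rewrite subr_eq0.
have cK : cvgn (pseries c (t1 - t0)) by apply/cvg_ex; exists (f t1); exact: fE.
have [C C0 CP] := pseries_tail_le K0 cK.
have K_gt0 : 0 < `|t1 - t0| by rewrite normr_gt0.
exists c, C, (`|t1 - t0| / 2); split => [|n t Dt tr]; first by rewrite divr_gt0.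
have -> : f t = limn (pseries c (t - t0)).
  apply/esym/cvg_lim => //; apply: fE => //.
  by rewrite (lt_trans tr)// (le_lt_trans _ t1r)// ler_pdivrMr// ler_peMr// ler1n.
rewrite (le_trans (CP n _ (ltW tr)))// ler_wpM2l// lerXn2r ?nnegrE ?divr_ge0// ?divr_ge0//.
by rewrite ler_wpM2l// lef_pV2 ?posrE ?divr_gt0// ler_pdivrMr// ler_peMr// ler1n.
Qed.
End TaylorEstimate.

Section Taylorable.
Variable R : realType.
Implicit Types (D : set R) (f g : R -> R).

Lemma taylorable2 D f g t0 : taylorable D f t0 -> taylorable D g t0 ->
  exists (a b : R ^nat) (C r : R), [/\ 0 < r, 0 <= C,
   (forall n t, D t -> `|t - t0| < r ->
    `|f t - \sum_(k < n) a k * (t - t0) ^+ k| <= C * (`|t - t0| / r) ^+ n) &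
   (forall n t, D t -> `|t - t0| < r ->
    `|g t - \sum_(k < n) b k * (t - t0) ^+ k| <= C * (`|t - t0| / r) ^+ n)].
Proof.
move=> [a [C [r [r0 aP]]]] [b [C' [r' [r'0 bP]]]].
have rr' : 0 < Num.min r r' by rewrite lt_min r0.
have mono x y n : 0 < x -> x <= y -> forall z : R, (`|z| / y) ^+ n <= (`|z| / x) ^+ n.
  move=> x0 xy z; have y0 := lt_le_trans x0 xy.
  by apply: lerXn2r; rewrite ?nnegrE ?divr_ge0 ?(ltW x0) ?(ltW y0)// ler_wpM2l// lef_pV2.
have pos x n : 0 < x -> forall z : R, 0 <= (`|z| / x) ^+ n.
  by move=> x0 z; rewrite exprn_ge0// divr_ge0// ltW.
exists a, b, (`|C| + `|C'|), (Num.min r r'); split => // n t Dt; rewrite lt_min => /andP[tr tr'].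
- rewrite (le_trans (aP n t Dt tr))// (@le_trans _ _ (`|C| * (`|t - t0| / r) ^+ n))//.
    by rewrite ler_wpM2r ?pos// ler_norm.
  by rewrite ler_pM ?pos ?lerDl// mono// ge_min lexx.
- rewrite (le_trans (bP n t Dt tr'))// (@le_trans _ _ (`|C'| * (`|t - t0| / r') ^+ n))//.
    by rewrite ler_wpM2r ?pos// ler_norm.
  by rewrite ler_pM ?pos ?lerDr// mono// ge_min lexx orbT.
Qed.

Lemma taylorable_cst D (c : R) t0 : taylorable D (fun=> c) t0.
Proof.
exists (fun k => c * (k == 0)%:R), `|c|, 1; split => // -[|n] t Dt _.
  by rewrite big_ord0 subr0 expr0 mulr1.
rewrite big_ord_recl big1 => [|k _]; last by rewrite /= mulr0 mul0r.
by rewrite /= ?expr0 !mulr1 addr0 subrr normr0 mulr_ge0// exprn_ge0// divr_ge0.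
Qed.

Lemma taylorableD D f g t0 : taylorable D f t0 -> taylorable D g t0 ->
  taylorable D (fun t => f t + g t) t0.
Proof.
move=> fT gT; have [a [b [C [r [r0 C0 aP bP]]]]] := taylorable2 fT gT.
exists (fun k => a k + b k), (C + C), r; split => // n t Dt tr.
under eq_bigr do rewrite mulrDl.
rewrite big_split/= opprD addrACA (le_trans (ler_normD _ _))// mulrDl.
by rewrite lerD ?aP ?bP.
Qed.

Lemma cauchy_product_sum (a b : R ^nat) x n :
  \sum_(k < n) (\sum_(j < k.+1) a j * b (k - j)%N) * x ^+ k =
  \sum_(j < n) a j * x ^+ j * \sum_(i < n - j) b i * x ^+ i.
Proof.
elim: n => [|n IH]; first by rewrite !big_ord0.
rewrite big_ord_recr/= IH [RHS](eq_bigr (fun j : 'I_n.+1 =>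
  a j * x ^+ j * (\sum_(i < n - j) b i * x ^+ i) + a j * b (n - j)%N * x ^+ n)).
  rewrite big_split/= [in RHS]big_ord_recr/= subnn big_ord0 mulr0 addr0.
  by rewrite -mulr_suml.
move=> j _; have jn : (j <= n)%N by rewrite -ltnS.
rewrite subSn// big_ord_recr/= mulrDr; congr (_ + _).
by rewrite mulrACA -exprD subnKC.
Qed.

(** The Cauchy product of the expansions.  Its remainder of order n is a sum of
    about n terms of size q^n; halving the radius absorbs the factor n in 2^n. *)
Lemma taylorableM D f g t0 : taylorable D f t0 -> taylorable D g t0 ->
  taylorable D (fun t => f t * g t) t0.
Proof.
move=> fT gT; have [a [b [C [r [r0 C0 aP bP]]]]] := taylorable2 fT gT.
(* the remainder is at most C^2 q^n + n (2 C^2 q^n), and 1 + 2 n <= 3 * 2^n *)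
exists (fun k => \sum_(j < k.+1) a j * b (k - j)%N), (3 * C ^+ 2), (r / 2).
split => [|n t Dt tr]; first by rewrite divr_gt0.
set x := t - t0; have xr : `|x| < r by apply: (lt_trans tr); lra.
rewrite cauchy_product_sum; set q := `|x| / r.
have q0 : 0 <= q by rewrite divr_ge0// ltW.
have q1 : q <= 1 by rewrite ler_pdivrMr// mul1r ltW.
have -> : `|x| / (r / 2) = 2 * q by rewrite /q; field; rewrite lt0r_neq0.
have aB j : `|a j * x ^+ j| <= 2 * C * q ^+ j.
  have -> : a j * x ^+ j = (f t - \sum_(k < j) a k * x ^+ k) -
      (f t - \sum_(k < j.+1) a k * x ^+ k) by rewrite big_ord_recr/=; ring.
  rewrite (le_trans (ler_normB _ _))//.
  have := aP j t Dt xr; have := aP j.+1 t Dt xr; rewrite -/x -/q exprS.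
  have : 0 <= C * q ^+ j by rewrite mulr_ge0// exprn_ge0.
  nra.
have gB : `|g t| <= C by have := bP 0%N t Dt xr; rewrite big_ord0 subr0 expr0 mulr1.
have -> : f t * g t - \sum_(j < n) a j * x ^+ j * (\sum_(i < n - j) b i * x ^+ i) =
   (f t - \sum_(j < n) a j * x ^+ j) * g t +
   \sum_(j < n) a j * x ^+ j * (g t - \sum_(i < n - j) b i * x ^+ i).
  under [X in _ = _ + X]eq_bigr do rewrite mulrBr.
  by rewrite sumrB -mulr_suml; ring.
have qn : 0 <= q ^+ n by rewrite exprn_ge0.
rewrite (le_trans (ler_normD _ _))// normrM.
apply: (@le_trans _ _ (C * q ^+ n * C + \sum_(j < n) 2 * C ^+ 2 * q ^+ n)).
  rewrite lerD//; first by rewrite ler_pM// aP.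
  rewrite (le_trans (ler_norm_sum _ _ _))//; apply: ler_sum => j _.
  rewrite normrM.
  have -> : 2 * C ^+ 2 * q ^+ n = (2 * C * q ^+ j) * (C * q ^+ (n - j)).
    by rewrite mulrACA -exprD subnKC ?expr2 1?mulrA// ltnW.
  by rewrite ler_pM// bP.
rewrite sumr_const card_ord [(2 * q) ^+ n]exprMn -[X in _ + X <= _]mulr_natr.
have n2 : n%:R <= 2 ^+ n :> R.
  by rewrite -natrX ler_nat ltnW// ltn_expl.
have n1 : 1 <= 2 ^+ n :> R by rewrite -natrX ler1n expn_gt0.
have : 0 <= C ^+ 2 * q ^+ n by rewrite mulr_ge0// exprn_ge0.
set z := C ^+ 2 * q ^+ n => z0.
have -> : C * q ^+ n * C + 2 * C ^+ 2 * q ^+ n * n%:R = z * (1 + 2 * n%:R) by rewrite /z; ring.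
have -> : 3 * C ^+ 2 * (2 ^+ n * q ^+ n) = z * (3 * 2 ^+ n) by rewrite /z; ring.
by rewrite ler_wpM2l//; lra.
Qed.

Lemma taylorable_sum n D (F : 'I_n -> R -> R) t0 : (forall i, taylorable D (F i) t0) ->
  taylorable D (fun t => \sum_i F i t) t0.
Proof.
elim: n F => [|n IH] F FT.
  by under eq_fun do rewrite big_ord0; exact: taylorable_cst.
by under eq_fun do rewrite big_ord_recr; apply: taylorableD => //; exact: IH.
Qed.

Lemma taylorable_cvg D f t0 : D t0 -> taylorable D f t0 ->
  f @ within D (nbhs t0) --> f t0.
Proof.
move=> Dt0 [a [C [r [r0 aP]]]].
have a0 : f t0 = a 0%N.
  have := aP 1%N t0 Dt0; rewrite subrr normr0 => /(_ r0).
  by rewrite mul0r expr1 mulr0 big_ord1 expr0 mulr1 normr_le0 subr_eq0 => /eqP.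
apply/cvgrPdist_le => e e0; rewrite near_withinE; near=> t => Dt.
have tr : `|t - t0| < r by rewrite distrC; near: t; apply/nbhs_ballP; exists r.
rewrite a0 distrC; have := aP 1%N t Dt tr; rewrite big_ord1 expr0 mulr1 expr1 => /le_trans; apply.
have : `|t - t0| <= e * r / (`|C| + 1).
  rewrite distrC; apply/ltW; near: t; apply/nbhs_ballP; exists (e * r / (`|C| + 1)) => //=.
  by rewrite divr_gt0 ?mulr_gt0 ?ltr_wpDl.
rewrite ler_pdivlMr ?ltr_wpDl// => H; rewrite mulrA ler_pdivrMr//.
have := ler_norm C; have := normr_ge0 (t - t0); nra.
Unshelve. all: by end_near. Qed.

(** Zeros accumulating at t0 kill the Taylor coefficients one after the other:
    the first nonzero one would dominate the remainder of the next order. *)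
Lemma taylorable_eq0 D f t0 : taylorable D f t0 ->
  (forall r, 0 < r -> exists t, [/\ D t, t != t0, `|t - t0| < r & f t = 0]) ->
  exists2 r, 0 < r & forall t, D t -> `|t - t0| < r -> f t = 0.
Proof.
move=> [a [C [r [r0 aP]]]] Z.
have a0 n : a n = 0.
  elim/ltn_ind: n => n IH; apply: contrapT => /eqP an0.
  have anP : 0 < `|a n| by rewrite normr_gt0.
  (* within distance d of t0 the term of degree n exceeds the remainder of order n + 1 *)
  pose d := Num.min r (`|a n| * r ^+ n.+1 / (`|C| + 1)).
  have d0 : 0 < d by rewrite lt_min r0 divr_gt0 ?mulr_gt0 ?exprn_gt0 ?ltr_wpDl.
  have [t [Dt tt0 td ft]] := Z _ d0.
  move: td; rewrite lt_min => /andP[tr td].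
  have := aP n.+1 t Dt tr; rewrite big_ord_recr/= big1 => [|k _]; last by rewrite IH ?mul0r.
  rewrite ft !add0r normrN normrM normrX.
  set x := `|t - t0| in tr td *; have x0 : 0 < x by rewrite normr_gt0 subr_eq0.
  move=> H; have rn : 0 < r ^+ n.+1 by rewrite exprn_gt0.
  have : `|a n| * r ^+ n.+1 <= C * x.
    rewrite -(ler_pM2r (exprn_gt0 n x0)) mulrAC.
    have -> : C * x * x ^+ n = C * (x / r) ^+ n.+1 * r ^+ n.+1.
      by rewrite expr_div_n -[RHS]mulrA divfK ?lt0r_neq0// exprS mulrA.
    by rewrite ler_pM2r.
  move: td; rewrite ltr_pdivlMr ?ltr_wpDl// => td; move: (ler_norm C) => ?.
  by apply/negP; rewrite -ltNge; nra.
exists r => // t Dt tr; apply/eqP; rewrite -normr_le0; apply/ler_addgt0Pl => e e0.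
rewrite addr0.
have q1 : `| `|t - t0| / r| < 1 by rewrite [ltLHS]ger0_norm ?divr_ge0 ?(ltW r0)// ltr_pdivrMr// mul1r.
have : C * (`|t - t0| / r) ^+ n @[n --> \oo] --> C * 0.
  by apply: cvgMl_tmp; exact: cvg_expr.
rewrite mulr0 => /cvgr0_norm_le /(_ _ e0)[N _ /(_ N)/= /(_ (leqnn N)) H].
have := aP N t Dt tr; rewrite big1 => [|k _]; last by rewrite a0 mul0r.
by rewrite subr0 => /le_trans; apply; exact: le_trans (ler_norm _) H.
Qed.

(** The points near which f vanishes form a set which is open by definition and
    closed by [taylorable_eq0]; connectedness does the rest. *)
Lemma taylorable_identity D f t1 : connected D -> D t1 ->
  (forall t, D t -> forall r, 0 < r -> exists t', [/\ D t', t' != t & `|t' - t| < r]) ->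
  (forall t, D t -> taylorable D f t) ->
  (exists2 r, 0 < r & forall t, D t -> `|t - t1| < r -> f t = 0) ->
  forall t, D t -> f t = 0.
Proof.
move=> cD Dt1 acc fT [r1 r10 f1].
pose O := [set t | exists2 r, 0 < r & forall t', D t' -> `|t' - t| < r -> f t' = 0].
have oO : open O.
  rewrite openE => t [r r0 ft]; apply/nbhs_ballP; exists (r / 2) => /=; first by rewrite divr_gt0.
  move=> s; rewrite /ball/= => ts; exists (r / 2) => [|u Du us]; first by rewrite divr_gt0.
  apply: ft => //; rewrite -(subrK s u) -addrA (le_lt_trans (ler_normD _ _))//.
  by rewrite (splitr r) ltrD// distrC.
suff <- : D `&` O = D by move=> t [Dt [r r0]]; apply => //; rewrite subrr normr0.
apply: cD; first by exists t1; split => //; exists r1.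
- by exists O.
exists (closure (D `&` O)); first exact: closed_closure.
apply/seteqP; split => t [Dt Ot]; split => //; first exact: subset_closure.
have [Ot'|nOt] := pselect (O t) => //.
apply: taylorable_eq0; first exact: fT.
move=> r r0; have [|s [[Ds [e e0 fe]] ts]] := Ot (ball t r); first exact: nbhsx_ballx.
exists s; split => //.
- by apply/eqP => st; apply: nOt; rewrite -st; exists e.
- by rewrite distrC.
- by apply: fe => //; rewrite subrr normr0.
Qed.
End Taylorable.

(** * Derivatives and 2-jets of real-analytic functions *)

Section PseriesDerivative.
Variable R : realType.
Implicit Types (I D : set R) (f g : R -> R).

(** Since (s - |x|) (k + 1) |x|^k <= s^(k + 1) for |x| < s, the
    derived series at x is dominated by the original one at s. *)
Lemma is_cvg_pseries_diffs (c : R ^nat) (K x : R) : cvgn (pseries c K) -> `|x| < `|K| ->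
  cvgn (pseries (pseries_diffs c) x).
Proof.
move=> cK xK; pose s := (`|x| + `|K|) / 2.
have xs : `|x| < s by rewrite /s; lra.
have s0 : 0 <= s by rewrite (le_trans _ (ltW xs)).
have sK : `|s| < `|K| by rewrite ger0_norm// /s; lra.
have cs := is_cvg_pseries_inside_norm cK sK.
apply: normed_cvg; rewrite /normed_series_of /=.
apply: (@series_le_cvg _ _ (fun k => (s - `|x|)^-1 * (`|c k.+1| * s ^+ k.+1))).
- by move=> k; rewrite normr_ge0.
- by move=> k; rewrite mulr_ge0 ?invr_ge0 ?subr_ge0 ?(ltW xs)// mulr_ge0// exprn_ge0.
- move=> k; rewrite /pseries_diffs !normrM normr_nat normrX.
  rewrite ler_pdivlMl ?subr_gt0//.
  have -> : (s - `|x|) * (k.+1%:R * `|c k.+1| * `|x| ^+ k) =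
      `|c k.+1| * ((s - `|x|) * (k.+1%:R * `|x| ^+ k)) by ring.
  rewrite ler_wpM2l//.
  have : (s - `|x|) * \sum_(i < k.+1) `|x| ^+ k <= s ^+ k.+1.
    apply: (@le_trans _ _ (s ^+ k.+1 - `|x| ^+ k.+1)); last by rewrite gerBl exprn_ge0.
    rewrite subrXX ler_wpM2l ?subr_ge0 ?(ltW xs)//; apply: ler_sum => i _ /=.
    have ik : (i <= k)%N by rewrite -ltnS.
    rewrite -{1}(subnK ik) exprD ler_wpM2r ?exprn_ge0//.
    by rewrite lerXn2r ?nnegrE// ltW.
  by rewrite sumr_const card_ord mulr_natl.
have -> : series (fun k => (s - `|x|)^-1 * (`|c k.+1| * s ^+ k.+1)) =
  (fun n => (s - `|x|)^-1 * (series (fun k => `|c k| * s ^+ k) n.+1 - `|c 0%N| * s ^+ 0)).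
  apply/funext => n; rewrite /series/= -mulr_sumr big_nat_recl//.
  by rewrite [X in _ = _ * (X - _)]addrC addrK.
apply: is_cvgMl_tmp; apply: is_cvgB; last exact: is_cvg_cst.
by apply/cvg_ex; exists (limn (pseries (fun k => `|c k|) s)); rewrite cvg_shiftS.
Qed.

Lemma pseries_at0 (c : R ^nat) : pseries c 0 @ \oo --> c 0%N.
Proof.
rewrite -cvg_shiftS; apply: cvg_near_cst; near=> n.
rewrite /pseries /series/= big_nat_recl// expr0 mulr1 big1 ?addr0// => k _.
by rewrite expr0n mulr0.
Unshelve. all: by end_near. Qed.

(** Termwise differentiation inside the disc of convergence; the intermediate
    radii K < K1 < K2 leave room for the series differentiated twice. *)
Lemma pseries_derive (c : R ^nat) (r : R) f t0 :
  (forall t, `|t - t0| < r -> pseries c (t - t0) @ \oo --> f t) ->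
  forall t, `|t - t0| < r -> is_derive t 1 f (derive1 f t) /\
     pseries (pseries_diffs c) (t - t0) @ \oo --> derive1 f t.
Proof.
move=> fE t tr; set x := t - t0; pose K := (`|x| + r) / 2.
have xK : `|x| < K by rewrite /K; move: tr; rewrite -/x; lra.
have K0 : 0 <= K by rewrite (le_trans _ (ltW xK)).
pose K1 := (K + r) / 2.
have KK1 : `|K| < `|K1| by rewrite ger0_norm// ger0_norm /K1; move: tr; rewrite -/x /K; have := normr_ge0 x; lra.
pose K2 := (K1 + r) / 2.
have K10 : 0 <= K1 by rewrite /K1; move: tr; rewrite -/x /K; have := normr_ge0 x; lra.
have KK2 : `|K1| < `|K2| by rewrite ger0_norm// ger0_norm /K2 /K1; move: tr; rewrite -/x /K; have := normr_ge0 x; lra.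
have cK2 : cvgn (pseries c K2).
  apply/cvg_ex; exists (f (t0 + K2)); rewrite -{1}(addKr t0 K2) addrC; apply: fE.
  rewrite addrC addKr ger0_norm /K2 /K1; move: tr; rewrite -/x /K; have := normr_ge0 x; lra.
have cK1 := is_cvg_pseries_diffs cK2 KK2.
have cK := is_cvg_pseries_diffs cK1 KK1.
have xKn : `|x| < `|K| by rewrite [ltRHS]ger0_norm.
have D : is_derive x 1 (fun x => limn (pseries c x)) (limn (pseries (pseries_diffs c) x)).
  apply: pseries_snd_diffs xKn => //.
    by apply: is_cvg_pseries_inside cK2 _; exact: lt_trans KK1 KK2.
  by apply: is_cvg_pseries_inside cK1 _.
have D' : is_derive t 1 f (limn (pseries (pseries_diffs c) x)).
  have -> : limn (pseries (pseries_diffs c) x) = limn (pseries (pseries_diffs c) x) * 1 by rewrite mulr1.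
  apply: (@near_eq_is_derive _ _ _ ((fun x => limn (pseries c x)) \o (fun t => t - t0))).
  - near=> s => /=; apply/cvg_lim => //; apply: fE.
    near: s; apply/nbhs_ballP; exists (r - `|x|) => /=; first by rewrite subr_gt0.
    move=> s; rewrite /ball/= ltrBrDr => H.
    have -> : s - t0 = x - (t - s) by rewrite /x; ring.
    by rewrite (le_lt_trans (ler_normB _ _))// addrC.
  - have D1 : is_derive t 1 (fun t => t - t0) (1 : R).
      by rewrite -[X in is_derive _ _ _ X]subr0; exact: is_deriveB.
    exact: (@is_derive1_comp _ (fun x => limn (pseries c x)) (fun t => t - t0) t _ _ D D1).
split; first by apply: (is_derive_eq D'); rewrite derive1E derive_val.
have -> : derive1 f t = limn (pseries (pseries_diffs c) x) by rewrite derive1E derive_val.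
exact: (is_cvg_pseries_inside cK1 (lt_trans xKn KK1)).
Unshelve. all: by end_near. Qed.

End PseriesDerivative.

Section SecondOrderJet.
Variable R : realType.
Implicit Types (I D : set R) (f g : R -> R) (F : set_system R).

(** Second-order expansion of f at t0 along the filter F: v is the velocity and
    w the acceleration.  F may be one-sided, or carried by a thin set accumulating
    at t0; this is what allows such curves to be tested against a chart. *)
Definition jet2 F f t0 v w := (fun t => (f t - f t0 - (t - t0) * v - (t - t0) ^+ 2 / 2 * w) / (t - t0) ^+ 2) @ F --> (0 : R).

Lemma analytic_interior I f t0 : nbhs t0 I -> analytic_within I f t0 -> analytic_within setT f t0.
Proof.
move=> /nbhs_ballP[e /= e0 eI] [c [r [r0 fE]]].
exists c, (Num.min e r); split; first by rewrite lt_min e0.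
move=> t _; rewrite lt_min => /andP[te tr]; apply: fE => //; apply: eI.
by rewrite /ball/= distrC.
Qed.

Lemma analytic_is_derive f t0 : analytic_within setT f t0 -> is_derive t0 1 f (derive1 f t0).
Proof.
move=> [c [r [r0 fE]]].
have [|//] := @pseries_derive _ c r f t0 (fun t => fE t I) t0.
by rewrite subrr normr0.
Qed.

Lemma analytic_derive1 f t0 : analytic_within setT f t0 -> analytic_within setT (derive1 f) t0.
Proof.
move=> [c [r [r0 fE]]]; exists (pseries_diffs c), r; split => // t _ tr.
by have [] := @pseries_derive _ c r f t0 (fun t => fE t I) t tr.
Qed.

Lemma analytic_continuous f t0 : analytic_within setT f t0 -> f @ t0 --> f t0.
Proof.
move=> /analytic_is_derive fD; apply: differentiable_continuous.
by apply/derivable1_diffP.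
Qed.

Lemma analytic_jet2 f t0 : analytic_within setT f t0 ->
  jet2 t0^' f t0 (derive1 f t0) (derive1 (derive1 f) t0).
Proof.
move=> [c [r [r0 fE]]].
have {}fE t : `|t - t0| < r -> pseries c (t - t0) @ \oo --> f t by exact: fE.
have f1E t : `|t - t0| < r -> pseries (pseries_diffs c) (t - t0) @ \oo --> derive1 f t.
  by move=> tr; have [] := pseries_derive fE tr.
have f2E t : `|t - t0| < r -> pseries (pseries_diffs (pseries_diffs c)) (t - t0) @ \oo --> derive1 (derive1 f) t.
  by move=> tr; have [] := pseries_derive f1E tr.
have t0r : `|t0 - t0| < r by rewrite subrr normr0.
have val (d : R ^nat) l : pseries d (t0 - t0) @ \oo --> l -> l = d 0%N.
  by rewrite subrr => /cvg_lim <- //; apply/cvg_lim => //; exact: pseries_at0.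
rewrite (val _ _ (f1E _ t0r)) (val _ _ (f2E _ t0r)) /jet2 (val _ _ (fE _ t0r)).
rewrite /pseries_diffs.
have K0 : r / 2 != 0 by rewrite mulf_neq0 ?invr_neq0 ?lt0r_neq0.
have r20 : 0 < r / 2 by rewrite divr_gt0.
have cK : cvgn (pseries c (r / 2)).
  apply/cvg_ex; exists (f (t0 + r / 2)); rewrite -{1}(addKr t0 (r / 2)) addrC; apply: fE.
  by rewrite addrC addKr gtr0_norm//; lra.
have [C C0 CP] := pseries_tail_le K0 cK.
rewrite gtr0_norm// in CP.
apply/cvgr0Pnorm_le => e e0; near=> t.
have tt0 : t != t0 by near: t; exact: nbhs_dnbhs_neq.
set x := t - t0; have x0 : 0 < `|x| by rewrite normr_gt0 subr_eq0.
have xr : `|x| <= r / 2 / 2.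
  rewrite /x distrC; apply/ltW; near: t; apply: nbhs_dnbhs; apply/nbhs_ballP.
  by exists (r / 2 / 2) => //=; rewrite divr_gt0.
have := CP 3%N x xr.
have -> : limn (pseries c x) = f t by apply/cvg_lim => //; apply: fE; rewrite -/x; lra.
rewrite !big_ord_recr big_ord0/= add0r expr0 mulr1 expr1.
have -> : f t - (c 0%N + c 1%N * x + c 2%N * x ^+ 2) =
   f t - c 0%N - x * (1 * c 1%N) - x ^+ 2 / 2 * (1 * (2 * c 2%N)) by field.
rewrite normrM normfV normrX ler_pdivrMr ?exprn_gt0// => /le_trans; apply.
have -> : C * (`|x| / (r / 2)) ^+ 3 = `|x| ^+ 2 * (C * `|x| / (r / 2) ^+ 3).
  by field; rewrite lt0r_neq0.
rewrite [leRHS]mulrC ler_wpM2l ?exprn_ge0// ler_pdivrMr ?exprn_gt0//.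
have : `|x| <= e * (r / 2) ^+ 3 / (C + 1).
  rewrite /x distrC; apply/ltW; near: t; apply: nbhs_dnbhs; apply/nbhs_ballP.
  by exists (e * (r / 2) ^+ 3 / (C + 1)) => //=; rewrite divr_gt0 ?mulr_gt0 ?exprn_gt0// ltr_wpDl.
by rewrite ler_pdivlMr ?ltr_wpDl//; lra.
Unshelve. all: by end_near. Qed.

Lemma jet2_sub F G f t0 v w : F --> G -> jet2 G f t0 v w -> jet2 F f t0 v w.
Proof. by move=> FG; apply: cvg_trans; apply: cvg_app. Qed.

Lemma cvg_increment F t0 : Filter F -> F --> t0^' -> (t - t0) @[t --> F] --> (0 : R).
Proof.
move=> FF Ft0; rewrite -(subrr t0); apply: cvgB; last exact: cvg_cst.
by apply: cvg_trans Ft0 _; exact: cvg_within.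
Qed.

Lemma near_neq F t0 : F --> t0^' -> \forall t \near F, t != t0.
Proof. by move=> Ft0; exact: (Ft0 [set t | t != t0] (@nbhs_dnbhs_neq _ t0)). Qed.

(** Applied to each coordinate, this gives the 2-jet of a point that slides
    with constant speed s along a moving line. *)
Lemma jet2_affine F f g t0 (u s v v' w w' : R) : Filter F -> F --> t0^' -> jet2 F f t0 v w -> jet2 F g t0 v' w' ->
  jet2 F (fun t => f t + (u + s * (t - t0)) * g t) t0 (v + u * v' + s * g t0) (w + u * w' + 2 * s * v').
Proof.
move=> FF Ft0 fJ gJ; rewrite /jet2.
have x0 : (t - t0) @[t --> F] --> (0 : R) by exact: cvg_increment.
have H : (fun t => (f t - f t0 - (t - t0) * v - (t - t0) ^+ 2 / 2 * w) / (t - t0) ^+ 2 + (u + s * (t - t0)) * ((g t - g t0 - (t - t0) * v' - (t - t0) ^+ 2 / 2 * w') / (t - t0) ^+ 2) + s * w' / 2 * (t - t0)) @ F --> (0 + (u + s * 0) * 0 + s * w' / 2 * 0 : R).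
  apply: cvgD; first apply: cvgD => //.
    apply: cvgM => //; apply: cvgD; first exact: cvg_cst.
    by apply: cvgM => //; exact: cvg_cst.
  by apply: cvgM => //; exact: cvg_cst.
rewrite !mulr0 !addr0 in H; apply: cvg_trans H; apply: near_eq_cvg.
apply: filterS (near_neq Ft0) => t tt0; field.
by rewrite subr_eq0.
Qed.
End SecondOrderJet.

(** * Double power series *)

Section DoubleSeries.
Variable R : realType.
Implicit Types (c : nat -> nat -> R) (r h s : R) (G : R -> R -> R).

Definition double_term c h s k := \sum_(i < k.+1) c i (k - i)%N * h ^+ i * s ^+ (k - i).

Definition double_series c r G := [/\ 0 < r,
  cvgn (series (fun k : nat => \sum_(i < k.+1) `|c i (k - i)%N| * r ^+ k)) &
  forall h s, `|h| < r -> `|s| < r -> series (double_term c h s) @ \oo --> G h s].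

Lemma double_series_swap c r G : double_series c r G ->
  double_series (fun i j => c j i) r (fun h s => G s h).
Proof.
have rev (F : nat -> nat -> R) k : \sum_(i < k.+1) F (k - i)%N i = \sum_(i < k.+1) F i (k - i)%N.
  rewrite [LHS](reindex_inj rev_ord_inj); apply: eq_bigr => i _ /=.
  by rewrite subSS subKn// -ltnS.
move=> [r0 cr cG]; split => // [|h s hr sr].
- by under eq_fun do rewrite (rev (fun i j => `|c i j| * r ^+ _)).
- rewrite (_ : double_term _ _ _ = double_term c s h); first exact: cG.
  apply/funext => k; rewrite /double_term (rev (fun i j => c i j * h ^+ j * s ^+ i)).
  by apply: eq_bigr => i _; rewrite mulrAC.
Qed.

(** Absolute convergence on the polydisc of radius r: when the monomials with
    indices in P are at most w times their values at (r, r), so is their sum with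
    coefficients, up to the constant M. *)
Lemma double_series_bound c r G : double_series c r G -> exists2 M, 0 <= M &
  forall (P : nat -> nat -> bool) w h s n, 0 <= w ->
   (forall i j, P i j -> `|h| ^+ i * `|s| ^+ j <= w * r ^+ (i + j)) ->
   \sum_(k < n) \sum_(i < k.+1 | P i (k - i)%N) `|c i (k - i)%N * h ^+ i * s ^+ (k - i)| <= w * M.
Proof.
move=> [r0 cr _]; have [M0 [_ MP]] := cvg_seq_bounded cr.
exists (`|M0| + 1) => [|P w h s n w0 wP]; first by rewrite addr_ge0.
apply: (@le_trans _ _ (w * \sum_(k < n) \sum_(i < k.+1) `|c i (k - i)%N| * r ^+ k)).
  rewrite mulr_sumr; apply: ler_sum => k _; rewrite mulr_sumr.
  rewrite [leRHS](bigID (fun i : 'I__ => P i (k - i)%N))/= -[leLHS]addr0 lerD//.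
    apply: ler_sum => i Pi; rewrite -mulrA normrM mulrCA ler_wpM2l//.
    by rewrite normrM !normrX (le_trans (wP _ _ Pi))// subnKC// -ltnS.
  by apply: sumr_ge0 => i _; rewrite !mulr_ge0// exprn_ge0// ltW.
rewrite ler_wpM2l// (le_trans (ler_norm _))//.
have /MP /(_ n I) /= : M0 < `|M0| + 1 by rewrite (le_lt_trans (ler_norm M0))// ltrDl.
by rewrite /series/= big_mkord.
Qed.

(** Comparison of G with the subseries outside P, summed in any convenient
    grouping: the error is controlled by the weight of P.  With P the
    monomials of degree at least 3 this is Taylor's formula, with P the
    monomials of degree at least 2 in one variable it yields a partial derivative. *)
Lemma double_series_approx c r G (P : nat -> nat -> bool) : double_series c r G -> exists2 M, 0 <= M &
  forall w h s (u : R ^nat) L, `|h| < r -> `|s| < r -> 0 <= w ->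
   (forall i j, P i j -> `|h| ^+ i * `|s| ^+ j <= w * r ^+ (i + j)) ->
   (forall k, \sum_(i < k.+1 | ~~ P i (k - i)%N) c i (k - i)%N * h ^+ i * s ^+ (k - i) = u k) ->
   series u @ \oo --> L -> `|G h s - L| <= w * M.
Proof.
move=> DS; have [M M0 MP] := double_series_bound DS; have [r0 _ cG] := DS.
exists M => // w h s u L hr sr w0 wP uE uL.
have : `|series (double_term c h s) n - series u n| @[n --> \oo] --> `|G h s - L|.
  by apply: cvg_norm; apply: cvgB => //; exact: cG.
move/cvgr_to_le; apply; near=> n.
rewrite /series/= -sumrB (le_trans (ler_norm_sum _ _ _))//.
rewrite (le_trans _ (MP P w h s n w0 wP))// big_mkord; apply: ler_sum => k _.
rewrite /double_term -uE (bigID (fun i : 'I_ _ => P i (k - i)%N))/= addrK.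
exact: ler_norm_sum.
Unshelve. all: by end_near. Qed.

Lemma double_series_taylor2 c r G : double_series c r G -> exists2 K, 0 <= K &
  forall h s, `|h| < r -> `|s| < r ->
  `|G h s - (c 0%N 0%N + c 1%N 0%N * h + c 0%N 1%N * s + c 2%N 0%N * h ^+ 2
     + c 1%N 1%N * h * s + c 0%N 2%N * s ^+ 2)| <= K * (`|h| + `|s|) ^+ 3.
Proof.
move=> DS; have [r0 _ cG] := DS.
have [M M0 MP] := double_series_approx (fun i j => (3 <= i + j)%N) DS.
exists (r ^- 3 * M) => [|h s hr sr]; first by rewrite mulr_ge0// invr_ge0 exprn_ge0// ltW.
rewrite [leRHS]mulrAC; pose u k := if (k < 3)%N then double_term c h s k else 0.
pose y := `|h| + `|s|.
apply: (MP _ h s u) => //.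
- by rewrite mulr_ge0// ?invr_ge0 exprn_ge0// ?ltW// addr_ge0.
- move=> i j ij; have [yr|ry] := leP y r.
    apply: (@le_trans _ _ (y ^+ (i + j))).
      rewrite exprD ler_pM ?exprn_ge0//; rewrite lerXn2r ?nnegrE ?addr_ge0// ?lerDl ?lerDr//.
    rewrite -(subnKC ij) !exprD -/y mulrACA [_ * r ^+ 3]mulrC mulrA mulfV ?mul1r; last first.
      by rewrite expf_neq0// lt0r_neq0.
    rewrite ler_wpM2l ?exprn_ge0 ?addr_ge0// lerXn2r ?nnegrE ?addr_ge0//; exact: ltW.
  apply: (@le_trans _ _ (r ^+ (i + j))).
    by rewrite exprD ler_pM ?exprn_ge0//; apply: lerXn2r; rewrite ?nnegrE ?(ltW r0) ?(ltW hr) ?(ltW sr).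
  rewrite ler_peMl ?exprn_ge0// ?(ltW r0)// ler_pdivlMl ?exprn_gt0// mulr1.
  by rewrite lerXn2r ?nnegrE ?addr_ge0// ltW.
- move=> k; rewrite /u; case: ltnP => k3.
    by rewrite /double_term; apply: eq_bigl => i; have ik : (i <= k)%N := ltn_ord i; rewrite (subnKC ik) -ltnNge k3.
  by apply: big1 => i; have ik : (i <= k)%N := ltn_ord i; rewrite (subnKC ik) k3.
rewrite -(cvg_shiftn 3); apply: cvg_near_cst; near=> n.
rewrite /series/= addnC big_nat_recl// !big_nat_recl// big1 => [|k _]; last by rewrite /u.
rewrite /u/= /double_term !big_ord_recr !big_ord0/=; ring.
Unshelve. all: by end_near. Qed.

End DoubleSeries.

Section DoubleSeriesDerivatives.
Variable R : realType.
Implicit Types (c : nat -> nat -> R) (r h s : R) (G : R -> R -> R).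

Lemma is_derive_cvg (V : normedModType R) (f : V -> R) (x v : V) (d : R) :
  h^-1 * (f (h *: v + x) - f x) @[h --> 0^'] --> d -> is_derive x v f d.
Proof.
move=> H; apply: DeriveDef; last by apply/cvg_lim.
by apply/cvg_ex; exists d.
Qed.

Lemma is_derive_quadratic (V : normedModType R) (f : V -> R) (x v : V) (d K r : R) : 0 < r ->
  (forall h, `|h| < r -> `|f (h *: v + x) - (f x + h * d)| <= K * h ^+ 2) -> is_derive x v f d.
Proof.
move=> r0 fK; apply: is_derive_cvg; apply: cvg_sub0; last exact: cvg_cst.
apply: (@cvg_to_0_linear _ _ K r r0) => h /andP[h0 hr].
have h0' : h != 0 by rewrite -normr_gt0.
rewrite (_ : _ - _ = h^-1 * (f (h *: v + x) - (f x + h * d))); last by rewrite /cst/=; field.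
rewrite normrM normfV ler_pdivrMl//; apply: (le_trans (fK h hr)).
by rewrite -[h ^+ 2]real_normK ?num_real// expr2 mulrCA.
Qed.

Lemma is_derive_line (V : normedModType R) (f : V -> R) (x v : V) (t d : R) :
  is_derive t 1 (fun h => f (h *: v + x)) d -> is_derive (t *: v + x) v f d.
Proof.
move=> [fD fd]; apply: is_derive_cvg; rewrite -fd.
move: fD; rewrite /derivable /= /derive => fD.
have -> : (fun h => h^-1 * (f (h *: v + (t *: v + x)) - f (t *: v + x))) =
  (fun h => h^-1 *: (((fun h => f (h *: v + x)) \o shift t) (h *: 1) - f (t *: v + x))).
  apply/funext => h /=; congr (_ * (f _ - _)).
  by rewrite addrA -scalerDl /GRing.scale/= mulr1.
exact: fD.
Qed.

Lemma double_series_axis c r G h : double_series c r G -> `|h| < r ->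
  pseries (fun i => c i 0%N) h @ \oo --> G h 0.
Proof.
move=> [r0 _ cG] hr; have := cG h 0 hr; rewrite normr0 => /(_ r0).
rewrite (_ : double_term c h 0 = (fun i => c i 0%N * h ^+ i))//.
apply/funext => k; rewrite /double_term big_ord_recr/= subnn expr0 mulr1 big1 ?add0r//.
by move=> i _; rewrite expr0n subn_eq0 leqNgt ltn_ord/= mulr0.
Qed.

(** The partial derivative at a point of the other axis is obtained by
    comparison with the terms of degree at most 1 in h. *)
Lemma double_series_slice c r G s : double_series c r G -> `|s| < r ->
  is_derive (0 : R) (1 : R) (fun h => G h s : R) (limn (pseries (c 1%N) s)) /\ pseries (c 1%N) s @ \oo --> limn (pseries (c 1%N) s).
Proof.
move=> DS sr; have [r0 _ cG] := DS.
have cB : cvgn (pseries (c 1%N) s).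
  apply: normed_cvg; rewrite /normed_series_of /=.
  have [M M0 MP] := double_series_bound DS.
  apply: nondecreasing_is_cvgn.
    by apply/nondecreasing_seqP => n; rewrite /series/= big_nat_recr//= lerDl.
  exists (M * r^-1) => _ [n _ <-].
  rewrite ler_pdivlMr// /series/= mulr_suml big_mkord.
  have H i j : i == 1%N -> `|r| ^+ i * `|s| ^+ j <= 1 * r ^+ (i + j).
    move=> _; rewrite mul1r exprD gtr0_norm// ler_wpM2l ?exprn_ge0 ?(ltW r0)//.
    by apply: lerXn2r; rewrite ?nnegrE ?(ltW r0)// ltW.
  have := MP (fun i _ => i == 1%N) 1 r s n.+1 ler01 H.
  rewrite mul1r; apply: le_trans.
  rewrite [leRHS]big_ord_recl/=.
  rewrite [X in X + _]big_pred0 ?add0r; last by move=> i; rewrite (ord1 i).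
  rewrite le_eqVlt; apply/orP; left; apply/eqP.
  apply: eq_bigr => k _; rewrite /bump/= add1n.
  rewrite (big_ord1_eq _ (fun i => `|c i (k.+1 - i)%N * r ^+ i * s ^+ (k.+1 - i)|) 1 k.+2)/=.
  by rewrite subn1/= expr1 mulrAC [in RHS]normrM (gtr0_norm r0).
split => //; have [M M0 MP] := double_series_approx (fun i _ => (2 <= i)%N) DS.
apply: (@is_derive_quadratic _ _ _ _ _ (M / r ^+ 2) r) => // h hr.
rewrite /GRing.scale/= mulr1 addr0.
pose u k := c 0%N k * s ^+ k + (if k is j.+1 then h * (c 1%N j * s ^+ j) else 0).
rewrite (_ : M / _ * _ = (`|h| / r) ^+ 2 * M); last first.
  by rewrite expr_div_n real_normK ?num_real//; ring.
apply: (MP _ h s u) => //.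
- by rewrite exprn_ge0// divr_ge0// ltW.
- move=> i j i2; rewrite -(subnKC i2); set m := (i - 2)%N.
  have -> : (`|h| / r) ^+ 2 * r ^+ (2 + m + j) = `|h| ^+ 2 * (r ^+ m * r ^+ j).
    by rewrite !exprD; field; rewrite lt0r_neq0.
  rewrite exprD -mulrA ler_wpM2l ?exprn_ge0//.
  by rewrite ler_pM ?exprn_ge0//; apply: lerXn2r; rewrite ?nnegrE ?(ltW r0)// ltW.
- move=> k; rewrite /u big_mkcond big_ord_recl/= subn0 expr0 mulr1; congr (_ + _).
  case: k => [|k]; first by rewrite big_ord0.
  rewrite big_ord_recl/= big1 ?addr0; first by rewrite /bump/= subn1/= expr1; ring.
  by move=> i _.
rewrite -cvg_shiftS (_ : [sequence _]_n = fun n => pseries (c 0%N) s n.+1 + h * pseries (c 1%N) s n).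
  apply: cvgD; last by apply: cvgM => //; exact: cvg_cst.
  by rewrite cvg_shiftS; exact: (double_series_axis (double_series_swap DS)).
apply/funext => n; rewrite /pseries/series/= /u big_split/=; congr (_ + _).
by rewrite big_nat_recl//= add0r -mulr_sumr.
Qed.

(** The functions A and B are the partial derivative in h along the two axes;
    differentiating them again in one variable gives the pure and the mixed
    second derivatives, which is all that a 2-jet requires. *)
Lemma double_series_partials c r G : double_series c r G ->
  exists (A B : R -> R), [/\ forall h, `|h| < r -> is_derive h (1 : R) (fun h => G h 0 : R) (A h),
    forall s, `|s| < r -> is_derive (0 : R) (1 : R) (fun h => G h s : R) (B s),
    A 0 = c 1%N 0%N /\ B 0 = c 1%N 0%N,
    is_derive (0 : R) (1 : R) A (2 * c 2%N 0%N) & is_derive (0 : R) (1 : R) B (c 1%N 1%N)].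
Proof.
move=> DS; have [r0 _ _] := DS; have r00 : `|0 - 0 : R| < r by rewrite subrr normr0.
have pE (c' : R ^nat) g : (forall s : R, `|s| < r -> pseries c' s @ \oo --> (g s : R)) ->
   [/\ forall s, `|s| < r -> is_derive s (1 : R) g (derive1 g s),
    forall s, `|s| < r -> pseries (pseries_diffs c') s @ \oo --> (derive1 g s : R) & g 0 = c' 0%N].
  move=> gE; have gE' s : `|s - 0| < r -> pseries c' (s - 0) @ \oo --> (g s : R).
    by rewrite subr0; exact: gE.
  split=> [s sr|s sr|].
  - by have [] := @pseries_derive _ c' r g 0 gE' s; rewrite subr0.
  - by have [] := @pseries_derive _ c' r g 0 gE' s; rewrite subr0.
  - have := gE 0; rewrite normr0 => /(_ r0) /cvg_lim <- //.
    by apply/cvg_lim => //; exact: pseries_at0.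
have [G1 G2 _] := pE _ _ (fun h => double_series_axis DS).
have [A1 A2 A3] := pE _ _ G2; have [_ _ A4] := pE _ _ A2.
have [B1 B2 B3] := pE _ _ (fun s hs => (double_series_slice DS hs).2).
have [_ _ B4] := pE _ _ B2.
exists (derive1 (fun h => G h 0)), (fun s => limn (pseries (c 1%N) s)); split => //.
- by move=> s sr; have [] := double_series_slice DS sr.
- by rewrite A3 B3 /pseries_diffs mul1r.
- have := A1 0; rewrite normr0 A4 /pseries_diffs => /(_ r0); rewrite mul1r; exact.
- by have := B1 0; rewrite normr0 B4 /pseries_diffs mul1r => /(_ r0); exact.
Qed.

End DoubleSeriesDerivatives.

(** * The 2-jet of an analytic chart *)

Section ChartJet.
Variable R : realType.
Implicit Types (f : 'rV[R]_2 -> R) (phi : 'rV[R]_2 -> 'rV[R]_3) (x : 'rV[R]_2).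

Lemma double_series_directional (V : normedModType R) (f : V -> R) (x v w : V) c r :
  double_series c r (fun h s => f (h *: v + (s *: w + x))) ->
  exists (A B : R -> R), [/\
    forall t, `|t| < r -> is_derive (t *: v + x) v f (A t),
    forall t, `|t| < r -> is_derive (t *: w + x) v f (B t),
    A 0 = c 1%N 0%N,
    is_derive (0 : R) (1 : R) A (2 * c 2%N 0%N) & is_derive (0 : R) (1 : R) B (c 1%N 1%N)].
Proof.
move=> DS; have [A [B [HA HB [A0 B0] dA dB]]] := double_series_partials DS.
exists A, B; split => // t tr.
- apply: is_derive_line; have := HA t tr.
  by under eq_fun do rewrite scale0r add0r.
- by have := is_derive_line (HB t tr); rewrite scale0r add0r.
Qed.

Lemma ord2P (P : 'I_2 -> Prop) : P 0 -> P 1 -> forall i, P i.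
Proof.
move=> P0 P1 [[|[|//]] i]; first by have -> : Ordinal i = 0 by exact: val_inj.
by have -> : Ordinal i = 1 by exact: val_inj.
Qed.

Lemma ord3P (P : 'I_3 -> Prop) : P 0 -> P 1 -> P 2%:R -> forall i, P i.
Proof.
move=> P0 P1 P2 [[|[|[|//]]] i]; first by have -> : Ordinal i = 0 by exact: val_inj.
  by have -> : Ordinal i = 1 by exact: val_inj.
by have -> : Ordinal i = 2%:R by exact: val_inj.
Qed.

Lemma row2E x x0 : x = (x 0 0 - x0 0 0) *: delta_mx 0 0 + ((x 0 1 - x0 0 1) *: delta_mx 0 1 + x0).
Proof. by apply/rowP; apply: ord2P; rewrite !mxE/=; ring. Qed.

Lemma analytic_at2_series f x0 : analytic_at2 f x0 -> exists c r,
  double_series c r (fun h s => f (h *: delta_mx 0 0 + (s *: delta_mx 0 1 + x0))).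
Proof.
move=> [c [r [r0 cr cf]]]; exists c, r; split => // h s hr sr.
set x := _ *: _ + _.
have x00 : x 0 0 - x0 0 0 = h by rewrite /x !mxE/=; ring.
have x01 : x 0 1 - x0 0 1 = s by rewrite /x !mxE/=; ring.
have := cf x; rewrite x00 x01; exact.
Qed.

Lemma derive_coord (V : normedModType R) n (phi : V -> 'rV[R]_n) (x v : V) (d : 'I_n -> R) :
  (forall k, is_derive x v (fun y => phi y 0 k) (d k)) -> derivable phi x v /\ forall k, 'D_v phi x 0 k = d k.
Proof.
move=> H; have D : derivable phi x v by apply/derivable_mxP => i j; rewrite (ord1 i); have [] := H j.
by split => // k; rewrite derive_mx// mxE derive_val.
Qed.

Lemma derive_coord2 (V : normedModType R) n (phi : V -> 'rV[R]_n) (x v w : V) (r : R) (B : 'I_n -> R -> R) (b : 'I_n -> R) : 0 < r ->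
  (forall k t, `|t| < r -> is_derive (t *: w + x) v (fun y => phi y 0 k) (B k t)) ->
  (forall k, is_derive (0 : R) (1 : R) (B k) (b k)) ->
  forall k, 'D_w ('D_v phi) x 0 k = b k.
Proof.
move=> r0 HB Hb; suff /derive_coord [_ //] : forall k, is_derive x w (fun y => 'D_v phi y 0 k) (b k).
move=> k; rewrite -(add0r x) -(scale0r w); apply: is_derive_line.
apply: near_eq_is_derive (Hb k); near=> t; apply/esym.
suff /derive_coord [_ //] : forall k, is_derive (t *: w + x) v (fun y => phi y 0 k) (B k t).
move=> l; apply: HB; rewrite -normrN -sub0r; near: t; apply/nbhs_ballP; exists r => //.
Unshelve. all: by end_near. Qed.

Definition quad (u v w : R) h s := (u * h ^+ 2 + 2 * v * h * s + w * s ^+ 2) / 2.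

(** The coefficients of the double series are identified with iterated partial
    derivatives; each order of differentiation requires one of the two orders of
    the variables, related by [double_series_swap]. *)
Lemma analytic_map_jet phi x0 : (forall k : 'I_3, analytic_at2 (fun y => phi y 0 k) x0) ->
  partial 0 (partial 1 phi) x0 = partial 1 (partial 0 phi) x0 /\
  exists (K r : R), [/\ 0 < r, 0 <= K & forall x k, `|x 0 0 - x0 0 0| < r -> `|x 0 1 - x0 0 1| < r ->
    `|phi x 0 k - (phi x0 0 k + partial 0 phi x0 0 k * (x 0 0 - x0 0 0) + partial 1 phi x0 0 k * (x 0 1 - x0 0 1)
     + quad (partial 0 (partial 0 phi) x0 0 k) (partial 1 (partial 0 phi) x0 0 k) (partial 1 (partial 1 phi) x0 0 k)
        (x 0 0 - x0 0 0) (x 0 1 - x0 0 1))| <= K * (`|x 0 0 - x0 0 0| + `|x 0 1 - x0 0 1|) ^+ 3].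
Proof.
move=> phiA; have /choice[c /choice[r DS]] := fun k => analytic_at2_series (phiA k).
have DS' k : double_series (fun i j => c k j i) (r k)
    (fun h s => phi (h *: delta_mx 0 1 + (s *: delta_mx 0 0 + x0)) 0 k).
  have := double_series_swap (DS k).
  by congr double_series; apply/funext => h; apply/funext => s; rewrite addrCA.
have r_gt0 k : 0 < r k by have [] := DS k.
pose rho := Num.min (r 0) (Num.min (r 1) (r 2%:R)).
have rho0 : 0 < rho by rewrite !lt_min !r_gt0.
have rhor t : t < rho -> forall k, t < r k.
  by rewrite !lt_min => /and3P[t0 t1 t2]; exact: (@ord3P (fun k => t < r k)).
have /choice[A /choice[B H]] := fun k => double_series_directional (f := fun y => phi y 0 k) (DS k).
have /choice[A' /choice[B' H']] := fun k => double_series_directional (f := fun y => phi y 0 k) (DS' k).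
have p0 k : partial 0 phi x0 0 k = c k 1%N 0%N.
  have [] // := @derive_coord _ _ phi x0 (delta_mx 0 0) (fun k => c k 1%N 0%N) _.
  by move=> l; have [HA _ <- _ _] := H l; have := HA 0; rewrite normr0 scale0r add0r; exact.
have p1 k : partial 1 phi x0 0 k = c k 0%N 1%N.
  have [] // := @derive_coord _ _ phi x0 (delta_mx 0 1) (fun k => c k 0%N 1%N) _.
  by move=> l; have [HA _ <- _ _] := H' l; have := HA 0; rewrite normr0 scale0r add0r; exact.
have p00 k : partial 0 (partial 0 phi) x0 0 k = 2 * c k 2%N 0%N.
  apply: (@derive_coord2 _ _ phi x0 _ _ _ A (fun k => 2 * c k 2%N 0%N) rho0) => l; have [HA _ _ dA _] := H l => //.
  by move=> t tr; apply: HA; exact: rhor.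
have p01 k : partial 1 (partial 0 phi) x0 0 k = c k 1%N 1%N.
  apply: (@derive_coord2 _ _ phi x0 _ _ _ B (fun k => c k 1%N 1%N) rho0) => l; have [_ HB _ _ dB] := H l => //.
  by move=> t tr; apply: HB; exact: rhor.
have p11 k : partial 1 (partial 1 phi) x0 0 k = 2 * c k 0%N 2%N.
  apply: (@derive_coord2 _ _ phi x0 _ _ _ A' (fun k => 2 * c k 0%N 2%N) rho0) => l; have [HA _ _ dA _] := H' l => //.
  by move=> t tr; apply: HA; exact: rhor.
have p10 k : partial 0 (partial 1 phi) x0 0 k = c k 1%N 1%N.
  apply: (@derive_coord2 _ _ phi x0 _ _ _ B' (fun k => c k 1%N 1%N) rho0) => l; have [_ HB _ _ dB] := H' l => //.
  by move=> t tr; apply: HB; exact: rhor.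
split; first by apply/rowP => k; exact: (etrans (p10 k) (esym (p01 k))).
have /choice[K HK] := fun k => let: ex_intro2 K K0 KP := double_series_taylor2 (DS k) in
  ex_intro (fun K => _ /\ _) K (conj K0 KP).
pose KK := K 0 + K 1 + K 2%:R.
have K0 k : 0 <= K k by have [] := HK k.
have KKP k : K k <= KK.
  by move: k; apply: ord3P; rewrite /KK; have := K0 0; have := K0 1; have := K0 2%:R; lra.
exists KK, rho; split => //; first by rewrite !addr_ge0.
move=> x k hr sr; set h := x 0 0 - x0 0 0; set s := x 0 1 - x0 0 1.
have [_ /(_ h s (rhor _ hr k) (rhor _ sr k)) HKk] := HK k.
have c00 : phi x0 0 k = c k 0%N 0%N.
  have [_ /(_ 0 0)] := HK k; rewrite normr0 => /(_ (r_gt0 k) (r_gt0 k)).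
  rewrite !scale0r !add0r [_ ^+ 3]expr0n/= !mulr0 normr_le0 subr_eq0 => /eqP ->.
  by ring.
have GE : phi (h *: delta_mx 0 0 + (s *: delta_mx 0 1 + x0)) 0 k = phi x 0 k.
  by rewrite /h /s -row2E.
rewrite GE in HKk.
suff final a0 a1 b00 b01 b11 : a0 = c k 1%N 0%N -> a1 = c k 0%N 1%N -> b00 = 2 * c k 2%N 0%N ->
   b01 = c k 1%N 1%N -> b11 = 2 * c k 0%N 2%N ->
   `|phi x 0 k - (phi x0 0 k + a0 * h + a1 * s + quad b00 b01 b11 h s)| <= KK * (`|h| + `|s|) ^+ 3.
  exact: final (p0 k) (p1 k) (p00 k) (p01 k) (p11 k).
move=> -> -> -> -> ->; rewrite c00 /quad.
set rhs := K k * _ in HKk.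
apply: (@le_trans _ _ rhs); last by rewrite ler_wpM2r// exprn_ge0// addr_ge0.
apply: le_trans HKk; rewrite le_eqVlt; apply/orP; left; apply/eqP; congr (`| _ |); by field.
Qed.
End ChartJet.

(** * Curves drawn on a surface *)

Section CurveAsymptotics.
Variable R : realType.
Implicit Types (u v w : 'rV[R]_3).

Lemma sum3E (F : 'I_3 -> R) : \sum_k F k = F 0 + F 1 + F 2%:R.
Proof.
rewrite !big_ord_recl big_ord0 addr0 addrA; congr (_ + F _ + F _); exact: val_inj.
Qed.

Lemma dotE u v : dot u v = u 0 0 * v 0 0 + u 0 1 * v 0 1 + u 0 2%:R * v 0 2%:R.
Proof. exact: sum3E. Qed.

Lemma cvg_row n (T : Type) (F : set_system T) (f : T -> 'rV[R]_n.+1) (l : 'rV[R]_n.+1) : Filter F ->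
  (forall k, f t 0 k @[t --> F] --> l 0 k) -> f @ F --> l.
Proof.
move=> FF H; apply/cvgrPdist_le => e e0; near=> t.
rewrite /Num.Def.normr/= mx_normrE (bigmax_le _ (ltW e0))//= => i _.
rewrite !mxE (ord1 i.1); move: i.2; near: t; apply: filter_forall => k.
exact: (cvgrPdist_le _ _).1 (H k) e e0.
Unshelve. all: by end_near. Qed.

Lemma jet2_velocity (F : set_system R) (f : R -> R) (t0 v w : R) : Filter F -> F --> t0^' -> jet2 F f t0 v w ->
  (f t - f t0) / (t - t0) @[t --> F] --> v.
Proof.
move=> FF Ft0 fJ.
have x0 : (t - t0) @[t --> F] --> (0 : R) by exact: cvg_increment.
have H : (fun t => (f t - f t0 - (t - t0) * v - (t - t0) ^+ 2 / 2 * w) / (t - t0) ^+ 2 * (t - t0) + v + (t - t0) * (w / 2)) @ F --> (0 * 0 + v + 0 * (w / 2) : R).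
  apply: cvgD; last by apply: cvgM => //; exact: cvg_cst.
  by apply: cvgD; [exact: cvgM|exact: cvg_cst].
rewrite !mul0r add0r addr0 in H; apply: cvg_trans H; apply: near_eq_cvg.
apply: filterS (near_neq Ft0) => t tt0; field.
by rewrite subr_eq0.
Qed.

Lemma jet2_continuous (F : set_system R) (f : R -> R) (t0 v w : R) : Filter F -> F --> t0^' -> jet2 F f t0 v w ->
  f @ F --> f t0.
Proof.
move=> FF Ft0 fJ; have H := jet2_velocity FF Ft0 fJ.
have x0 : (t - t0) @[t --> F] --> (0 : R) by exact: cvg_increment.
have {}H : (f t - f t0) / (t - t0) * (t - t0) + f t0 @[t --> F] --> (v * 0 + f t0 : R).
  by apply: cvgD; [exact: cvgM|exact: cvg_cst].
rewrite mulr0 add0r in H; apply: cvg_trans H; apply: near_eq_cvg.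
apply: filterS (near_neq Ft0) => t tt0; field.
by rewrite subr_eq0.
Qed.

Lemma cvg_coord m n (T : Type) (F : set_system T) (f : T -> 'M[R]_(m.+1, n.+1)) (l : 'M[R]_(m.+1, n.+1)) i j : Filter F ->
  f @ F --> l -> f t i j @[t --> F] --> l i j.
Proof. move=> FF fl; exact: (cvg_comp _ _ fl (@coord_continuous _ _ _ i j l)). Qed.

(** The comparison of a curve with a chart, in coordinates.  The parameters
    (h0, h1) of the curve in the chart are only known to tend to 0.  Applying a left
    inverse (B0, B1) of the differential shows first that they are O(t - t0), then
    that h / (t - t0) converges to some (w0, w1).  For n normal to the
    surface the linear terms disappear from the expansion of the curve, and
    dividing by (t - t0)^2 leaves the quadratic form of the chart at (w0, w1). *)
Lemma chart_curve_asymptotics (F : set_system R) (t0 : R) (a0 a1 b00 b01 b11 g1 g2 B0 B1: 'I_3 -> R) (g : 'I_3 -> R -> R) (h0 h1 : R -> R) (K : R) :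
  ProperFilter F -> F --> t0^' ->
  (forall k, jet2 F (g k) t0 (g1 k) (g2 k)) ->
  h0 @ F --> (0 : R) -> h1 @ F --> (0 : R) ->
  (\forall t \near F, forall k, `|g k t - g k t0 - a0 k * h0 t - a1 k * h1 t - quad (b00 k) (b01 k) (b11 k) (h0 t) (h1 t)| <= K * (`|h0 t| + `|h1 t|) ^+ 3) ->
  \sum_k a0 k * B0 k = 1 -> \sum_k a1 k * B0 k = 0 -> \sum_k a0 k * B1 k = 0 -> \sum_k a1 k * B1 k = 1 ->
  exists (w0 w1 : R), (forall k, g1 k = w0 * a0 k + w1 * a1 k) /\
    forall n, \sum_k n k * a0 k = 0 -> \sum_k n k * a1 k = 0 ->
     \sum_k n k * g2 k = w0 ^+ 2 * (\sum_k n k * b00 k) + 2 * w0 * w1 * (\sum_k n k * b01 k) + w1 ^+ 2 * (\sum_k n k * b11 k).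
Proof.
move=> PF Ft0 gJ h0F h1F HK B00 B01 B10 B11.
have tneq := near_neq Ft0.
have x0 : (t - t0) @[t --> F] --> (0 : R) by exact: cvg_increment.
have gV k : (g k t - g k t0) / (t - t0) @[t --> F] --> g1 k.
  exact: jet2_velocity Ft0 (gJ k).
pose y t := `|h0 t| + `|h1 t|.
have y0 t : 0 <= y t by rewrite addr_ge0.
have yF : y @ F --> (0 : R).
  by rewrite -(addr0 0); apply: cvgD; rewrite -(normr0 R); exact: cvg_norm.
pose E k t := g k t - g k t0 - a0 k * h0 t - a1 k * h1 t.
pose C := \sum_k (`|b00 k| + 2 * `|b01 k| + `|b11 k|) + `|K|.
have C0 : 0 <= C by rewrite addr_ge0// sumr_ge0// => k _; rewrite !addr_ge0// mulr_ge0.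
(* the deviation from the linear part is quadratic in the size y of (h0, h1) *)
have EC : \forall t \near F, forall k, `|E k t| <= C * y t ^+ 2.
  near=> t => k.
  have y1 : y t <= 1 by near: t; apply: (cvgr_le 0 yF); exact: ltr01.
  have HKt : `|E k t - quad (b00 k) (b01 k) (b11 k) (h0 t) (h1 t)| <= K * y t ^+ 3 by move: k; near: t.
  have qb : `|quad (b00 k) (b01 k) (b11 k) (h0 t) (h1 t)| <= (`|b00 k| + 2 * `|b01 k| + `|b11 k|) * y t ^+ 2.
    have a0' := normr_ge0 (h0 t); have a1' := normr_ge0 (h1 t).
    have -> : y t ^+ 2 = `|h0 t| ^+ 2 + 2 * `|h0 t| * `|h1 t| + `|h1 t| ^+ 2 by rewrite /y; ring.
    rewrite /quad normrM [`|2^-1|]gtr0_norm// ler_pdivrMr//.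
    rewrite (le_trans (ler_normD _ _))// (le_trans (lerD (ler_normD _ _) (lexx _)))//.
    rewrite !normrM [`|2|]gtr0_norm//.
    have := normr_ge0 (b00 k); have := normr_ge0 (b01 k); have := normr_ge0 (b11 k).
    move: a0' a1'; set p := `|h0 t|; set q := `|h1 t|; set B2 := `|b11 k|; set B1' := `|b01 k|; set B0' := `|b00 k|.
    move=> p0 q0 B20 B10' B00'.
    have p2 : 0 <= p ^+ 2 by rewrite sqr_ge0.
    have q2 : 0 <= q ^+ 2 by rewrite sqr_ge0.
    have pq : 0 <= p * q by rewrite mulr_ge0.
    have := mulr_ge0 B00' p2; have := mulr_ge0 B00' q2; have := mulr_ge0 B00' pq.
    have := mulr_ge0 B10' p2; have := mulr_ge0 B10' q2; have := mulr_ge0 B10' pq.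
    have := mulr_ge0 B20 p2; have := mulr_ge0 B20 q2; have := mulr_ge0 B20 pq.
    lra.
  rewrite -(subrK (quad (b00 k) (b01 k) (b11 k) (h0 t) (h1 t)) (E k t)) (le_trans (ler_normD _ _))//.
  have S1 : `|b00 k| + 2 * `|b01 k| + `|b11 k| <= \sum_k (`|b00 k| + 2 * `|b01 k| + `|b11 k|).
    by rewrite (bigD1 k)//= lerDl sumr_ge0// => j _; rewrite !addr_ge0// mulr_ge0.
  have hq : (`|b00 k| + 2 * `|b01 k| + `|b11 k|) * y t ^+ 2 <= \sum_k (`|b00 k| + 2 * `|b01 k| + `|b11 k|) * y t ^+ 2.
    by rewrite -mulr_suml ler_wpM2r// sqr_ge0.
  have hK : K * y t ^+ 3 <= `|K| * y t ^+ 2.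
    apply: (@le_trans _ _ (`|K| * y t ^+ 3)); first by rewrite ler_wpM2r ?exprn_ge0// ler_norm.
    by rewrite ler_wpM2l// exprS ler_piMl// sqr_ge0.
  rewrite /C mulrDl mulr_suml addrC lerD//; [exact: le_trans qb hq|exact: le_trans HKt hK].
pose beta := \sum_k (`|B0 k| + `|B1 k|).
have beta0 : 0 <= beta by apply: sumr_ge0 => k _; rewrite addr_ge0.
have h0E t : h0 t = \sum_k (g k t - g k t0 - E k t) * B0 k.
  rewrite (eq_bigr (fun k => h0 t * (a0 k * B0 k) + h1 t * (a1 k * B0 k))); last by move=> k _; rewrite /E; ring.
  by rewrite big_split/= -!mulr_sumr B00 B01; ring.
have h1E t : h1 t = \sum_k (g k t - g k t0 - E k t) * B1 k.
  rewrite (eq_bigr (fun k => h0 t * (a0 k * B1 k) + h1 t * (a1 k * B1 k))); last by move=> k _; rewrite /E; ring.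
  by rewrite big_split/= -!mulr_sumr B10 B11; ring.
pose G := \sum_k `|g1 k| + 1.
have G0 : 0 <= G by rewrite addr_ge0// sumr_ge0.
have gG : \forall t \near F, forall k, `|g k t - g k t0| <= G * `|t - t0|.
  have H k : \forall t \near F, `|(g k t - g k t0) / (t - t0)| <= G.
    have /cvgr_norm_le := gV k; apply.
    by rewrite /G (bigD1 k)//= -addrA ltrDl ltr_wpDl// sumr_ge0.
  near=> t => k.
  have tt0 : t - t0 != 0 by rewrite subr_eq0; near: t.
  have : `|(g k t - g k t0) / (t - t0)| <= G by move: k; near: t; exact: filter_forall H.
  by rewrite normrM normfV ler_pdivrMr// normr_gt0.
pose L := 2 * beta * G.
(* y <= beta (G |t - t0| + C y^2) with y -> 0: the quadratic term is absorbed by the left side *)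
have yL : \forall t \near F, y t <= L * `|t - t0|.
  near=> t.
  have gt k : `|g k t - g k t0| <= G * `|t - t0| by move: k; near: t.
  have Et k : `|E k t| <= C * y t ^+ 2 by move: k; near: t.
  have yy : y t <= beta * (G * `|t - t0| + C * y t ^+ 2).
    have hB (h : R -> R) (B : 'I_3 -> R) : (h t = \sum_k (g k t - g k t0 - E k t) * B k) ->
      `|h t| <= \sum_k `|B k| * (G * `|t - t0| + C * y t ^+ 2).
      move=> ->; rewrite (le_trans (ler_norm_sum _ _ _))//; apply: ler_sum => k _.
      by rewrite normrM mulrC ler_wpM2l// (le_trans (ler_normB _ _))// lerD.
    rewrite /y /beta mulr_suml (eq_bigr _ (fun k _ => mulrDl _ _ _)) big_split/=.
    by rewrite lerD// hB.
  have bCy : beta * C * y t <= 2^-1.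
    near: t; have : beta * C * y t @[t --> F] --> beta * C * 0 by apply: cvgM => //; exact: cvg_cst.
    by rewrite mulr0 => /cvgr_le; apply; rewrite invr_gt0.
  have := y0 t; rewrite /L; move: yy bCy; rewrite mulrDr expr2 !mulrA.
  set X := beta * G * _; set Z := beta * C * _ => yy bCy y0t.
  have -> : 2 * beta * G * `|t - t0| = 2 * X by rewrite /X; ring.
  nra.
have L0 : 0 <= L by rewrite /L !mulr_ge0.
have E1 k : E k t / (t - t0) @[t --> F] --> (0 : R).
  apply/cvgr0Pnorm_le => e e0; near=> t.
  have tt0 : t - t0 != 0 by rewrite subr_eq0; near: t.
  have Et : `|E k t| <= C * y t ^+ 2 by move: (k); near: t.
  have yt : y t <= L * `|t - t0| by near: t.
  rewrite normrM normfV ler_pdivrMr ?normr_gt0//; apply: (le_trans Et).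
  have te : C * L ^+ 2 * `|t - t0| <= e.
    near: t; have : C * L ^+ 2 * `|t - t0| @[t --> F] --> C * L ^+ 2 * `|0 : R|.
      by apply: cvgM; [exact: cvg_cst|exact: cvg_norm].
    by rewrite normr0 mulr0 => /cvgr_le; apply.
  apply: (@le_trans _ _ (C * (L * `|t - t0|) ^+ 2)).
    by rewrite ler_wpM2l//; apply: lerXn2r; rewrite ?nnegrE ?y0// mulr_ge0.
  by rewrite exprMn mulrA [`|t - t0| ^+ 2]expr2 mulrA ler_wpM2r.
have hw (h : R -> R) (B : 'I_3 -> R) : (forall t, h t = \sum_k (g k t - g k t0 - E k t) * B k) ->
  h t / (t - t0) @[t --> F] --> \sum_k g1 k * B k.
  move=> hE; have H : \sum_k ((g k t - g k t0) / (t - t0) - E k t / (t - t0)) * B k @[t --> F] --> \sum_k (g1 k - 0) * B k.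
    under eq_fun do rewrite sum3E; rewrite sum3E.
    have HB k : ((g k t - g k t0) / (t - t0) - E k t / (t - t0)) * B k @[t --> F] --> (g1 k - 0) * B k.
      by apply: cvgM; [exact: cvgB|exact: cvg_cst].
    by apply: cvgD; [apply: cvgD|]; exact: HB.
  rewrite (eq_bigr _ (fun k _ => congr1 (fun z => z * B k) (subr0 (g1 k)))) in H.
  apply: cvg_trans H; apply: near_eq_cvg; near=> t.
  by rewrite hE mulr_suml; apply: eq_bigr => k _; ring.
have w0 := hw _ _ h0E; have w1 := hw _ _ h1E.
exists (\sum_k g1 k * B0 k), (\sum_k g1 k * B1 k).
move: w0 w1; set w0 := \sum_k _; set w1 := \sum_k _ => Hw0 Hw1.
have gw k : g1 k = w0 * a0 k + w1 * a1 k.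
  have H : a0 k * (h0 t / (t - t0)) + a1 k * (h1 t / (t - t0)) + E k t / (t - t0) @[t --> F] --> a0 k * w0 + a1 k * w1 + 0.
    by apply: cvgD => //; apply: cvgD; apply: cvgM => //; exact: cvg_cst.
  have -> : w0 * a0 k + w1 * a1 k = a0 k * w0 + a1 k * w1 + 0 by ring.
  apply: (cvg_unique (@Rhausdorff R) (gV k)); rewrite //=.
  apply: cvg_trans H; apply: near_eq_cvg; near=> t; rewrite /E; ring.
split => // n n0 n1.
pose q k t := quad (b00 k) (b01 k) (b11 k) (h0 t / (t - t0)) (h1 t / (t - t0)).
pose rem k t := (E k t - quad (b00 k) (b01 k) (b11 k) (h0 t) (h1 t)) / (t - t0) ^+ 2.
pose j k t := (g k t - g k t0 - (t - t0) * g1 k - (t - t0) ^+ 2 / 2 * g2 k) / (t - t0) ^+ 2.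
have remF k : rem k t @[t --> F] --> (0 : R).
  apply/cvgr0Pnorm_le => e e0; near=> t.
  have tt0 : t - t0 != 0 by rewrite subr_eq0; near: t.
  have Et : `|E k t - quad (b00 k) (b01 k) (b11 k) (h0 t) (h1 t)| <= K * y t ^+ 3 by move: (k); near: t.
  have yt : y t <= L * `|t - t0| by near: t.
  rewrite normrM normfV normrX ler_pdivrMr ?exprn_gt0 ?normr_gt0//; apply: (le_trans Et).
  have te : `|K| * L ^+ 3 * `|t - t0| <= e.
    near: t; have : `|K| * L ^+ 3 * `|t - t0| @[t --> F] --> `|K| * L ^+ 3 * `|0 : R|.
      by apply: cvgM; [exact: cvg_cst|exact: cvg_norm].
    by rewrite normr0 mulr0 => /cvgr_le; apply.
  apply: (@le_trans _ _ (`|K| * (L * `|t - t0|) ^+ 3)).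
    apply: (@le_trans _ _ (`|K| * y t ^+ 3)).
      by rewrite ler_wpM2r ?exprn_ge0// ler_norm.
    by rewrite ler_wpM2l//; apply: lerXn2r; rewrite ?nnegrE ?y0// mulr_ge0.
  by rewrite exprMn mulrA [`|t - t0| ^+ 3]exprS mulrA ler_wpM2r// exprn_ge0.
have sumF (u : 'I_3 -> R -> R) (l : 'I_3 -> R) : (forall k, u k t @[t --> F] --> l k) ->
    \sum_k n k * u k t @[t --> F] --> \sum_k n k * l k.
  move=> H; under eq_fun do rewrite sum3E; rewrite sum3E.
  by apply: cvgD; [apply: cvgD|]; apply: cvgM => //; exact: cvg_cst.
have qF k : q k t @[t --> F] --> quad (b00 k) (b01 k) (b11 k) w0 w1.
  rewrite /q /quad; apply: cvgM; last exact: cvg_cst.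
  by apply: cvgD; [apply: cvgD; [|apply: cvgM => //]|];
    apply: cvgM; rewrite ?expr2; do ?[exact: cvg_cst|exact: cvgM|done].
(* the same quotient is expanded in the chart (lhs) and along the curve (rhs) *)
have lhs : \sum_k n k * (q k t + rem k t - j k t) @[t --> F] --> \sum_k n k * (quad (b00 k) (b01 k) (b11 k) w0 w1 + 0 - 0).
  by apply: sumF => k; apply: cvgB; [apply: cvgD|exact: gJ].
have rhs : \sum_k n k * (q k t + rem k t - j k t) @[t --> F] --> \sum_k n k * (g2 k / 2).
  apply: cvg_near_cst; near=> t.
  have tt0 : t - t0 != 0 by rewrite subr_eq0; near: t.
  rewrite (eq_bigr (fun k => n k * (g2 k / 2) + (w0 / (t - t0) - h0 t / (t - t0) ^+ 2) * (n k * a0 k)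
     + (w1 / (t - t0) - h1 t / (t - t0) ^+ 2) * (n k * a1 k))); last first.
    by move=> k _; rewrite /q /rem /j /E /quad gw; field.
  by rewrite !big_split/= -!mulr_sumr n0 n1 !mulr0 !addr0.
have := cvg_unique (@Rhausdorff R) lhs rhs.
rewrite (eq_bigr (fun k => (w0 ^+ 2 / 2) * (n k * b00 k) + (w0 * w1) * (n k * b01 k) + (w1 ^+ 2 / 2) * (n k * b11 k))); last first.
  by move=> k _; rewrite /quad; field.
rewrite [RHS](eq_bigr (fun k => 2^-1 * (n k * g2 k))); last by move=> k _; field.
rewrite !big_split/= -!mulr_sumr => H; have {}H := H (fmap_proper_filter _ PF); lra.
Unshelve. all: by end_near. Qed.
End CurveAsymptotics.

Section Osculation.
Variable R : realType.
Implicit Types (S : set 'rV[R]_3) (U M : set 'rV[R]_2) (phi : 'rV[R]_2 -> 'rV[R]_3).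

Lemma row_free_right_inverse (a0 a1 : 'rV[R]_3) (T : 'M[R]_(2, 3)) :
  (forall k, T 0 k = a0 0 k) -> (forall k, T 1 k = a1 0 k) -> row_free T ->
  exists B0 B1 : 'I_3 -> R, [/\ \sum_k a0 0 k * B0 k = 1, \sum_k a1 0 k * B0 k = 0,
     \sum_k a0 0 k * B1 k = 0 & \sum_k a1 0 k * B1 k = 1].
Proof.
move=> T0 T1 /row_freeP[B TB]; exists (fun k => B k 0), (fun k => B k 1).
have E i j : \sum_k T i k * B k j = (i == j)%:R.
  by have := congr1 (fun X : 'M[R]_(2, 2) => X i j) TB; rewrite !mxE.
split; [apply: etrans (E 0 0)|apply: etrans (E 1 0)|apply: etrans (E 0 1)|apply: etrans (E 1 1)];
  by apply: eq_bigr => k _; rewrite ?T0 ?T1.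
Qed.

Lemma row_lin2 (a b : R) (u v : 'rV[R]_3) k : (a *: u + b *: v) 0 k = a * u 0 k + b * v 0 k.
Proof. by rewrite !mxE. Qed.

(** Second-order contact of a curve with the surface whose 2-jet is given by a0,
    a1 (first derivatives) and b00, b01, b11 (second derivatives): v is the
    velocity of the curve and a its acceleration.  The tangential part of the
    acceleration, which depends on the unknown second derivatives of the curve in
    the chart, is left free. *)
Definition osculates (a0 a1 b00 b01 b11 v a : 'rV[R]_3) := exists w0 w1 : R,
  v = w0 *: a0 + w1 *: a1 /\
  forall n, dot n a0 = 0 -> dot n a1 = 0 ->
    dot n a = w0 ^+ 2 * dot n b00 + 2 * w0 * w1 * dot n b01 + w1 ^+ 2 * dot n b11.

(** The inverse of the chart is continuous, and this is all that is needed for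
    [chart_curve_asymptotics]: its differentiability along the curve is an
    outcome of the comparison. *)
Lemma chart_curve_jet S U M phi x0 (F : set_system R) (gam : R -> 'rV[R]_3) t0 (g1 g2 : 'rV[R]_3) :
  analytic_chart S U M phi -> (U `&` M) x0 -> ProperFilter F -> F --> t0^' ->
  (\forall t \near F, S (gam t)) -> gam t0 = phi x0 ->
  (forall k, jet2 F (fun t => gam t 0 k) t0 (g1 0 k) (g2 0 k)) ->
  osculates (partial 0 phi x0) (partial 1 phi x0) (partial 0 (partial 0 phi) x0)
    (partial 1 (partial 0 phi) x0) (partial 1 (partial 1 phi) x0) g1 g2.
Proof.
move=> [oU _ phiA phiF [V [psi [oV UMV psiK psiC]]]] UMx0 PF Ft0 SF gx0 gJ.
have [_ [K [r [r0 K0 HK]]]] := analytic_map_jet (phiA _ UMx0.1).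
have [B0 [B1 [B00 B01 B10 B11]]] := @row_free_right_inverse (partial 0 phi x0) (partial 1 phi x0) _
  (fun k => mxE _ _ _ _) (fun k => mxE _ _ _ _) (phiF _ UMx0.1).
have SVx0 : (S `&` V) (phi x0) by rewrite -UMV; exists x0.
have gF : gam @ F --> phi x0.
  rewrite -gx0; apply: cvg_row => k; exact: jet2_continuous (gJ k).
have SVF : \forall t \near F, (S `&` V) (gam t).
  by apply: filterI SF _; apply: gF; apply: open_nbhs_nbhs; split => //; exact: SVx0.2.
have xF : psi (gam t) @[t --> F] --> x0.
  have : psi @ within (S `&` V) (nbhs (phi x0)) --> psi (phi x0) := (subspace_continuousP _ _).1 psiC _ SVx0.
  rewrite (psiK _ UMx0) => psiF.
  move=> A /psiF HA; have := gF _ HA => HF.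
  by apply: filterS (filterI SVF HF) => t [SVt]; apply.
have phiE : \forall t \near F, phi (psi (gam t)) = gam t.
  by apply: filterS SVF => t; rewrite -UMV => -[y UMy <-]; rewrite psiK.
pose h (i : 'I_2) t := psi (gam t) 0 i - x0 0 i.
have hF i : h i @ F --> (0 : R).
  by rewrite -(subrr (x0 0 i)); apply: cvgB; [exact: cvg_coord|exact: cvg_cst].
have HF : \forall t \near F, forall k, `|gam t 0 k - gam t0 0 k - partial 0 phi x0 0 k * h 0 t - partial 1 phi x0 0 k * h 1 t
    - quad (partial 0 (partial 0 phi) x0 0 k) (partial 1 (partial 0 phi) x0 0 k) (partial 1 (partial 1 phi) x0 0 k) (h 0 t) (h 1 t)|
     <= K * (`|h 0 t| + `|h 1 t|) ^+ 3.
  near=> t => k; have pE : phi (psi (gam t)) = gam t by near: t.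
  have h0r : `|h 0 t| < r.
    by near: t; apply: (cvgr_norm_lt _ (hF 0)); rewrite normr0.
  have h1r : `|h 1 t| < r.
    by near: t; apply: (cvgr_norm_lt _ (hF 1)); rewrite normr0.
  have := HK (psi (gam t)) k h0r h1r; rewrite pE gx0.
  by rewrite !opprD !addrA.
have [w0 [w1 [Hw Hn]]] := chart_curve_asymptotics (g := fun k t => gam t 0 k) PF Ft0 gJ (hF 0) (hF 1) HF B00 B01 B10 B11.
exists w0, w1; split; first by apply/rowP => k; rewrite Hw row_lin2.
by move=> n; exact: Hn.
Unshelve. all: by end_near. Qed.
End Osculation.

(** * Principal curvatures in terms of the fundamental forms *)

Section VectorAlgebra.
Variable R : realType.
Implicit Types (u v w n : 'rV[R]_3).

Lemma crossE u v : [/\ cross u v 0 0 = u 0 1 * v 0 2%:R - u 0 2%:R * v 0 1,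
  cross u v 0 1 = u 0 2%:R * v 0 0 - u 0 0 * v 0 2%:R &
  cross u v 0 2%:R = u 0 0 * v 0 1 - u 0 1 * v 0 0].
Proof. by split; rewrite !mxE. Qed.

Lemma dotC u v : dot u v = dot v u.
Proof. by rewrite !dotE; ring. Qed.

Lemma dotZl (a : R) u v : dot (a *: u) v = a * dot u v.
Proof. by rewrite !dotE !mxE; ring. Qed.

Lemma dotDl u v w : dot (u + v) w = dot u w + dot v w.
Proof. by rewrite !dotE !mxE; ring. Qed.

Lemma dotZr (a : R) u v : dot u (a *: v) = a * dot u v.
Proof. by rewrite dotC dotZl dotC. Qed.

Lemma dotDr u v w : dot w (u + v) = dot w u + dot w v.
Proof. by rewrite dotC dotDl !(dotC _ w). Qed.

Lemma dot_crossl u v : dot u (cross u v) = 0.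
Proof. by rewrite dotE; have [-> -> ->] := crossE u v; ring. Qed.

Lemma dot_crossr u v : dot v (cross u v) = 0.
Proof. by rewrite dotE; have [-> -> ->] := crossE u v; ring. Qed.

Lemma dot_cross_cross u v : dot (cross u v) (cross u v) = dot u u * dot v v - dot u v ^+ 2.
Proof. by rewrite !dotE; have [-> -> ->] := crossE u v; ring. Qed.

Lemma dot_ge0 u : 0 <= dot u u.
Proof. by rewrite dotE -!expr2 !addr_ge0 ?sqr_ge0. Qed.

Lemma dot_eq0 u : (dot u u == 0) = (u == 0).
Proof.
apply/eqP/eqP => [|->]; last by rewrite dotE !mxE; ring.
rewrite dotE -!expr2 => /eqP; rewrite paddr_eq0 ?addr_ge0 ?sqr_ge0// paddr_eq0 ?sqr_ge0//.
rewrite !sqrf_eq0 => /andP[/andP[/eqP u0 /eqP u1] /eqP u2].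
by apply/rowP; apply: ord3P; rewrite mxE.
Qed.

Lemma dot_gt0 u : (0 < dot u u) = (u != 0).
Proof. by rewrite lt_def dot_ge0 andbT dot_eq0. Qed.

Lemma cross_lin2 (p0 p1 q0 q1 : R) u v :
  cross (p0 *: u + p1 *: v) (q0 *: u + q1 *: v) = (p0 * q1 - p1 * q0) *: cross u v.
Proof.
have [E0 E1 E2] := crossE (p0 *: u + p1 *: v) (q0 *: u + q1 *: v); have [F0 F1 F2] := crossE u v.
by apply/rowP; apply: ord3P; rewrite (E0, E1, E2) [RHS]mxE (F0, F1, F2) !row_lin2; ring.
Qed.

Lemma det_mx2 (K : comNzRingType) (A : 'M[K]_2) : \det A = A 0 0 * A 1 1 - A 0 1 * A 1 0.
Proof.
rewrite (expand_det_row _ 0) !big_ord_recl big_ord0 addr0 /cofactor !det_mx11 !mxE.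
have -> : lift 0 0 = 1 :> 'I_2 by exact: val_inj.
have -> : lift 1 0 = 0 :> 'I_2 by exact: val_inj.
have -> : ord0 = 0 :> 'I_2 by exact: val_inj.
by rewrite /= expr0 expr1 mul1r mulN1r mulrN.
Qed.

Lemma char_poly2 (A : 'M[R]_2) k1 k2 :
  char_poly A = ('X - k1%:P) * ('X - k2%:P) <-> A 0 0 + A 1 1 = k1 + k2 /\ A 0 0 * A 1 1 - A 0 1 * A 1 0 = k1 * k2.
Proof.
have -> : char_poly A = ('X - (A 0 0)%:P) * ('X - (A 1 1)%:P) - (A 0 1)%:P * (A 1 0)%:P.
  by rewrite /char_poly det_mx2 !mxE/= ?mulr1n ?mulr0n; ring.
split=> [H|[H1 H2]].
  have E x : (x - A 0 0) * (x - A 1 1) - A 0 1 * A 1 0 = (x - k1) * (x - k2).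
    by have := congr1 (fun p => p.[x]) H; rewrite !hornerE.
  by have := E 0; have := E 1; split; lra.
have -> : k2 = A 0 0 + A 1 1 - k1 by rewrite H1; ring.
have : (A 0 0)%:P * (A 1 1)%:P - (A 0 1)%:P * (A 1 0)%:P = k1%:P * (A 0 0 + A 1 1 - k1)%:P.
  by rewrite -!polyCM -polyCB H2 H1; congr (_%:P); ring.
rewrite !polyCB !polyCD => H.
transitivity ('X ^+ 2 - ((A 0 0)%:P + (A 1 1)%:P) * 'X + ((A 0 0)%:P * (A 1 1)%:P - (A 0 1)%:P * (A 1 0)%:P)); first by ring.
by rewrite H; ring.
Qed.

End VectorAlgebra.

Section PrincipalCurvatures.
Variable R : realType.
Implicit Types (u v w n : 'rV[R]_3) (phi : 'rV[R]_2 -> 'rV[R]_3).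

Lemma row_free_cross (T : 'M[R]_(2, 3)) u v : (forall k, T 0 k = u 0 k) -> (forall k, T 1 k = v 0 k) ->
  row_free T -> cross u v != 0.
Proof.
move=> T0 T1 Tf; have [B0 [B1 [B00 B01 B10 B11]]] := row_free_right_inverse T0 T1 Tf.
apply/eqP => c0; have [] := crossE u v; rewrite c0 !mxE => c1 c2 c3.
move: B00 B01 B10 B11; rewrite !sum3E => B00 B01 B10 B11.
suff : (1 : R) = 0 by move/eqP; rewrite oner_eq0.
rewrite -[LHS]mulr1 -{1}B00 -B11.
transitivity ((u 0 0 * B0 0 + u 0 1 * B0 1 + u 0 2%:R * B0 2%:R) * (v 0 0 * B1 0 + v 0 1 * B1 1 + v 0 2%:R * B1 2%:R)
  - (v 0 0 * B0 0 + v 0 1 * B0 1 + v 0 2%:R * B0 2%:R) * (u 0 0 * B1 0 + u 0 1 * B1 1 + u 0 2%:R * B1 2%:R)).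
  by rewrite B01 B10 mul0r subr0.
transitivity ((u 0 1 * v 0 2%:R - u 0 2%:R * v 0 1) * (B0 1 * B1 2%:R - B0 2%:R * B1 1)
  + (u 0 2%:R * v 0 0 - u 0 0 * v 0 2%:R) * (B0 2%:R * B1 0 - B0 0 * B1 2%:R)
  + (u 0 0 * v 0 1 - u 0 1 * v 0 0) * (B0 0 * B1 1 - B0 1 * B1 0)); first by ring.
by rewrite -c1 -c2 -c3 !mul0r !addr0.
Qed.

Lemma sum2E (F : 'I_2 -> R) : \sum_k F k = F 0 + F 1.
Proof. by rewrite !big_ord_recl big_ord0 addr0; congr (F _ + F _); exact: val_inj. Qed.

Lemma shape_trace_det (A II J : 'M[R]_2) (E F G L M N : R) :
  J 0 0 = E -> J 0 1 = F -> J 1 0 = F -> J 1 1 = G ->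
  II 0 0 = L -> II 0 1 = M -> II 1 0 = M -> II 1 1 = N -> E * G - F ^+ 2 != 0 ->
  A = II *m invmx J ->
  (A 0 0 + A 1 1) * (E * G - F ^+ 2) = L * G - 2 * M * F + N * E /\
  (A 0 0 * A 1 1 - A 0 1 * A 1 0) * (E * G - F ^+ 2) = L * N - M ^+ 2.
Proof.
move=> J00 J01 J10 J11 I00 I01 I10 I11 d0 AE.
have Ju : J \in unitmx by rewrite unitmxE unitfE det_mx2 J00 J01 J10 J11 -expr2.
have AJ : A *m J = II by rewrite AE mulmxKV.
have e i j : A i 0 * J 0 j + A i 1 * J 1 j = II i j.
  by rewrite -AJ [RHS]mxE sum2E.
have := e 0 0; have := e 0 1; have := e 1 0; have := e 1 1.
rewrite J00 J01 J10 J11 I00 I01 I10 I11 => N1 M1 M2 L1.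
split.
  transitivity ((A 0 0 * E + A 0 1 * F) * G - (A 0 0 * F + A 0 1 * G) * F
    + (A 1 0 * F + A 1 1 * G) * E - (A 1 0 * E + A 1 1 * F) * F); first by ring.
  by rewrite L1 M1 M2 N1; ring.
transitivity ((A 0 0 * E + A 0 1 * F) * (A 1 0 * F + A 1 1 * G) - (A 0 0 * F + A 0 1 * G) * (A 1 0 * E + A 1 1 * F)).
  by ring.
by rewrite L1 M1 M2 N1; ring.
Qed.

Lemma char_poly2_scaled (A : 'M[R]_2) (g T D k1 k2 : R) : g != 0 -> (A 0 0 + A 1 1) * g = T ->
  (A 0 0 * A 1 1 - A 0 1 * A 1 0) * g = D ->
  char_poly A = ('X - k1%:P) * ('X - k2%:P) <-> (k1 + k2) * g = T /\ k1 * k2 * g = D.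
Proof.
move=> g0 <- <-; split=> [/char_poly2[-> ->]//|[H1 H2]]; apply/char_poly2.
by split; apply: (mulIf g0).
Qed.

Lemma normalized_cross (u v n : 'rV[R]_3) : cross u v != 0 -> n = (Num.sqrt (dot (cross u v) (cross u v)))^-1 *: cross u v ->
  let g := dot u u * dot v v - dot u v ^+ 2 in
  [/\ 0 < g, [/\ dot n n = 1, dot n u = 0 & dot n v = 0] &
    exists2 c, c ^+ 2 * g = 1 & n = c *: cross u v].
Proof.
rewrite dot_cross_cross => c0 nE g.
have g0 : 0 < g by rewrite /g -dot_cross_cross dot_gt0.
have s0 : Num.sqrt g ^+ 2 = g by rewrite sqr_sqrtr// ltW.
have sg0 : Num.sqrt g != 0 by rewrite sqrtr_eq0 -ltNge.
split => //.
- split.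
  + by rewrite nE dotZl dotZr dot_cross_cross -/g -{3}s0; field.
  + by rewrite nE dotZl [dot (cross _ _) _]dotC dot_crossl mulr0.
  + by rewrite nE dotZl [dot (cross _ _) _]dotC dot_crossr mulr0.
- by exists (Num.sqrt g)^-1 => //; rewrite -{2}s0; field.
Qed.

(** The characteristic polynomial of the shape operator is determined by its
    trace and determinant; multiplied by the determinant g of the first
    fundamental form they become polynomial in the coefficients of both forms. *)
Lemma chart_principal phi x0 : (forall k : 'I_3, analytic_at2 (fun y => phi y 0 k) x0) ->
  row_free (\matrix_(i < 2) partial i phi x0) ->
  let a0 := partial 0 phi x0 in let a1 := partial 1 phi x0 in
  let n := unit_normal phi x0 in
  let L := dot n (partial 0 (partial 0 phi) x0) in
  let M := dot n (partial 1 (partial 0 phi) x0) in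
  let N := dot n (partial 1 (partial 1 phi) x0) in
  let g := dot a0 a0 * dot a1 a1 - dot a0 a1 ^+ 2 in
  [/\ 0 < g, [/\ dot n n = 1, dot n a0 = 0 & dot n a1 = 0],
    exists2 c, c ^+ 2 * g = 1 & n = c *: cross a0 a1 &
  forall k1 k2, char_poly (shape_operator phi x0) = ('X - k1%:P) * ('X - k2%:P) <->
    (k1 + k2) * g = L * dot a1 a1 - 2 * M * dot a0 a1 + N * dot a0 a0 /\ k1 * k2 * g = L * N - M ^+ 2].
Proof.
move=> phiA phiF a0 a1 n L M N g.
have sym := (analytic_map_jet phiA).1.
have c0 : cross a0 a1 != 0 by apply: (row_free_cross _ _ phiF) => k; exact: mxE.
have [g0 nn nE] := @normalized_cross a0 a1 n c0 (erefl _).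
split; [exact: g0|exact: nn|exact: nE|].
move=> k1 k2.
have gn := lt0r_neq0 g0.
have s01 : second_form phi x0 0 1 = M by rewrite /M dotC; exact: mxE.
have s10 : second_form phi x0 1 0 = M by rewrite /M dotC -sym; exact: mxE.
have s00 : second_form phi x0 0 0 = L by rewrite /L dotC; exact: mxE.
have s11 : second_form phi x0 1 1 = N by rewrite /N dotC; exact: mxE.
have f10 : first_form phi x0 1 0 = dot a0 a1 by rewrite dotC; exact: mxE.
have [tr de] := shape_trace_det (mxE _ _ _ _) (mxE _ _ _ _) f10 (mxE _ _ _ _) s00 s01 s10 s11 gn (erefl (shape_operator phi x0)).
exact: char_poly2_scaled gn tr de.
Qed.

(** Polarization: the second fundamental form is known on r1, r2 and r1 + r2 as
    soon as curves with these velocities osculate the surface. *)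
Lemma second_form_pullback (a0 a1 b00 b01 b11 r1 r2 r11 r12 r22 : 'rV[R]_3) : cross a0 a1 != 0 ->
  let osc := osculates a0 a1 b00 b01 b11 in
  osc r1 r11 -> osc r2 r22 -> osc (r1 + r2) (r11 + 2 *: r12 + r22) ->
  exists p0 p1 q0 q1 : R, [/\ r1 = p0 *: a0 + p1 *: a1, r2 = q0 *: a0 + q1 *: a1 &
    forall n, dot n a0 = 0 -> dot n a1 = 0 ->
    [/\ dot n r11 = p0 ^+ 2 * dot n b00 + 2 * p0 * p1 * dot n b01 + p1 ^+ 2 * dot n b11,
        dot n r12 = p0 * q0 * dot n b00 + (p0 * q1 + p1 * q0) * dot n b01 + p1 * q1 * dot n b11 &
        dot n r22 = q0 ^+ 2 * dot n b00 + 2 * q0 * q1 * dot n b01 + q1 ^+ 2 * dot n b11]].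
Proof.
move=> c0 osc [p0 [p1 [r1E Hp]]] [q0 [q1 [r2E Hq]]] [s0 [s1 [r3E Hs]]].
exists p0, p1, q0, q1.
have [] : s0 = p0 + q0 /\ s1 = p1 + q1.
  have z : s0 *: a0 + s1 *: a1 = (p0 + q0) *: a0 + (p1 + q1) *: a1.
    by rewrite -r3E r1E r2E !scalerDl addrACA.
  have cc : dot (cross a0 a1) (cross a0 a1) != 0 by rewrite dot_eq0.
  split; apply: (mulIf cc); rewrite -!dotZl.
    have := congr1 (fun v => cross v (0 *: a0 + 1 *: a1)) z.
    by rewrite !cross_lin2 !mulr0 !mulr1 !subr0 => ->.
  have := congr1 (fun v => cross (1 *: a0 + 0 *: a1) v) z.
  by rewrite !cross_lin2 !mul0r !mul1r !subr0 => ->.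
move=> sE0 sE1; rewrite sE0 sE1 in Hs.
split => // n n0 n1; have := Hp n n0 n1; have := Hq n n0 n1; have := Hs n n0 n1.
by rewrite !dotDr !dotZr; split; lra.
Qed.

End PrincipalCurvatures.

(** * Fundamental forms read on two curves *)

Section FormsPullback.
Variable R : realType.
Implicit Types (u v w n : 'rV[R]_3) (phi : 'rV[R]_2 -> 'rV[R]_3).

(** The numerators of 2H and K are covariants: both are multiplied by the
    square of the determinant d of the change of basis. *)
Lemma forms_pullback (a0 a1 b00 b01 b11 r1 r2 r11 r12 r22 : 'rV[R]_3) : cross a0 a1 != 0 ->
  let osc := osculates a0 a1 b00 b01 b11 in
  osc r1 r11 -> osc r2 r22 -> osc (r1 + r2) (r11 + 2 *: r12 + r22) ->
  exists2 d : R, cross r1 r2 = d *: cross a0 a1 &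
    forall n, dot n a0 = 0 -> dot n a1 = 0 ->
    dot n r11 * dot r2 r2 - 2 * dot n r12 * dot r1 r2 + dot n r22 * dot r1 r1
     = d ^+ 2 * (dot n b00 * dot a1 a1 - 2 * dot n b01 * dot a0 a1 + dot n b11 * dot a0 a0) /\
    dot n r11 * dot n r22 - dot n r12 ^+ 2 = d ^+ 2 * (dot n b00 * dot n b11 - dot n b01 ^+ 2).
Proof.
move=> c0 osc o1 o2 o3; have [p0 [p1 [q0 [q1 [-> -> H]]]]] := second_form_pullback c0 o1 o2 o3.
exists (p0 * q1 - p1 * q0) => [|n n0 n1]; first exact: cross_lin2.
have [-> -> ->] := H n n0 n1.
by rewrite !(dotDl, dotDr, dotZl, dotZr) (dotC a1 a0); split; ring.
Qed.

(** Here r2 is the direction of a ruling, of zero acceleration, hence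
    asymptotic.  The unit normal is replaced by the polynomial vector N, which
    is legitimate also where N vanishes. *)
Lemma ruled_curvature_ratio (a0 a1 b00 b01 b11 r1 r2 r11 r12 n : 'rV[R]_3) (k1 k2 A : R) :
  cross a0 a1 != 0 ->
  let osc := osculates a0 a1 b00 b01 b11 in
  osc r1 r11 -> osc r2 0 -> osc (r1 + r2) (r11 + 2 *: r12) ->
  dot n n = 1 -> dot n a0 = 0 -> dot n a1 = 0 ->
  (exists2 c, c ^+ 2 * (dot a0 a0 * dot a1 a1 - dot a0 a1 ^+ 2) = 1 & n = c *: cross a0 a1) ->
  (k1 + k2) * (dot a0 a0 * dot a1 a1 - dot a0 a1 ^+ 2) =
    dot n b00 * dot a1 a1 - 2 * dot n b01 * dot a0 a1 + dot n b11 * dot a0 a0 ->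
  k1 * k2 * (dot a0 a0 * dot a1 a1 - dot a0 a1 ^+ 2) = dot n b00 * dot n b11 - dot n b01 ^+ 2 ->
  k1 * k2 != 0 -> (k1 + k2) ^+ 2 = A * (k1 * k2) ->
  let N := cross r1 r2 in
  (dot r2 r2 * dot r11 N - 2 * dot r1 r2 * dot r12 N) ^+ 2 = - A * dot r12 N ^+ 2 * dot N N /\
  (dot r12 N = 0 -> dot N N = 0).
Proof.
move=> c0 osc o1 o2 o3 nn n0 n1 [c cg nE]; set g := _ - _ in cg * => tr de k12 kA N.
have [|d NE /(_ n n0 n1)[]] := @forms_pullback a0 a1 b00 b01 b11 r1 r2 r11 r12 0 c0 o1 o2.
  by rewrite addr0.
rewrite -tr -de -/N in NE *; have -> : dot n 0 = 0 by rewrite dotE !mxE; ring.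
rewrite mul0r mulr0 addr0 sub0r => T D.
have cN : c != 0 by apply/eqP => c0'; move: cg; rewrite c0' expr0n mul0r => /esym/eqP; rewrite oner_eq0.
have Nn : N = (d / c) *: n by rewrite nE scalerA divfK.
have dN v : dot v N = (d / c) * dot n v by rewrite Nn dotZr dotC.
have NN : dot N N = d ^+ 2 * g.
  transitivity ((d / c) ^+ 2 * (c ^+ 2 * g)); last by field.
  by rewrite dN dN nn cg; ring.
have dc : (d / c) ^+ 2 = d ^+ 2 * g by rewrite -NN dN dN nn; ring.
(* N = (d / c) n, and (d / c)^2 = |N|^2 = d^2 g *)
have g2 : d ^+ 2 * (k1 * k2 * g) = k1 * k2 * (d ^+ 2 * g) by ring.
rewrite (dN r11) (dN r12) NN; split.
  have -> : dot r2 r2 * (d / c * dot n r11) - 2 * dot r1 r2 * (d / c * dot n r12) = d / c * (d ^+ 2 * ((k1 + k2) * g)).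
    by rewrite -T; ring.
  have -> : (d / c * (d ^+ 2 * ((k1 + k2) * g))) ^+ 2 = (d / c) ^+ 2 * (d ^+ 2 * g) ^+ 2 * (k1 + k2) ^+ 2 by ring.
  have -> : - A * (d / c * dot n r12) ^+ 2 * (d ^+ 2 * g) = (d / c) ^+ 2 * A * (- dot n r12 ^+ 2) * (d ^+ 2 * g) by ring.
  by rewrite D kA g2; ring.
move=> H; have : (d / c) ^+ 2 * dot n r12 ^+ 2 = 0 by rewrite -exprMn H expr0n.
rewrite dc -[dot n r12 ^+ 2]opprK D g2 => /eqP; rewrite mulrN oppr_eq0 mulf_eq0.
by case/orP => [/eqP //|]; rewrite mulf_eq0 (negPf k12) => /eqP.
Qed.
End FormsPullback.

(** * The curvature equation along one ruling *)

Section RulingRatio.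
Variable R : realType.
Implicit Types (S : set 'rV[R]_3) (c e : R -> 'rV[R]_3) (I : set R).

Definition dvec (g : R -> 'rV[R]_3) (t : R) : 'rV[R]_3 := \row_k derive1 (fun s => g s 0 k) t.

Lemma dvecE g t k : dvec g t 0 k = derive1 (fun s => g s 0 k) t.
Proof. exact: mxE. Qed.

Definition analytic_vec (g : R -> 'rV[R]_3) t := forall k, analytic_within setT (fun s => g s 0 k) t.

Lemma analytic_curve_vec I g t : analytic_curve I g -> nbhs t I -> analytic_vec g t.
Proof. by move=> gA It k; exact: analytic_interior It (gA t (nbhs_singleton It) k). Qed.

Lemma analytic_dvec g t : analytic_vec g t -> analytic_vec (dvec g) t.
Proof.
move=> H k; have -> : (fun s => dvec g s 0 k) = derive1 (fun s => g s 0 k).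
  by apply/funext => s; rewrite dvecE.
exact: analytic_derive1.
Qed.

Lemma dvec2E g t k : dvec (dvec g) t 0 k = derive1 (derive1 (fun s => g s 0 k)) t.
Proof.
by rewrite dvecE; congr (derive1 _ _); apply/funext => s; rewrite dvecE.
Qed.

Lemma jet2_line (F : set_system R) (p v : R) t0 : Filter F -> F --> t0^' ->
  jet2 F (fun t => p + (t - t0) * v) t0 v 0.
Proof.
move=> FF Ft0; apply: cvg_near_cst; apply: nearW => t.
rewrite (_ : _ - _ - _ - _ = 0) ?mul0r//; ring.
Qed.

Lemma row_lin3 (a b : R) (p q r : 'rV[R]_3) k : (p + a *: q + b *: r) 0 k = p 0 k + a * q 0 k + b * r 0 k.
Proof. by rewrite !mxE. Qed.

(** Transversal curves across the rulings, with all possible slopes s, give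
    access to the mixed second derivative of the ruled parametrization. *)
Lemma jet2_ruling (F : set_system R) c e t0 u s : Filter F -> F --> t0^' ->
  analytic_vec c t0 -> analytic_vec e t0 -> forall k,
  jet2 F (fun t => (c t + (u + s * (t - t0)) *: e t) 0 k) t0
    ((dvec c t0 + u *: dvec e t0 + s *: e t0) 0 k)
    ((dvec (dvec c) t0 + u *: dvec (dvec e) t0 + (2 * s) *: dvec e t0) 0 k).
Proof.
move=> FF Ft0 cA eA k; set w := (X in jet2 _ _ _ _ X); set v := (X in jet2 _ _ _ X _).
rewrite /v /w !row_lin3 !dvec2E !dvecE.
have -> : (fun t => (c t + (u + s * (t - t0)) *: e t) 0 k) = (fun t => c t 0 k + (u + s * (t - t0)) * e t 0 k).
  by apply/funext => t; rewrite mxE [X in _ + X]mxE.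
by apply: jet2_affine => //; apply: jet2_sub Ft0 _; exact: analytic_jet2.
Qed.

(** The coefficient is the same for a and 1 / a, so the order of the principal
    curvatures is irrelevant. *)
Lemma ratio_quadratic (a k1 k2 : R) : a != 0 -> k1 * k2 != 0 -> k1 / k2 = a \/ k2 / k1 = a ->
  (k1 + k2) ^+ 2 = (a + 1) ^+ 2 / a * (k1 * k2).
Proof.
move=> a0; rewrite mulf_eq0 negb_or => /andP[k10 k20].
have H (x y : R) : x != 0 -> y != 0 -> x / y = a -> (x + y) ^+ 2 = (a + 1) ^+ 2 / a * (x * y).
  by move=> x0 y0 <-; field; rewrite x0 y0.
by case=> [/H ->//|/H H']; rewrite addrC (mulrC k1) H'.
Qed.

(** Three curves through the point with parameters t0 and u osculate the chart:
    the ruling itself, and two transversal ones.  The latter stay on the surface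
    only at parameters t in T, whence the filter. *)
Lemma ruling_ratio S c e t0 (T : set R) (q q' u a : R) : a != 0 ->
  (forall p, S p -> exists k1 k2, [/\ principal_curvatures S p k1 k2, k1 * k2 != 0 & k1 / k2 = a \/ k2 / k1 = a]) ->
  analytic_vec c t0 -> analytic_vec e t0 ->
  T t0 -> ProperFilter (within T t0^') ->
  (forall t v, T t -> q < v < q' -> S (c t + v *: e t)) -> q < u < q' ->
  let r1 := dvec c t0 + u *: dvec e t0 in
  let r11 := dvec (dvec c) t0 + u *: dvec (dvec e) t0 in
  let N := cross r1 (e t0) in
  (dot (e t0) (e t0) * dot r11 N - 2 * dot r1 (e t0) * dot (dvec e t0) N) ^+ 2
    = - ((a + 1) ^+ 2 / a) * dot (dvec e t0) N ^+ 2 * dot N N /\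
  (dot (dvec e t0) N = 0 -> dot N N = 0).
Proof.
move=> a0 Sa cA eA Tt0 PF TS qu r1 r11 N.
have [k1 [k2 [[U [M [phi [x0 [chart UMx0 phix0 cp]]]]] k12 ka]]] := Sa _ (TS t0 u Tt0 qu).
have [_ _ phiA phiF _] := chart.
have [g0 [nn n0 n1] nE cpE] := chart_principal (phiA _ UMx0.1) (phiF _ UMx0.1).
have [tr de] := (cpE k1 k2).1 cp.
have c0 : cross (partial 0 phi x0) (partial 1 phi x0) != 0.
  by apply: (row_free_cross _ _ (phiF _ UMx0.1)) => k; exact: mxE.
have F1 : within T t0^' --> t0^' by exact: cvg_within.
have osc s : osculates (partial 0 phi x0) (partial 1 phi x0) (partial 0 (partial 0 phi) x0)
    (partial 1 (partial 0 phi) x0) (partial 1 (partial 1 phi) x0) (r1 + s *: e t0) (r11 + (2 * s) *: dvec e t0).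
  apply: (chart_curve_jet (gam := fun t => c t + (u + s * (t - t0)) *: e t) chart UMx0 PF F1).
  - have : \forall t \near t0, q < u + s * (t - t0) < q'.
      have uc : u + s * (t - t0) @[t --> t0] --> u + s * (t0 - t0).
        by apply: cvgD; [exact: cvg_cst|apply: cvgM; [exact: cvg_cst|apply: cvgB; [exact: cvg_id|exact: cvg_cst]]].
      rewrite subrr mulr0 addr0 in uc; have /andP[qu1 qu2] := qu.
      by apply: filterS2 (cvgr_gt _ uc _ qu1) (cvgr_lt _ uc _ qu2) => t -> ->.
    move=> H; rewrite near_withinE; near=> t => Tt; apply: TS => //.
    by near: t; exact: nbhs_dnbhs.
  - by rewrite subrr mulr0 addr0.
  - exact: jet2_ruling.
(* the ruling itself, for which all nearby parameters are available *)
have osce : osculates (partial 0 phi x0) (partial 1 phi x0) (partial 0 (partial 0 phi) x0)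
    (partial 1 (partial 0 phi) x0) (partial 1 (partial 1 phi) x0) (e t0) 0.
  apply: (chart_curve_jet (F := t0^') (t0 := t0) (gam := fun t => (c t0 + u *: e t0) + (t - t0) *: e t0) chart UMx0) => //.
  - have : \forall t \near t0, q < u + (t - t0) < q'.
      have uc : u + (t - t0) @[t --> t0] --> u + (t0 - t0).
        by apply: cvgD; [exact: cvg_cst|apply: cvgB; [exact: cvg_id|exact: cvg_cst]].
      rewrite subrr addr0 in uc; have /andP[qu1 qu2] := qu.
      by apply: filterS2 (cvgr_gt _ uc _ qu1) (cvgr_lt _ uc _ qu2) => t -> ->.
    move=> H; near=> t; rewrite -addrA -scalerDl; apply: TS => //.
    by near: t; exact: nbhs_dnbhs.
  - by rewrite subrr scale0r addr0.
  - move=> k; have -> : (0 : 'rV[R]_3) 0 k = 0 by exact: mxE.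
    have -> : (fun t => ((c t0 + u *: e t0) + (t - t0) *: e t0) 0 k) = (fun t => (c t0 + u *: e t0) 0 k + (t - t0) * e t0 0 k).
      by apply/funext => t; rewrite [LHS]mxE [X in _ + X]mxE.
    exact: jet2_line.
have o1 := osc 0; rewrite scale0r mulr0 scale0r !addr0 in o1.
have o2 := osc 1; rewrite scale1r mulr1 in o2.
exact: (ruled_curvature_ratio c0 o1 osce o2 nn n0 n1 nE tr de k12 (ratio_quadratic a0 k12 ka)).
Unshelve. all: by end_near. Qed.

End RulingRatio.

(** * Parameters whose rulings share an interval *)

Section Condensation.
Variable R : realType.

Lemma not_isolated_proper (T : set R) t : T t -> ~ isolated T t -> ProperFilter (within T t^').
Proof.
move=> Tt nis; have : closure T t by exact: subset_closure.
rewrite closure_isolated_limit_point => -[//|lT].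
apply: Build_ProperFilter_ex => A HA; have [s [st Ts As]] := lT _ HA.
by exists s; exact: As.
Qed.

Lemma uncountable_itvoo (a b : R) : a < b -> ~ countable `]a, b[%classic.
Proof.
move=> ab /countable_lebesgue_measure0; rewrite lebesgue_measure_itv/= lte_fin ab -EFinB => -[] /eqP.
by rewrite subr_eq0 gt_eqF.
Qed.

(** For rationals q < q', let T be the set of parameters whose segment contains
    ]q, q'[.  Every parameter belongs to some T; if it were always an isolated point
    there, the interval ]a, b[ would be a countable union of sets of isolated
    points, each of which is countable. *)
Lemma condensation_ruling (I : set R) (J : R -> set R) (a b : R) : a < b -> (forall t, a < t < b -> I t) ->
  (forall t, I t -> is_interval (J t) /\ exists u v, [/\ J t u, J t v & u != v]) ->
  exists t0 (T : set R) (q q' : R), [/\ a < t0 < b, q < q', T t0, ProperFilter (within T t0^') &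
    forall t v, T t -> q < v < q' -> I t /\ J t v].
Proof.
move=> ab abI IJ.
pose T (p : rat * rat) := [set t | I t /\ forall v, ratr p.1 < v < ratr p.2 -> J t v].
apply: contrapT => H; apply: (uncountable_itvoo ab).
apply: (@sub_countable _ _ _ (\bigcup_(p in [set: rat * rat]) isolated (T p))); last first.
  by apply: bigcup_countable => // p _; exact: countable_isolated.
apply: subset_card_le => t /=; rewrite in_itv/= => tab.
have It := abI _ tab; have [Jt [u [v [Ju Jv uv]]]] := IJ _ It.
wlog uv' : u v Ju Jv {uv} / u < v.
  by move=> W; case: (ltgtP u v) uv => // uv _; [exact: (W u v)|exact: (W v u)].
have [q /itvP quv] := rat_in_itvoo uv'.
have qv : ratr q < v by rewrite quv.
have [q' /itvP q'v] := rat_in_itvoo qv.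
have Tt : T (q, q') t.
  split => // w /= /andP[qw wq']; apply: (Jt u v Ju Jv).
  by rewrite (le_trans _ (ltW qw)) ?quv//= (le_trans (ltW wq'))// q'v.
exists (q, q') => //; apply: contrapT => nis; apply: H.
exists t, (T (q, q')), (ratr q), (ratr q'); split => //; first by rewrite q'v.
  exact: not_isolated_proper.
by move=> s w [Is HJ] /HJ.
Qed.

End Condensation.

(** * The polynomial identity along a ruling *)

Section RulingCoefficients.
Variable R : realType.
Implicit Types (u v w : 'rV[R]_3) (c e : R -> 'rV[R]_3) (I : set R).

Lemma poly_eq0_itv (p : {poly R}) (q q' : R) : q < q' -> (forall u : R, q < u < q' -> p.[u] = 0) -> p = 0.
Proof.
move=> qq' p0; apply: contrapT => /eqP pn0.
pose h := (q' - q) / (size p).+1%:R.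
have h0 : 0 < h by rewrite divr_gt0 ?subr_gt0.
pose rs := [seq q + i.+1%:R * h | i <- iota 0 (size p)].
have /(_ rs) := max_poly_roots pn0.
rewrite size_map size_iota ltnn => H; suff : false by []; apply: H.
  apply/allP => _ /mapP[i + ->]; rewrite mem_iota add0n => /= ip; apply/rootP; apply: p0.
  rewrite ltrDl mulr_gt0//= -ltrBrDl /h mulrCA gtr_pMr ?subr_gt0//.
  by rewrite ltr_pdivrMr// mul1r ltr_nat ltnS.
rewrite map_inj_uniq ?iota_uniq// => i j /addrI /(mulIf (lt0r_neq0 h0)) /eqP.
by rewrite eqr_nat eqSS => /eqP.
Qed.

Lemma quartic_eq0_itv (a0 a1 a2 a3 a4 q q' : R) : q < q' ->
  (forall u : R, q < u < q' -> a0 + a1 * u + a2 * u ^+ 2 + a3 * u ^+ 3 + a4 * u ^+ 4 = 0) ->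
  [/\ a0 = 0, a1 = 0, a2 = 0, a3 = 0 & a4 = 0].
Proof.
move=> qq' H; have p0 : Poly [:: a0; a1; a2; a3; a4] = 0.
  apply: (poly_eq0_itv qq') => u /H <-; rewrite horner_Poly/=; ring.
have E i := congr1 (fun p : {poly R} => p`_i) p0.
have := E 0%N; have := E 1%N; have := E 2%N; have := E 3%N; have := E 4%N.
by rewrite !coef_Poly !coef0/=.
Qed.

Lemma cross_lin_l (s : R) u v w : cross (u + s *: v) w = cross u w + s *: cross v w.
Proof.
have [E0 E1 E2] := crossE (u + s *: v) w; have [F0 F1 F2] := crossE u w; have [G0 G1 G2] := crossE v w.
by apply/rowP; apply: ord3P; rewrite (E0, E1, E2) [RHS]mxE [X in _ = _ + X]mxE (F0, F1, F2) (G0, G1, G2) !mxE; ring.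
Qed.

(** A Gram determinant: both cross products are orthogonal to w, and their own
    cross product is a multiple of w. *)
Lemma dot_cross_cross_common u v w :
  dot (cross u w) (cross u w) * dot (cross v w) (cross v w) - dot (cross u w) (cross v w) ^+ 2
   = dot w w * dot v (cross u w) ^+ 2.
Proof.
rewrite !dotE; have [-> -> ->] := crossE u w; have [-> -> ->] := crossE v w; ring.
Qed.

(** Both sides of the curvature equation are polynomials in u of degree at most
    4.  The coefficient of u^4 shows that P has degree at most 1; the others,
    with the Gram determinant |e|^2 m^2 of X and Y, leave no room for A. *)
Lemma ruling_coefficients (c1 c2 e e1 e2 : 'rV[R]_3) (A q q' : R) : e != 0 -> q < q' ->
  (forall u : R, q < u < q' ->
   let r1 := c1 + u *: e1 in let N := cross r1 e in
   (dot e e * dot (c2 + u *: e2) N - 2 * dot r1 e * dot e1 N) ^+ 2 = - A * dot e1 N ^+ 2 * dot N N /\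
   (dot e1 N = 0 -> dot N N = 0)) ->
  let X := cross c1 e in let Y := cross e1 e in let m := dot e1 X in
  [/\ [/\ dot e e * dot c2 X - 2 * dot c1 e * m = 0,
      dot e e * (dot c2 Y + dot e2 X) - 2 * dot e1 e * m = 0 &
      dot e2 Y = 0],
    m != 0 -> A = 0 & m = 0 -> X = 0 /\ Y = 0].
Proof.
move=> e0 qq' H X Y m.
set P0 := _ - _; set P1 := (X in [/\ _, X = 0 & _]).
have G0 : dot e e != 0 by rewrite dot_eq0.
pose P2 := dot e e * dot e2 Y.
have mN (u : R) : dot e1 (cross (c1 + u *: e1) e) = m.
  by rewrite cross_lin_l dotDr dotZr dot_crossl mulr0 addr0.
have NN (u : R) : dot (cross (c1 + u *: e1) e) (cross (c1 + u *: e1) e) = dot X X + 2 * dot X Y * u + dot Y Y * u ^+ 2.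
  by rewrite cross_lin_l !(dotDl, dotDr, dotZl, dotZr) (dotC Y X); ring.
have PE (u : R) : dot e e * dot (c2 + u *: e2) (cross (c1 + u *: e1) e) - 2 * dot (c1 + u *: e1) e * m
    = P0 + P1 * u + P2 * u ^+ 2.
  by rewrite cross_lin_l !(dotDl, dotDr, dotZl, dotZr) /P0 /P1 /P2 -/X -/Y; ring.
have [z0 z1 z2 z3 z4] : [/\ P0 ^+ 2 + A * m ^+ 2 * dot X X = 0, 2 * P0 * P1 + A * m ^+ 2 * (2 * dot X Y) = 0,
     P1 ^+ 2 + 2 * P0 * P2 + A * m ^+ 2 * dot Y Y = 0, 2 * P1 * P2 = 0 & P2 ^+ 2 = 0].
  apply: (quartic_eq0_itv qq') => u /H [+ _]; rewrite mN NN PE => Hu.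
  by rewrite -[RHS](subrr ((P0 + P1 * u + P2 * u ^+ 2) ^+ 2)) {2}Hu; ring.
have P20 : P2 = 0 by apply/eqP; rewrite -sqrf_eq0 z4.
rewrite P20 mulr0 addr0 in z2.
have e2Y : dot e2 Y = 0 by move: P20 => /eqP; rewrite mulf_eq0 (negPf G0) => /eqP.
have A0 : m != 0 -> A = 0.
  move=> m0; have D := dot_cross_cross_common c1 e1 e; rewrite -/X -/Y -/m in D.
  have : A ^+ 2 * m ^+ 4 * (dot X X * dot Y Y - dot X Y ^+ 2) = 0.
    (* elimination of P0 and P1: P0^2 P1^2 = (P0 P1)^2 *)
    transitivity ((P0 ^+ 2 + A * m ^+ 2 * dot X X) * (A * m ^+ 2 * dot Y Y)
      - (P1 ^+ 2 + A * m ^+ 2 * dot Y Y) * P0 ^+ 2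
      + (2 * P0 * P1 + A * m ^+ 2 * (2 * dot X Y)) * (2 * P0 * P1 - A * m ^+ 2 * (2 * dot X Y)) / 4); first by field.
    by rewrite z0 z1 z2 !mul0r subr0 addr0.
  rewrite D => /eqP; rewrite !(expf_eq0, mulf_eq0) (negPf G0) (negPf m0) /= ?orbF ?orbb.
  by move/eqP.
have Am : A * m ^+ 2 = 0.
  by have [->|/A0 ->] := eqVneq m 0; rewrite ?expr0n ?mulr0 ?mul0r.
rewrite Am !mul0r !addr0 in z0 z2.
split => //.
  by split => //; apply/eqP; rewrite -sqrf_eq0; [rewrite z0|rewrite z2].
move=> m0; have [|XX _ YY _ _] := @quartic_eq0_itv (dot X X) (2 * dot X Y) (dot Y Y) 0 0 q q' qq'.
  by move=> u /H [_]; rewrite mN NN m0 !mul0r !addr0 => ->.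
by split; apply/eqP; rewrite -dot_eq0 ?XX ?YY.
Qed.
End RulingCoefficients.

(** * Minimal or degenerate rulings *)

Section RulingDichotomy.
Variable R : realType.
Implicit Types (u v w : 'rV[R]_3) (c e : R -> 'rV[R]_3) (I : set R) (S : set 'rV[R]_3).

Lemma cvg_dot (T : Type) (F : set_system T) (f g : T -> 'rV[R]_3) a b : Filter F ->
  f @ F --> a -> g @ F --> b -> dot (f t) (g t) @[t --> F] --> dot a b.
Proof.
move=> FF fa gb; rewrite dotE; under eq_fun do rewrite dotE.
by apply: cvgD; [apply: cvgD|]; apply: cvgM; exact: cvg_coord.
Qed.

Lemma cvg_cross (T : Type) (F : set_system T) (f g : T -> 'rV[R]_3) a b : Filter F ->
  f @ F --> a -> g @ F --> b -> cross (f t) (g t) @[t --> F] --> cross a b.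
Proof.
move=> FF fa gb; apply: cvg_row; have [E0 E1 E2] := crossE a b.
apply: ord3P; rewrite (E0, E1, E2).
- under eq_fun do rewrite (let: And3 E _ _ := crossE _ _ in E).
  by apply: cvgB; apply: cvgM; exact: cvg_coord.
- under eq_fun do rewrite (let: And3 _ E _ := crossE _ _ in E).
  by apply: cvgB; apply: cvgM; exact: cvg_coord.
- under eq_fun do rewrite (let: And3 _ _ E := crossE _ _ in E).
  by apply: cvgB; apply: cvgM; exact: cvg_coord.
Qed.

Lemma analytic_vec_cvg (g : R -> 'rV[R]_3) t : analytic_vec g t -> g @ t --> g t.
Proof. by move=> gA; apply: cvg_row => k; exact: analytic_continuous (gA k). Qed.

Lemma near_itv (a b t : R) : a < t < b -> \forall s \near t, a < s < b.
Proof.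
have id_t : s @[s --> t] --> t by exact: cvg_id.
by move=> /andP[at_ tb]; apply: filterS2 (cvgr_gt _ id_t _ at_) (cvgr_lt _ id_t _ tb) => s -> ->.
Qed.

Lemma dense_eq0 (G I : set R) (f : R -> R) t :
  (forall a b, a < b -> (forall t, a < t < b -> I t) -> exists2 s, a < s < b & G s) ->
  nbhs t I -> f @ t --> f t -> (forall s, G s -> f s = 0) -> f t = 0.
Proof.
move=> dG It fc f0; apply: contrapT => /eqP ft0.
have [d /= d0 dP] : \forall s \near t, I s /\ f s != 0.
  near=> s; split; near: s => //.
  exact: (@cvgr_neq0 _ _ _ _ _ f (f t)).
have tt : t - d < t + d by lra.
have H s : t - d < s < t + d -> I s /\ f s != 0.
  by move=> st; apply: dP; rewrite /ball_/= ltr_norml; lra.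
have [|s /H [_ fs] /f0 fs0] := dG _ _ tt; first by move=> s /H [].
by rewrite fs0 eqxx in fs.
Unshelve. all: by end_near. Qed.

(** [ruling_coefficients] holds at a dense set of parameters, and its conclusions
    on P and N pass to the limit.  If m is nonzero somewhere, it is so at
    one of these parameters, so A = 0, that is a = -1. *)
Lemma ruled_dichotomy I (J : R -> set R) c e S (a : R) :
  analytic_curve I c -> analytic_curve I e ->
  (forall t, I t -> [/\ e t != 0, is_interval (J t) & exists u v : R, [/\ J t u, J t v & u != v]]) ->
  S = \bigcup_(t in I) [set c t + u *: e t | u in J t] -> a != 0 ->
  (forall p, S p -> exists k1 k2, [/\ principal_curvatures S p k1 k2, k1 * k2 != 0 & k1 / k2 = a \/ k2 / k1 = a]) ->
  let X t := cross (dvec c t) (e t) in let Y t := cross (dvec e t) (e t) in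
  let m t := dot (dvec e t) (X t) in
  (forall t, nbhs t I -> [/\ dot (e t) (e t) * dot (dvec (dvec c) t) (X t) - 2 * dot (dvec c t) (e t) * m t = 0,
     dot (e t) (e t) * (dot (dvec (dvec c) t) (Y t) + dot (dvec (dvec e) t) (X t)) - 2 * dot (dvec e t) (e t) * m t = 0
     & dot (dvec (dvec e) t) (Y t) = 0]) /\
  ((exists t, nbhs t I /\ m t != 0) /\ a = -1 \/ (forall t, nbhs t I -> X t = 0 /\ Y t = 0)).
Proof.
move=> cA eA IJ SE a0 Sa X Y m.
have cV t : nbhs t I -> analytic_vec c t := analytic_curve_vec cA.
have eV t : nbhs t I -> analytic_vec e t := analytic_curve_vec eA.
pose A := (a + 1) ^+ 2 / a.
pose Q0 t := dot (e t) (e t) * dot (dvec (dvec c) t) (X t) - 2 * dot (dvec c t) (e t) * m t.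
pose Q1 t := dot (e t) (e t) * (dot (dvec (dvec c) t) (Y t) + dot (dvec (dvec e) t) (X t)) - 2 * dot (dvec e t) (e t) * m t.
pose Q2 t := dot (dvec (dvec e) t) (Y t).
pose G := [set t | [/\ [/\ Q0 t = 0, Q1 t = 0 & Q2 t = 0], m t != 0 -> A = 0 & m t = 0 -> X t = 0 /\ Y t = 0]].
(* G collects the parameters to which ruling_coefficients applies *)
have dG (p q : R) : p < q -> (forall t, p < t < q -> I t) -> exists2 s, p < s < q & G s.
  move=> pq pqI; have [|t [T [q1 [q2 [tpq q12 Tt PF TJ]]]]] := condensation_ruling (J := J) pq pqI.
    by move=> t It; have [_ ? ?] := IJ t It.
  have It : nbhs t I.
    by apply: filterS (near_itv tpq) => s; exact: pqI.
  exists t => //; apply: (ruling_coefficients _ q12); first by have [] := IJ t (pqI _ tpq).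
  move=> u qu; apply: (ruling_ratio (S := S) (T := T) (q := q1) (q' := q2)) => //; [exact: cV|exact: eV|].
  by move=> s v Ts qv; rewrite SE; have [Is Jv] := TJ s v Ts qv; exists s => //; exists v.
have [c0' c1' c2'] : [/\ forall t, nbhs t I -> c @ t --> c t, forall t, nbhs t I -> dvec c @ t --> dvec c t &
   forall t, nbhs t I -> dvec (dvec c) @ t --> dvec (dvec c) t].
  split=> t /cV H; by apply: analytic_vec_cvg; do ?apply: analytic_dvec.
have [e0' e1' e2'] : [/\ forall t, nbhs t I -> e @ t --> e t, forall t, nbhs t I -> dvec e @ t --> dvec e t &
   forall t, nbhs t I -> dvec (dvec e) @ t --> dvec (dvec e) t].
  split=> t /eV H; by apply: analytic_vec_cvg; do ?apply: analytic_dvec.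
have Xc t : nbhs t I -> X @ t --> X t by move=> It; apply: cvg_cross; [exact: c1'|exact: e0'].
have Yc t : nbhs t I -> Y @ t --> Y t by move=> It; apply: cvg_cross; [exact: e1'|exact: e0'].
have mc t : nbhs t I -> m @ t --> m t by move=> It; apply: cvg_dot; [exact: e1'|exact: Xc].
split=> [t It|].
  have [cc1 cc2 ce ce1 ce2] := And5 (c1' _ It) (c2' _ It) (e0' _ It) (e1' _ It) (e2' _ It).
  have [cX cY cm] := And3 (Xc _ It) (Yc _ It) (mc _ It).
  have cst2 : (fun=> 2 : R) @ t --> (2 : R) by exact: cvg_cst.
  split.
  - apply: (dense_eq0 (f := Q0) dG It); last by move=> s [[]].
    apply: cvgB; first by apply: cvgM; [exact: (cvg_dot _ ce ce)|exact: (cvg_dot _ cc2 cX)].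
    by apply: cvgM; [exact: (cvgM cst2 (cvg_dot _ cc1 ce))|exact: cm].
  - apply: (dense_eq0 (f := Q1) dG It); last by move=> s [[]].
    apply: cvgB; last by apply: cvgM; [exact: (cvgM cst2 (cvg_dot _ ce1 ce))|exact: cm].
    apply: cvgM; first exact: (cvg_dot _ ce ce).
    by apply: cvgD; [exact: (cvg_dot _ cc2 cY)|exact: (cvg_dot _ ce2 cX)].
  - by apply: (dense_eq0 (f := Q2) dG It (cvg_dot _ ce2 cY)) => s [[]].
have [[t [It mt]]|nm] := pselect (exists t, nbhs t I /\ m t != 0).
  left; split; first by exists t.
  have [s [Gs ms]] : exists s, G s /\ m s != 0.
    apply: contrapT => H; move/eqP: mt; apply; apply: (dense_eq0 dG It (mc _ It)) => s Gs.
    by apply: contrapT => /eqP ms; apply: H; exists s.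
  have [_ /(_ ms) A0 _] := Gs; apply/eqP; rewrite -subr_eq0 opprK.
  by move/eqP: A0; rewrite /A mulf_eq0 invr_eq0 (negPf a0) orbF sqrf_eq0.
right=> t It; have m0 s : nbhs s I -> m s = 0.
  by move=> Is; apply: contrapT => /eqP ms; apply: nm; exists s.
pose G' := G `&` [set s | nbhs s I].
have dG' (p q : R) : p < q -> (forall t, p < t < q -> I t) -> exists2 s, p < s < q & G' s.
  move=> pq pqI; have [s spq Gs] := dG p q pq pqI; exists s => //; split => //=.
  by apply: filterS (near_itv spq) => r; exact: pqI.
split; apply/eqP; rewrite -dot_eq0; apply/eqP.
- apply: (dense_eq0 (f := fun t => dot (X t) (X t)) dG' It); first exact: (cvg_dot _ (Xc t It) (Xc t It)).
  by move=> s [[_ _ /(_ _)H] Is]; have [-> _] := H (m0 s Is); rewrite dotE !mxE; ring.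
- apply: (dense_eq0 (f := fun t => dot (Y t) (Y t)) dG' It); first exact: (cvg_dot _ (Yc t It) (Yc t It)).
  by move=> s [[_ _ /(_ _)H] Is]; have [_ ->] := H (m0 s Is); rewrite dotE !mxE; ring.
Unshelve. all: by end_near. Qed.
End RulingDichotomy.

(** * Vector calculus and linear differential equations *)

Section VectorCalculus.
Variable R : realType.
Implicit Types (u v w : 'rV[R]_3) (c e : R -> 'rV[R]_3) (I D : set R) (S : set 'rV[R]_3).

Section Pointwise.
Variables (f g : R -> R) (t a b : R).
Hypotheses (fa : is_derive t (1 : R) f a) (gb : is_derive t (1 : R) g b).

Lemma is_derive_add : is_derive t (1 : R) (fun s => f s + g s) (a + b).
Proof. exact: is_deriveD. Qed.

Lemma is_derive_sub : is_derive t (1 : R) (fun s => f s - g s) (a - b).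
Proof. exact: is_deriveB. Qed.

Lemma is_derive_mul : is_derive t (1 : R) (fun s => f s * g s) (a * g t + f t * b).
Proof.
apply: (is_derive_eq (is_deriveM fa gb)).
by rewrite /GRing.scale/= addrC mulrC.
Qed.

Lemma is_derive_div : g t != 0 -> is_derive t (1 : R) (fun s => f s / g s) ((a * g t - f t * b) / g t ^+ 2).
Proof.
move=> g0; have gV : is_derive t (1 : R) (fun s => (g s)^-1) (- (g t) ^- 2 * b).
  apply: DeriveDef; first by apply: derivableV g0 _; exact: ex_derive.
  by rewrite deriveV// derive_val.
apply: (is_derive_eq (is_deriveM fa gV)).
by rewrite /GRing.scale/=; field.
Qed.
End Pointwise.

Lemma is_derive0_interval_cst D (h : R -> R) s t : is_interval D -> D s -> D t ->
  (forall r, D r -> is_derive r (1 : R) h 0) -> h s = h t.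
Proof.
move=> iD; wlog st : s t / s < t.
  move=> W Ds Dt Dh; have [st|ts|->//] := ltgtP s t; first exact: W.
  by apply/esym; exact: W.
move=> Ds Dt Dh; have DI r : r \in `[s, t]%R -> D r.
  by rewrite in_itv/= => srt; exact: (iD s t).
have [||r _] := @MVT R h (cst 0) s t st.
- by move=> r rst; apply: Dh; apply: DI; exact: subset_itv_oo_cc.
- by apply: derivable_within_continuous => r /DI /Dh [].
by rewrite mul0r => /eqP; rewrite subr_eq0 => /eqP ->.
Qed.

(** Uniqueness for y' = mu y without exponentials: if a nonvanishing G satisfies
    G' = 2 mu G, then y^2 / G is constant.  In applications G is the squared norm of
    a direction vector. *)
Lemma linear_ode_eq0 D (y G mu : R -> R) s : is_interval D -> D s -> y s = 0 ->
  (forall r, D r -> G r != 0) ->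
  (forall r, D r -> is_derive r (1 : R) y (mu r * y r)) ->
  (forall r, D r -> is_derive r (1 : R) G (2 * mu r * G r)) -> forall t, D t -> y t = 0.
Proof.
move=> iD Ds ys G0 dy dG t Dt.
have H r : D r -> is_derive r (1 : R) (fun r => y r * y r / G r) 0.
  move=> Dr; have Gr := G0 r Dr.
  apply: (is_derive_eq (is_derive_div (is_derive_mul (dy r Dr) (dy r Dr)) (dG r Dr) Gr)).
  rewrite (_ : _ - _ = 0) ?mul0r//; ring.
have := is_derive0_interval_cst iD Dt Ds H; rewrite ys mulr0 mul0r => /eqP.
rewrite mulf_eq0 invr_eq0 (negPf (G0 t Dt)) orbF mulf_eq0 orbb.
by move/eqP.
Qed.

Definition vderiv (g : R -> 'rV[R]_3) t (v : 'rV[R]_3) := forall k, is_derive t (1 : R) (fun s => g s 0 k) (v 0 k).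

Lemma analytic_vderiv g t : analytic_vec g t -> vderiv g t (dvec g t).
Proof. by move=> gA k; rewrite dvecE; exact: analytic_is_derive. Qed.

Lemma vderiv_dot f g t a b : vderiv f t a -> vderiv g t b ->
  is_derive t (1 : R) (fun s => dot (f s) (g s)) (dot a (g t) + dot (f t) b).
Proof.
move=> fa gb; under eq_fun do rewrite dotE.
apply: (is_derive_eq (is_derive_add (is_derive_add (is_derive_mul (fa 0) (gb 0)) (is_derive_mul (fa 1) (gb 1))) (is_derive_mul (fa 2%:R) (gb 2%:R)))).
by rewrite !dotE; ring.
Qed.

Lemma vderiv_cst v t : vderiv (fun=> v) t 0.
Proof. by move=> k; rewrite mxE; exact: is_derive_cst. Qed.

Lemma vderiv_cross f g t a b : vderiv f t a -> vderiv g t b ->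
  vderiv (fun s => cross (f s) (g s)) t (cross a (g t) + cross (f t) b).
Proof.
move=> fa gb; have [E0 E1 E2] := crossE a (g t); have [F0 F1 F2] := crossE (f t) b.
apply: ord3P; rewrite mxE (E0, E1, E2) (F0, F1, F2).
- under eq_fun do rewrite (let: And3 E _ _ := crossE _ _ in E).
  apply: (is_derive_eq (is_derive_sub (is_derive_mul (fa 1) (gb 2%:R)) (is_derive_mul (fa 2%:R) (gb 1)))); ring.
- under eq_fun do rewrite (let: And3 _ E _ := crossE _ _ in E).
  apply: (is_derive_eq (is_derive_sub (is_derive_mul (fa 2%:R) (gb 0)) (is_derive_mul (fa 0) (gb 2%:R)))); ring.
- under eq_fun do rewrite (let: And3 _ _ E := crossE _ _ in E).
  apply: (is_derive_eq (is_derive_sub (is_derive_mul (fa 0) (gb 1)) (is_derive_mul (fa 1) (gb 0)))); ring.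
Qed.

Lemma cross_eq0_parallel u v : cross u v = 0 -> v != 0 -> u = (dot u v / dot v v) *: v.
Proof.
move=> uv0 v0; have vv0 : dot v v != 0 by rewrite dot_eq0.
have [] := crossE u v; rewrite uv0 !mxE => c1 c2 c3.
apply/rowP => k; rewrite mxE; apply: (mulIf vv0); rewrite mulrAC divfK//.
move: k; apply: ord3P; rewrite !dotE.
- by transitivity (u 0 0 * (v 0 0 * v 0 0 + v 0 1 * v 0 1 + v 0 2%:R * v 0 2%:R) + 0); [ring|];
  transitivity (u 0 0 * (v 0 0 * v 0 0 + v 0 1 * v 0 1 + v 0 2%:R * v 0 2%:R) - v 0 1 * 0 + v 0 2%:R * 0);
  [ring|rewrite {1}c3 c2; ring].
- by transitivity (u 0 1 * (v 0 0 * v 0 0 + v 0 1 * v 0 1 + v 0 2%:R * v 0 2%:R) + v 0 0 * 0 - v 0 2%:R * 0);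
  [ring|rewrite {1}c3 c1; ring].
- by transitivity (u 0 2%:R * (v 0 0 * v 0 0 + v 0 1 * v 0 1 + v 0 2%:R * v 0 2%:R) - v 0 0 * 0 + v 0 1 * 0);
  [ring|rewrite {1}c2 c1; ring].
Qed.

(** If f' is parallel to f, then the components of f x (f s) satisfy a linear
    equation for which |f|^2 plays the role of G. *)
Lemma constant_direction D (f f' : R -> 'rV[R]_3) s : is_interval D -> D s ->
  (forall t, D t -> [/\ f t != 0, vderiv f t (f' t) & cross (f' t) (f t) = 0]) ->
  forall t, D t -> cross (f t) (f s) = 0.
Proof.
move=> iD Ds H t Dt; pose mu r := dot (f' r) (f r) / dot (f r) (f r).
have f'E r : D r -> f' r = mu r *: f r by move=> Dr; have [f0 _ c0] := H r Dr; exact: cross_eq0_parallel.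
apply/rowP => k; rewrite [RHS]mxE.
apply: (@linear_ode_eq0 D (fun r => cross (f r) (f s) 0 k) (fun r => dot (f r) (f r)) mu s iD Ds _ _ _ _ t Dt).
- have [c0 c1 c2] := crossE (f s) (f s).
  by move: k; apply: ord3P; rewrite (c0, c1, c2); ring.
- by move=> r Dr; have [? _ _] := H r Dr; rewrite dot_eq0.
- move=> r Dr; have [_ fd _] := H r Dr.
  apply: (is_derive_eq (vderiv_cross fd (vderiv_cst (f s) r) k)).
  rewrite f'E// mxE; have [E0 E1 E2] := crossE (mu r *: f r) (f s); have [F0 F1 F2] := crossE (f r) (f s).
  have [G0 G1 G2] := crossE (f r) 0.
  by move: k; apply: ord3P; rewrite (E0, E1, E2) (F0, F1, F2) (G0, G1, G2) !mxE; ring.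
- move=> r Dr; have [_ fd _] := H r Dr; apply: (is_derive_eq (vderiv_dot fd fd)).
  by rewrite f'E// dotZl dotZr; ring.
Qed.
End VectorCalculus.

(** * Interiors of intervals; surfaces are not contained in a line *)

Section SurfaceNotInLine.
Variable R : realType.
Implicit Types (u v w : 'rV[R]_3) (c e : R -> 'rV[R]_3) (I D : set R) (S : set 'rV[R]_3) (phi : 'rV[R]_2 -> 'rV[R]_3).

Lemma nbhs_between I (s t r : R) : is_interval I -> I s -> I t -> s < r < t -> nbhs r I.
Proof.
move=> iI Is It srt; apply: filterS (near_itv srt) => x /andP[sx xt].
by apply: (iI s t) => //; rewrite !ltW.
Qed.

Lemma interior_interval I : is_interval I -> is_interval [set t : R | nbhs t I].
Proof.
move=> iI s t /= Is It r /andP[]; rewrite le_eqVlt => /predU1P[<-//|sr].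
rewrite le_eqVlt => /predU1P[->//|rt].
by apply: (nbhs_between iI (nbhs_singleton Is) (nbhs_singleton It)); rewrite sr.
Qed.

Lemma interior_limit_point I (s0 t r : R) : is_interval I -> nbhs s0 I -> I t -> 0 < r ->
  exists s : R, [/\ nbhs s I, s != t & `|s - t| < r].
Proof.
move=> iI Is0 It r0; have [s1 Is1 s1t] : exists2 s1, I s1 & s1 != t.
  have /nbhs_ballP[e /= e0 eI] := Is0.
  have e2 : ball s0 e (s0 + e / 2) by rewrite /ball/= opprD addrA subrr sub0r normrN gtr0_norm; lra.
  have [ts|ts] := eqVneq s0 t; last by exists s0 => //; exact: nbhs_singleton.
  by exists (s0 + e / 2); [exact: eI|rewrite ts -subr_eq0 addrAC subrr add0r gt_eqF//; lra].
pose l := Num.min 2^-1 (r / (2 * `|s1 - t|)).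
have d0 : 0 < `|s1 - t| by rewrite normr_gt0 subr_eq0.
have l0 : 0 < l by rewrite lt_min invr_gt0 ltr0n divr_gt0// mulr_gt0.
have l1 : l < 1 by rewrite gt_min invf_lt1// ltr1n.
exists (t + l * (s1 - t)); split.
- have [ts|st] : t < s1 \/ s1 < t by apply/orP; rewrite -neq_lt eq_sym.
    apply: (nbhs_between iI It Is1); apply/andP; split; nra.
  apply: (nbhs_between iI Is1 It); apply/andP; split; nra.
- by rewrite addrC -subr_eq0 addrK mulf_neq0 ?subr_eq0// lt0r_neq0.
- rewrite addrC addKr normrM gtr0_norm//.
  have : l <= r / (2 * `|s1 - t|) by rewrite ge_min lexx orbT.
  rewrite ler_pdivlMr ?mulr_gt0//; lra.
Qed.

Lemma analytic_curve_cvg I (s0 : R) c (t : R) : is_interval I -> nbhs s0 I -> analytic_curve I c -> I t ->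
  c @ within I (nbhs t) --> c t.
Proof.
move=> iI Is0 cA It; apply: cvg_row => k.
apply: (@taylorable_cvg _ I (fun s => c s 0 k)) => //.
apply: analytic_taylorable (cA t It k) => r r0.
have [s [Is st sr]] := interior_limit_point iI Is0 It r0.
by exists s; split => //; exact: nbhs_singleton.
Qed.

(** For identities which are established in the interior, where derivatives
    exist, and are needed at the endpoints. *)
Lemma eq0_interior_extend I (s0 : R) (f : R -> R) (t : R) : is_interval I -> nbhs s0 I -> I t ->
  f @ within I (nbhs t) --> f t -> (forall s : R, nbhs s I -> f s = 0) -> f t = 0.
Proof.
move=> iI Is0 It fc f0; have PF : ProperFilter (within [set s : R | nbhs s I] (nbhs t)).
  apply: Build_ProperFilter_ex => A /nbhs_ballP[r /= r0 rA].
  have [s [Is st sr]] := interior_limit_point iI Is0 It r0.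
  by exists s; apply: rA => //; rewrite /ball/= distrC.
apply: (cvg_unique (@Rhausdorff R) (F := f @ within [set s : R | nbhs s I] (nbhs t))).
  apply: cvg_trans fc; apply: cvg_app => P; rewrite !nbhs_simpl /within/=.
  by apply: filterS => x H Ix; exact: H (nbhs_singleton Ix).
by apply: cvg_near_cst; rewrite near_withinE; exact: nearW.
Qed.

Lemma row_lin3' (a b c : R) (p q r : 'rV[R]_3) k : (a *: p + b *: q + c *: r) 0 k = a * p 0 k + b * q 0 k + c * r 0 k.
Proof. by rewrite !mxE. Qed.

Lemma cubic_remainder_jet2 (f : R -> R) (v w K r : R) : 0 < r ->
  (forall s, `|s| < r -> `|f s - (f 0 + s * v + s ^+ 2 / 2 * w)| <= K * `|s| ^+ 3) -> jet2 0^' f 0 v w.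
Proof.
move=> r0 fK; apply: (@cvg_to_0_linear _ _ K _ r0) => s /andP[s0 sr].
rewrite !subr0 normrM normfV normrX ler_pdivrMr ?exprn_gt0//.
have -> : K * `|s| * `|s| ^+ 2 = K * `|s| ^+ 3 by ring.
by have := fK s sr; rewrite !opprD !addrA.
Qed.

Lemma quad_line (p A0 A1 B00 B01 B11 h0 h1 s : R) :
  p + A0 * (s * h0) + A1 * (s * h1) + quad B00 B01 B11 (s * h0) (s * h1) =
  p + s * (h0 * A0 + h1 * A1) + s ^+ 2 / 2 * (h0 ^+ 2 * B00 + 2 * h0 * h1 * B01 + h1 ^+ 2 * B11).
Proof. by rewrite /quad; field. Qed.

(** The images of straight lines of the chart domain, the curves by which a
    chart is compared with another surface. *)
Lemma chart_line_jet phi x0 (h : 'rV[R]_2) : (forall k : 'I_3, analytic_at2 (fun y => phi y 0 k) x0) ->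
  forall k, jet2 0^' (fun s : R => phi (s *: h + x0) 0 k) 0
   ((h 0 0 *: partial 0 phi x0 + h 0 1 *: partial 1 phi x0) 0 k)
   ((h 0 0 ^+ 2 *: partial 0 (partial 0 phi) x0 + (2 * h 0 0 * h 0 1) *: partial 1 (partial 0 phi) x0
      + h 0 1 ^+ 2 *: partial 1 (partial 1 phi) x0) 0 k).
Proof.
move=> phiA k; have [_ [K [r [r0 K0 HK]]]] := analytic_map_jet phiA.
pose H := `|h 0 0| + `|h 0 1|; have H0 : 0 <= H by rewrite addr_ge0.
have d0 : 0 < r / (H + 1) by rewrite divr_gt0// ltr_wpDl.
rewrite row_lin3' row_lin2.
apply: (@cubic_remainder_jet2 _ _ _ (K * H ^+ 3) _ d0) => s sr.
have sH : `|s| * (H + 1) < r by rewrite -ltr_pdivlMr// ltr_wpDl.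
have h0H : `|h 0 0| <= H by rewrite lerDl.
have h1H : `|h 0 1| <= H by rewrite lerDr.
have x0E : (s *: h + x0) 0 0 - x0 0 0 = s * h 0 0 by rewrite !mxE; ring.
have x1E : (s *: h + x0) 0 1 - x0 0 1 = s * h 0 1 by rewrite !mxE; ring.
have := HK (s *: h + x0) k; rewrite x0E x1E scale0r add0r !normrM -mulrDr -/H.
have -> : `|s| * `|h 0 0| < r by rewrite (le_lt_trans _ sH)// ler_wpM2l// (le_trans h0H)// lerDl.
have -> : `|s| * `|h 0 1| < r by rewrite (le_lt_trans _ sH)// ler_wpM2l// (le_trans h1H)// lerDl.
move=> /(_ isT isT); rewrite exprMn.
rewrite quad_line.
have -> : K * (`|s| ^+ 3 * H ^+ 3) = K * H ^+ 3 * `|s| ^+ 3 by ring.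
exact.
Qed.

(** At a boundary point of the surface only the directions pointing into the
    half-plane are available, and only for s > 0. *)
Lemma chart_domain_segment (U M : set 'rV[R]_2) x0 (h : 'rV[R]_2) : open U -> M = setT \/ M = @half_plane R -> (U `&` M) x0 ->
  0 <= h 0 1 -> \forall s \near (0 : R)^'+, (U `&` M) (s *: h + x0).
Proof.
move=> oU MP [Ux0 Mx0] h1.
have hc : s *: h + x0 @[s --> (0 : R)] --> (0 : R) *: h + x0.
  by apply: cvgD; [apply: cvgZr_tmp; exact: cvg_id|exact: cvg_cst].
rewrite scale0r add0r in hc.
have US : \forall s \near (0 : R), U (s *: h + x0) by apply: hc; exact: open_nbhs_nbhs.
have {}US : \forall s \near (0 : R)^'+, U (s *: h + x0) by exact: cvg_within US.
near=> s; split; first by near: s.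
case: MP Mx0 => -> //; rewrite /half_plane/= => x01; rewrite !mxE addr_ge0// mulr_ge0//.
Unshelve. all: by end_near. Qed.

Lemma at_right_dnbhs (x : R) : x^'+ --> x^'.
Proof.
move=> P; rewrite !nbhs_simpl /at_right /dnbhs /within/=.
by apply: filterS => y H xy; apply: H; rewrite gt_eqF.
Qed.

Lemma crossZl (a : R) u v : cross (a *: u) v = a *: cross u v.
Proof.
have [E0 E1 E2] := crossE (a *: u) v; have [F0 F1 F2] := crossE u v.
by apply/rowP; apply: ord3P; rewrite (E0, E1, E2) [RHS]mxE (F0, F1, F2) !mxE; ring.
Qed.

Lemma crossBl u v w : cross (u - v) w = cross u w - cross v w.
Proof. by rewrite -scaleN1r cross_lin_l scaleN1r. Qed.

Lemma crossZZ (a b : R) u : cross (a *: u) (b *: u) = 0.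
Proof.
have [E0 E1 E2] := crossE (a *: u) (b *: u).
by apply/rowP; apply: ord3P; rewrite (E0, E1, E2) !mxE; ring.
Qed.

(** The velocities of the two coordinate half-lines of a chart would both be
    parallel to d, contradicting the injectivity of the differential. *)
Lemma surface_not_in_line S p0 d : analytic_surface S -> S !=set0 -> d != 0 ->
  ~ (forall p, S p -> cross (p - p0) d = 0).
Proof.
move=> [_ SC] [p Sp] d0 H.
have [U [M [phi [x0 [[oU MP phiA phiF [V [psi [_ UMV _ _]]]] UMx0 phix0]]]]] := SC p Sp.
have Sphi x : (U `&` M) x -> S (phi x).
  by move=> UMx; have [] : (S `&` V) (phi x) by rewrite -UMV; exists x.
have vel (h : 'rV[R]_2) : 0 <= h 0 1 -> cross (h 0 0 *: partial 0 phi x0 + h 0 1 *: partial 1 phi x0) d = 0.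
  move=> h1; set v := _ + _.
  have F0 := @at_right_dnbhs 0.
  have J k := jet2_sub F0 (chart_line_jet h (phiA _ UMx0.1) k).
  have V1 k : (phi (s *: h + x0) 0 k - phi ((0 : R) *: h + x0) 0 k) / (s - 0) @[s --> (0 : R)^'+] --> v 0 k.
    exact: jet2_velocity F0 (J k).
  have vc : s^-1 *: (phi (s *: h + x0) - phi x0) @[s --> (0 : R)^'+] --> v.
    apply: cvg_row => k; have := V1 k.
    apply: cvg_trans; apply: near_eq_cvg; near=> s.
    by rewrite subr0 scale0r add0r mulrC !mxE.
  have dc : (fun=> d) @ (0 : R)^'+ --> d by exact: cvg_cst.
  apply: (cvg_unique (@norm_hausdorff _ _) (cvg_cross _ vc dc)).
  apply: cvg_near_cst; near=> s.
  have Ss : S (phi (s *: h + x0)).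
    by apply: Sphi; near: s; exact: chart_domain_segment.
  have -> : phi (s *: h + x0) - phi x0 = (phi (s *: h + x0) - p0) - (phi x0 - p0).
    by rewrite opprB addrA subrK.
  by rewrite crossZl crossBl (H _ Ss) (H _ (Sphi _ UMx0)) subrr scaler0.
have c0 : cross (partial 0 phi x0) (partial 1 phi x0) != 0.
  by apply: (row_free_cross _ _ (phiF _ UMx0.1)) => k; exact: mxE.
move/eqP: c0; apply.
have v0 := vel (delta_mx 0 0); have v1 := vel (delta_mx 0 1).
have d00 : (delta_mx 0 0 : 'rV[R]_2) 0 0 = 1 by exact: mxE.
have d01 : (delta_mx 0 0 : 'rV[R]_2) 0 1 = 0 by exact: mxE.
have d10 : (delta_mx 0 1 : 'rV[R]_2) 0 0 = 0 by exact: mxE.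
have d11 : (delta_mx 0 1 : 'rV[R]_2) 0 1 = 1 by exact: mxE.
rewrite d00 d01 scale1r scale0r addr0 in v0; rewrite d10 d11 scale1r scale0r add0r in v1.
rewrite (cross_eq0_parallel (v0 (lexx 0)) d0) (cross_eq0_parallel (v1 ler01) d0).
exact: crossZZ.
Unshelve. all: by end_near. Qed.
End SurfaceNotInLine.

(** * Degenerate families of lines, and screw motions *)

Section LinesAndScrews.
Variable R : realType.
Implicit Types (u v w : 'rV[R]_3) (c e : R -> 'rV[R]_3) (I D : set R) (S : set 'rV[R]_3).

(** As e' is parallel to e, the direction of e is constant; then c' is parallel
    to this direction. *)
Lemma ruling_in_line I c e (t1 : R) : is_interval I -> nbhs t1 I -> analytic_curve I c -> analytic_curve I e ->
  (forall t, I t -> e t != 0) ->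
  (forall t : R, nbhs t I -> cross (dvec c t) (e t) = 0 /\ cross (dvec e t) (e t) = 0) ->
  forall t (u : R), I t -> cross (c t + u *: e t - c t1) (e t1) = 0.
Proof.
move=> iI It1 cA eA e0 H.
have cV t : nbhs t I -> analytic_vec c t := analytic_curve_vec cA.
have eV t : nbhs t I -> analytic_vec e t := analytic_curve_vec eA.
have iI' := interior_interval iI.
have He t : nbhs t I -> cross (e t) (e t1) = 0.
  apply: (@constant_direction _ [set t : R | nbhs t I] e (dvec e) t1 iI' It1) => s Is.
  split; [by apply: e0; exact: nbhs_singleton|exact/analytic_vderiv/eV|by have [] := H s Is].
have e10 : e t1 != 0 by apply: e0; exact: nbhs_singleton.
have Hc t : nbhs t I -> cross (c t) (e t1) = cross (c t1) (e t1).
  move=> It; apply/rowP => k; apply: (is_derive0_interval_cst (h := fun s => cross (c s) (e t1) 0 k) iI' It It1) => s Is.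
  apply: (is_derive_eq (vderiv_cross (analytic_vderiv (cV s Is)) (vderiv_cst (e t1) s) k)).
  have es0 : e s != 0 by apply: e0; exact: nbhs_singleton.
  rewrite (cross_eq0_parallel (H s Is).1 es0) crossZl He// scaler0 add0r.
  have [E0 E1 E2] := crossE (c s) 0.
  by move: k; apply: ord3P; rewrite (E0, E1, E2) !mxE; ring.
move=> t u It; apply/rowP => k; rewrite [RHS]mxE.
apply: (eq0_interior_extend (f := fun t => cross (c t + u *: e t - c t1) (e t1) 0 k) iI It1 It).
  have cc := analytic_curve_cvg iI It1 cA It; have ec := analytic_curve_cvg iI It1 eA It.
  apply: cvg_coord; apply: cvg_cross; last exact: cvg_cst.
  apply: cvgB; last exact: cvg_cst.
  apply: cvgD => //; apply: cvgZl_tmp; exact: ec.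
move=> s Is; rewrite crossBl cross_lin_l He// scaler0 addr0 Hc// subrr; exact: mxE.
Qed.

(** The rulings are horizontal: the base curve is (x, y, z) and the direction
    (e1, e2, 0), a further digit 1 or 2 marking first and second derivatives
    (x1 = x', x2 = x'', e11 = e1', e12 = e1'').  Then W / G is the
    derivative of the polar angle of the direction, s is the third component of
    (e1, e2) x (x', y'), and P0, P1 express the vanishing of the two coefficients
    of P that the horizontality leaves. *)
Section PlanarDirection.
Variables (D : set R) (x y e1 e2 x1 y1 z1 e11 e21 x2 y2 z2 e12 e22 : R -> R).
Hypotheses (iD : is_interval D)
  (dx : forall t, D t -> is_derive t (1 : R) x (x1 t)) (dx1 : forall t, D t -> is_derive t (1 : R) x1 (x2 t))
  (dy : forall t, D t -> is_derive t (1 : R) y (y1 t)) (dy1 : forall t, D t -> is_derive t (1 : R) y1 (y2 t))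
  (dz1 : forall t, D t -> is_derive t (1 : R) z1 (z2 t))
  (de1 : forall t, D t -> is_derive t (1 : R) e1 (e11 t)) (de11 : forall t, D t -> is_derive t (1 : R) e11 (e12 t))
  (de2 : forall t, D t -> is_derive t (1 : R) e2 (e21 t)) (de21 : forall t, D t -> is_derive t (1 : R) e21 (e22 t)).
Let G t := e1 t * e1 t + e2 t * e2 t.
Let W t := e1 t * e21 t - e2 t * e11 t.
Let W' t := e1 t * e22 t - e2 t * e12 t.
Let s t := y1 t * e1 t - x1 t * e2 t.
Hypotheses (z0 : forall t, D t -> z1 t != 0) (W0 : forall t, D t -> W t != 0)
  (P0 : forall t, D t -> G t * (z1 t * (y2 t * e1 t - x2 t * e2 t) - z2 t * s t) - 2 * (x1 t * e1 t + y1 t * e2 t) * (z1 t * W t) = 0)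
  (P1 : forall t, D t -> G t * (z1 t * W' t - z2 t * W t) - 2 * (e11 t * e1 t + e21 t * e2 t) * (z1 t * W t) = 0).

Let G0 t : D t -> G t != 0.
Proof.
move=> Dt; apply: contra (W0 Dt); rewrite /G -!expr2 paddr_eq0 ?sqr_ge0// !sqrf_eq0 => /andP[/eqP h1 /eqP h2].
by rewrite /W h1 h2 !mul0r subrr.
Qed.

Let dG t : D t -> is_derive t (1 : R) G (2 * (e11 t * e1 t + e21 t * e2 t)).
Proof.
move=> Dt; apply: (is_derive_eq (is_derive_add (is_derive_mul (de1 Dt) (de1 Dt)) (is_derive_mul (de2 Dt) (de2 Dt)))); ring.
Qed.

Let dW t : D t -> is_derive t (1 : R) W (W' t).
Proof.
move=> Dt; apply: (is_derive_eq (is_derive_sub (is_derive_mul (de1 Dt) (de21 Dt)) (is_derive_mul (de2 Dt) (de11 Dt)))).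
by rewrite /W'; ring.
Qed.

(** P1 = 0 says that the logarithmic derivatives of W and G z' agree; the
    quotient is the rate at which the ruling turns per unit of height. *)
Lemma constant_pitch t t0 : D t -> D t0 -> W t / (G t * z1 t) = W t0 / (G t0 * z1 t0).
Proof.
move=> Dt Dt0; apply: (is_derive0_interval_cst (h := fun t => W t / (G t * z1 t)) iD Dt Dt0) => r Dr.
have Gz : G r * z1 r != 0 by rewrite mulf_neq0 ?G0 ?z0.
apply: (is_derive_eq (is_derive_div (dW Dr) (is_derive_mul (dG Dr) (dz1 Dr)) Gz)).
rewrite (_ : _ - _ = 0) ?mul0r//; have := P1 Dr; move=> <-; ring.
Qed.

(** Elimination of z'' between P0 = 0 and P1 = 0. *)
Let closing t : D t -> W t * (y2 t * e1 t - x2 t * e2 t) - s t * W' t + 2 * W t * (y1 t * e11 t - x1 t * e21 t) = 0.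
Proof.
move=> Dt; have Gz : G t * z1 t != 0 by rewrite mulf_neq0 ?G0 ?z0.
apply: (mulfI Gz); rewrite mulr0.
transitivity (W t * (G t * (z1 t * (y2 t * e1 t - x2 t * e2 t) - z2 t * s t) - 2 * (x1 t * e1 t + y1 t * e2 t) * (z1 t * W t))
  - s t * (G t * (z1 t * W' t - z2 t * W t) - 2 * (e11 t * e1 t + e21 t * e2 t) * (z1 t * W t))).
  by rewrite /G /W /W' /s; ring.
by rewrite P0// P1// !mulr0 subrr.
Qed.

Let ds t : D t -> is_derive t (1 : R) s (y2 t * e1 t + y1 t * e11 t - (x2 t * e2 t + x1 t * e21 t)).
Proof. by move=> Dt; exact: (is_derive_sub (is_derive_mul (dy1 Dt) (de1 Dt)) (is_derive_mul (dx1 Dt) (de2 Dt))). Qed.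

(** The derivative of s / W is the opposite of (y' e1' - x' e2') / W. *)
Let dq (f f1 p p1 : R -> R) t : D t -> is_derive t (1 : R) f (f1 t) -> is_derive t (1 : R) p (p1 t) ->
  W t * f1 t + (y1 t * e11 t - x1 t * e21 t) * p t - s t * p1 t = 0 ->
  is_derive t (1 : R) (fun t => f t - s t / W t * p t) 0.
Proof.
move=> Dt df dp H; have Wt := W0 Dt.
apply: (is_derive_eq (is_derive_sub df (is_derive_mul (is_derive_div (ds Dt) (dW Dt) Wt) dp))).
have K : (y2 t * e1 t + y1 t * e11 t - (x2 t * e2 t + x1 t * e21 t)) * W t - s t * W' t = - (W t * (y1 t * e11 t - x1 t * e21 t)).
  by apply/eqP; rewrite -subr_eq0 -(closing Dt); apply/eqP; ring.
rewrite K.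
transitivity ((W t * f1 t + (y1 t * e11 t - x1 t * e21 t) * p t - s t * p1 t) / W t); first by field.
by rewrite H mul0r.
Qed.

(** The foot of the axis is c - (s / W) e, the projection of the point of
    striction of the ruling; it does not move. *)
Lemma fixed_axis t0 : D t0 -> exists q1 q2, forall t, D t -> (y t - q2) * e1 t - (x t - q1) * e2 t = 0.
Proof.
move=> Dt0; exists (x t0 - s t0 / W t0 * e1 t0), (y t0 - s t0 / W t0 * e2 t0) => t Dt.
have Hx r : D r -> is_derive r (1 : R) (fun t => x t - s t / W t * e1 t) 0.
  move=> Dr; apply: (dq Dr (dx Dr) (de1 Dr)); rewrite /W /s; ring.
have Hy r : D r -> is_derive r (1 : R) (fun t => y t - s t / W t * e2 t) 0.
  move=> Dr; apply: (dq Dr (dy Dr) (de2 Dr)); rewrite /W /s; ring.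
have := is_derive0_interval_cst iD Dt0 Dt Hx; have := is_derive0_interval_cst iD Dt0 Dt Hy.
by move=> /= -> ->; ring.
Qed.

End PlanarDirection.
End LinesAndScrews.

(** * Change of orthonormal frame *)

Section Frame.
Variable R : realType.
Implicit Types (u v w : 'rV[R]_3) (c e : R -> 'rV[R]_3) (I D : set R) (Q : 'M[R]_3).

Lemma mulmx_trE v Q i : (v *m Q^T) 0 i = \sum_k v 0 k * Q i k.
Proof. by rewrite mxE; apply: eq_bigr => k _; rewrite mxE. Qed.

Lemma dot_mulmx_tr u v Q : Q *m Q^T = 1%:M -> dot (u *m Q^T) (v *m Q^T) = dot u v.
Proof.
move=> QQ; have dE a b : dot a b = (a *m b^T) 0 0 :> R.
  by rewrite mxE; apply: eq_bigr => k _; rewrite [in RHS]mxE.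
by rewrite !dE trmx_mul trmxK mulmxA -[_ *m Q]mulmxA (mulmx1C QQ) mulmx1.
Qed.

(** The factor d is the determinant of Q, expanded; it enters as a common
    factor of the equations and disappears from them. *)
Lemma triple_mulmx_tr Q : exists d : R, forall a b c : 'rV[R]_3,
  dot (a *m Q^T) (cross (b *m Q^T) (c *m Q^T)) = d * dot a (cross b c).
Proof.
exists (Q 0 0 * (Q 1 1 * Q 2%:R 2%:R - Q 1 2%:R * Q 2%:R 1) - Q 0 1 * (Q 1 0 * Q 2%:R 2%:R - Q 1 2%:R * Q 2%:R 0)
  + Q 0 2%:R * (Q 1 0 * Q 2%:R 1 - Q 1 1 * Q 2%:R 0)) => a b c.
rewrite !dotE; have [-> -> ->] := crossE (b *m Q^T) (c *m Q^T); have [-> -> ->] := crossE b c.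
rewrite !mulmx_trE !sum3E; ring.
Qed.

(** Rows u / |u|, (u x w) / (|u| |w|) and sg w / |w|; the sign sg is kept free
    so that the handedness of the helicoid can be absorbed by the frame. *)
Lemma orthonormal_frame u w (sg : R) : u != 0 -> w != 0 -> dot u w = 0 -> sg ^+ 2 = 1 ->
  exists Q, [/\ Q *m Q^T = 1%:M,
    forall p, (p *m Q^T) 0 0 = dot p u / Num.sqrt (dot u u),
    forall p, (p *m Q^T) 0 1 = dot p (cross u w) / (Num.sqrt (dot u u) * Num.sqrt (dot w w)) &
    forall p, (p *m Q^T) 0 2%:R = sg * (dot p w / Num.sqrt (dot w w))].
Proof.
move=> u0 w0 uw s2.
have U2 : Num.sqrt (dot u u) ^+ 2 = dot u u by rewrite sqr_sqrtr// dot_ge0.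
have W2 : Num.sqrt (dot w w) ^+ 2 = dot w w by rewrite sqr_sqrtr// dot_ge0.
have U0 : Num.sqrt (dot u u) != 0 by rewrite sqrtr_eq0 -ltNge dot_gt0.
have W0 : Num.sqrt (dot w w) != 0 by rewrite sqrtr_eq0 -ltNge dot_gt0.
move: (Num.sqrt (dot u u)) (Num.sqrt (dot w w)) U2 W2 U0 W0 => U W U2 W2 U0 W0.
pose f (i : 'I_3) := if i == 0 then U^-1 *: u else if i == 1 then (U * W)^-1 *: cross u w else (sg / W) *: w.
pose Q := \matrix_(i < 3) f i.
have QE p i : (p *m Q^T) 0 i = dot p (f i).
  by rewrite mulmx_trE; apply: eq_bigr => k _; rewrite mxE.
exists Q; split; last 3 first.
- by move=> p; rewrite QE /f eqxx dotZr mulrC.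
- by move=> p; rewrite QE /f /= dotZr mulrC.
- by move=> p; rewrite QE /f /= dotZr; ring.
have uu : dot (f 0) (f 0) = 1 by rewrite /f eqxx dotZl dotZr -U2; field.
have ww : dot (f 2%:R) (f 2%:R) = 1.
  by rewrite /f /= dotZl dotZr -W2 -s2; field.
have cc : dot (f 1) (f 1) = 1.
  by rewrite /f /= dotZl dotZr dot_cross_cross uw -U2 -W2; field; rewrite U0 W0.
have uc : dot (f 0) (f 1) = 0 by rewrite /f /= dotZl dotZr dot_crossl !mulr0.
have wc : dot (f 2%:R) (f 1) = 0 by rewrite /f /= dotZl dotZr dot_crossr !mulr0.
have uw' : dot (f 0) (f 2%:R) = 0 by rewrite /f /= dotZl dotZr uw !mulr0.
have QQ i j : (Q *m Q^T) i j = dot (f i) (f j).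
  by rewrite mxE; apply: eq_bigr => k _; rewrite !mxE.
apply/matrixP => i j; rewrite QQ mxE; move: i j; apply: ord3P; apply: ord3P => //=; by rewrite // dotC.
Qed.

Lemma vderiv_mulmx_tr (g : R -> 'rV[R]_3) t v Q : vderiv g t v -> vderiv (fun s => g s *m Q^T) t (v *m Q^T).
Proof.
move=> gv k; under eq_fun do rewrite mulmx_trE sum3E.
have cst (q : R) : is_derive t (1 : R) (fun=> q) 0 by exact: is_derive_cst.
apply: (is_derive_eq (is_derive_add (is_derive_add (is_derive_mul (gv 0) (cst (Q k 0))) (is_derive_mul (gv 1) (cst (Q k 1)))) (is_derive_mul (gv 2%:R) (cst (Q k 2%:R))))).
by rewrite mulmx_trE sum3E; ring.
Qed.

Lemma taylorable_mulmx_tr D (g : R -> 'rV[R]_3) t Q k : (forall j, taylorable D (fun s => g s 0 j) t) ->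
  taylorable D (fun s => (g s *m Q^T) 0 k) t.
Proof.
move=> gT; under eq_fun do rewrite mulmx_trE.
by apply: taylorable_sum => j; apply: taylorableM => //; exact: taylorable_cst.
Qed.

Lemma cvg_mulmx_tr (F : set_system R) (g : R -> 'rV[R]_3) v Q : Filter F -> g @ F --> v ->
  forall k, (g t *m Q^T) 0 k @[t --> F] --> (v *m Q^T) 0 k.
Proof.
move=> FF gv k; under eq_fun do rewrite mulmx_trE sum3E; rewrite mulmx_trE sum3E.
by apply: cvgD; [apply: cvgD|]; apply: cvgM; (exact: cvg_cst || exact: cvg_coord).
Qed.

Lemma interior_taylorable I (f : R -> R) (t : R) : is_interval I -> nbhs t I -> analytic_within setT f t ->
  taylorable [set s : R | nbhs s I] f t.
Proof.
move=> iI It [c [r [r0 fE]]]; apply: analytic_taylorable.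
  by move=> d d0; have [s [Is st sd]] := interior_limit_point iI It (nbhs_singleton It) d0; exists s.
by exists c, r; split => // s _; exact: fE.
Qed.

(** The equations of a helicoid, established near a parameter where m is
    nonzero, propagate across the zeros of m. *)
Lemma identity_on_interior I (f : R -> R) (t0 : R) : is_interval I -> nbhs t0 I ->
  (forall t : R, nbhs t I -> taylorable [set s : R | nbhs s I] f t) ->
  (\forall t \near t0, f t = 0) -> forall t : R, nbhs t I -> f t = 0.
Proof.
move=> iI It0 fT [r /= r0 f0]; apply: (@taylorable_identity _ [set s : R | nbhs s I] f t0) => //.
- by apply/connected_intervalP; exact: interior_interval.
- move=> t It d d0; have [s [Is st sd]] := interior_limit_point iI It (nbhs_singleton It) d0.
  by exists s.
- by exists r => // t _ tr; apply: f0; rewrite /ball_/= distrC.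
Qed.

Lemma near0_derive (f : R -> R) (t d : R) : (\forall s \near t, f s = 0) -> is_derive t (1 : R) f d -> d = 0.
Proof.
move=> f0 fd; have := @near_eq_is_derive _ _ _ f (cst 0) t 1 d f0 fd.
move=> H; have := @derive_val _ _ _ _ _ _ _ H; rewrite derive_cst => <-//.
Qed.

End Frame.

(** * Rulings of a minimal ruled surface form a helicoid *)

Section HelicoidPoints.
Variable R : realType.
Implicit Types (u v w : 'rV[R]_3) (c e : R -> 'rV[R]_3) (I D : set R) (Q : 'M[R]_3).

(** The polar angle of the ruling and kap (z - z0) have the same derivative
    W / G.  To avoid choosing an angle, the quantity stated to vanish is |e| times the
    sine of their difference, and [linear_ode_eq0] applies to it. *)
Lemma ruling_angle D (kap z0 t0 : R) (z z1 e1 e2 e11 e21 : R -> R) : is_interval D -> D t0 -> e2 t0 = 0 -> z t0 = z0 ->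
  (forall t, D t -> e1 t * e1 t + e2 t * e2 t != 0) ->
  (forall t, D t -> is_derive t (1 : R) z (z1 t)) ->
  (forall t, D t -> is_derive t (1 : R) e1 (e11 t)) -> (forall t, D t -> is_derive t (1 : R) e2 (e21 t)) ->
  (forall t, D t -> kap * (e1 t * e1 t + e2 t * e2 t) * z1 t = e1 t * e21 t - e2 t * e11 t) ->
  forall t, D t -> e1 t * sin (kap * (z t - z0)) - e2 t * cos (kap * (z t - z0)) = 0.
Proof.
move=> iD Dt0 e20 zt0 G0 dz de1 de2 H.
pose mu t := (e11 t * e1 t + e21 t * e2 t) / (e1 t * e1 t + e2 t * e2 t).
apply: (@linear_ode_eq0 _ D (fun t => e1 t * sin (kap * (z t - z0)) - e2 t * cos (kap * (z t - z0)))
   (fun t => e1 t * e1 t + e2 t * e2 t) mu t0) => //.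
- by rewrite zt0 subrr mulr0 sin0 e20 mulr0 mul0r subrr.
- move=> t Dt; have cst (q : R) : is_derive t (1 : R) (fun=> q) 0 by exact: is_derive_cst.
  have da : is_derive t (1 : R) (fun t => kap * (z t - z0)) (kap * z1 t).
    by apply: (is_derive_eq (is_derive_mul (cst kap) (is_derive_sub (dz t Dt) (cst z0)))); ring.
  have ds : is_derive t (1 : R) (fun t => sin (kap * (z t - z0))) (cos (kap * (z t - z0)) * (kap * z1 t)).
    exact: (@is_derive1_comp _ sin (fun t => kap * (z t - z0)) t _ _ _ da).
  have dc : is_derive t (1 : R) (fun t => cos (kap * (z t - z0))) (- sin (kap * (z t - z0)) * (kap * z1 t)).
    exact: (@is_derive1_comp _ cos (fun t => kap * (z t - z0)) t _ _ _ da).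
  apply: (is_derive_eq (is_derive_sub (is_derive_mul (de1 t Dt) ds) (is_derive_mul (de2 t Dt) dc))).
  rewrite /mu; move: (G0 t Dt) (H t Dt).
  set S := sin _; set C := cos _; set G := e1 t * e1 t + e2 t * e2 t => Gt Ht.
  have -> : kap * z1 t = (e1 t * e21 t - e2 t * e11 t) / G by rewrite -Ht; field.
  by rewrite /G; field.
- move=> t Dt; apply: (is_derive_eq (is_derive_add (is_derive_mul (de1 t Dt) (de1 t Dt)) (is_derive_mul (de2 t Dt) (de2 t Dt)))).
  by rewrite /mu -mulrA divfK ?G0//; ring.
Qed.

(** Helicoids presented by the rate kap at which the rulings turn per unit of
    height. *)
Definition helicoid_at (kap : R) Q b := [set p : 'rV[R]_3 | exists u v : R,
   p = kap^-1 *: (vec3 (u * cos v) (u * sin v) v *m Q) + b].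

(** A horizontal line through the axis, at the angle prescribed by its height,
    is a ruling of the helicoid. *)
Lemma in_helicoid_at (kap q1 q2 z0 u : R) Q (c e : 'rV[R]_3) : kap != 0 -> Q *m Q^T = 1%:M -> e != 0 ->
  let x k := (c *m Q^T) 0 k in let y k := (e *m Q^T) 0 k in
  y 2%:R = 0 -> (x 1 - q2) * y 0 - (x 0 - q1) * y 1 = 0 ->
  y 0 * sin (kap * (x 2%:R - z0)) - y 1 * cos (kap * (x 2%:R - z0)) = 0 ->
  helicoid_at kap Q (vec3 q1 q2 z0 *m Q) (c + u *: e).
Proof.
move=> k0 QQ e0 x y y2 L A; set v := kap * (x 2%:R - z0).
set C := cos v in A *; set S := sin v in A *; have CS : C ^+ 2 + S ^+ 2 = 1 by exact: cos2Dsin2.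
pose rho := y 0 * C + y 1 * S; pose mu := (x 0 - q1) * C + (x 1 - q2) * S.
have y0E : y 0 = rho * C.
  transitivity (y 0 * (C ^+ 2 + S ^+ 2)); first by rewrite CS mulr1.
  transitivity (rho * C + S * (y 0 * S - y 1 * C)); first by rewrite /rho; ring.
  by rewrite A mulr0 addr0.
have y1E : y 1 = rho * S.
  transitivity (y 1 * (C ^+ 2 + S ^+ 2)); first by rewrite CS mulr1.
  transitivity (rho * S - C * (y 0 * S - y 1 * C)); first by rewrite /rho; ring.
  by rewrite A mulr0 subr0.
have rho0 : rho != 0.
  apply: contra e0 => /eqP r0; rewrite -dot_eq0 -(dot_mulmx_tr e e QQ) dotE.
  by rewrite -/(y 0) -/(y 1) -/(y 2%:R) y0E y1E y2 r0 !mul0r !addr0.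
have L' : (x 1 - q2) * C - (x 0 - q1) * S = 0.
  apply: (mulfI rho0); rewrite mulr0 -[RHS]L y0E y1E; ring.
have x0E : x 0 = q1 + mu * C.
  transitivity (q1 + (x 0 - q1) * (C ^+ 2 + S ^+ 2)); first by rewrite CS mulr1; ring.
  transitivity (q1 + mu * C - S * ((x 1 - q2) * C - (x 0 - q1) * S)); first by rewrite /mu; ring.
  by rewrite L' mulr0 subr0.
have x1E : x 1 = q2 + mu * S.
  transitivity (q2 + (x 1 - q2) * (C ^+ 2 + S ^+ 2)); first by rewrite CS mulr1; ring.
  transitivity (q2 + mu * S + C * ((x 1 - q2) * C - (x 0 - q1) * S)); first by rewrite /mu; ring.
  by rewrite L' mulr0 addr0.
exists (kap * (mu + u * rho)), v.
rewrite scalemxAl -mulmxDl -[LHS]mulmx1 -(mulmx1C QQ) mulmxA; congr (_ *m _).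
apply/rowP => k; rewrite mulmxDl -scalemxAl mxE [X in _ + X]mxE [RHS]mxE [X in _ = X + _]mxE.
rewrite -/(x k) -/(y k).
move: k; apply: ord3P; rewrite !mxE/= -/C -/S; [rewrite x0E y0E|rewrite x1E y1E|rewrite y2 /v]; by field.
Qed.
End HelicoidPoints.

Section HelicoidRulings.
Variable R : realType.
Implicit Types (u v w : 'rV[R]_3) (c e : R -> 'rV[R]_3) (I D : set R) (Q : 'M[R]_3).

Lemma dot_cross_cycle u v w : dot u (cross v w) = dot v (cross w u).
Proof. by rewrite !dotE; have [-> -> ->] := crossE v w; have [-> -> ->] := crossE w u; ring. Qed.

Lemma crossC u v : cross u v = - cross v u.
Proof.
have [E0 E1 E2] := crossE u v; have [F0 F1 F2] := crossE v u.
by apply/rowP; apply: ord3P; rewrite (E0, E1, E2) [RHS]mxE (F0, F1, F2); ring.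
Qed.

Lemma cross_cross_common u v w : cross (cross u w) (cross v w) = - dot v (cross u w) *: w.
Proof.
have [E0 E1 E2] := crossE (cross u w) (cross v w); have [F0 F1 F2] := crossE u w; have [G0 G1 G2] := crossE v w.
by apply/rowP; apply: ord3P; rewrite (E0, E1, E2) [RHS]mxE !dotE (F0, F1, F2) (F0, F1, F2) (F0, F1, F2)
  (G0, G1, G2) (G0, G1, G2); ring.
Qed.

Lemma crossuu u : cross u u = 0.
Proof. by have := crossZZ 1 1 u; rewrite !scale1r. Qed.

(** Translation of the coefficients of P into a frame in which e is horizontal,
    in the form required by [constant_pitch] and [fixed_axis]. *)
Lemma planar_coefficients Q (c1 c2 e e1 e2 : 'rV[R]_3) : Q *m Q^T = 1%:M ->
  let x1 := c1 *m Q^T in let x2 := c2 *m Q^T in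
  let y := e *m Q^T in let y1 := e1 *m Q^T in let y2 := e2 *m Q^T in
  y 0 2%:R = 0 -> y1 0 2%:R = 0 -> y2 0 2%:R = 0 ->
  let X := cross c1 e in let Y := cross e1 e in let m := dot e1 X in
  dot e e * dot c2 X - 2 * dot c1 e * m = 0 ->
  dot e e * (dot c2 Y + dot e2 X) - 2 * dot e1 e * m = 0 ->
  let G := y 0 0 * y 0 0 + y 0 1 * y 0 1 in let W := y 0 0 * y1 0 1 - y 0 1 * y1 0 0 in
  [/\ dot e e = G,
   G * (x1 0 2%:R * (x2 0 1 * y 0 0 - x2 0 0 * y 0 1) - x2 0 2%:R * (x1 0 1 * y 0 0 - x1 0 0 * y 0 1))
    - 2 * (x1 0 0 * y 0 0 + x1 0 1 * y 0 1) * (x1 0 2%:R * W) = 0,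
   G * (x1 0 2%:R * (y 0 0 * y2 0 1 - y 0 1 * y2 0 0) - x2 0 2%:R * W)
    - 2 * (y1 0 0 * y 0 0 + y1 0 1 * y 0 1) * (x1 0 2%:R * W) = 0 &
   m != 0 -> x1 0 2%:R != 0 /\ W != 0].
Proof.
move=> QQ x1 x2 y y1 y2 y3 y13 y23 X Y m H0 H1 G W.
have [d dE] := triple_mulmx_tr Q.
have d0 : d != 0.
  apply/eqP => d0; have := dE (delta_mx 0 0 *m Q) (delta_mx 0 1 *m Q) (delta_mx 0 2%:R *m Q).
  rewrite -!mulmxA QQ !mulmx1 d0 mul0r dotE.
  have [-> -> ->] := crossE (delta_mx 0 1) (delta_mx 0 2%:R : 'rV[R]_3).
  by rewrite !mxE/= => /eqP; rewrite !(mul0r, mulr0, mulr1, mul1r, subr0, addr0) oner_eq0.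
have dotQ a b := dot_mulmx_tr a b QQ.
have ee : dot e e = G by rewrite -dotQ -/y dotE y3 mul0r addr0.
have c1e : dot c1 e = x1 0 0 * y 0 0 + x1 0 1 * y 0 1 by rewrite -dotQ -/y -/x1 dotE y3 mulr0 addr0.
have e1e : dot e1 e = y1 0 0 * y 0 0 + y1 0 1 * y 0 1 by rewrite -dotQ -/y -/y1 dotE y3 mulr0 addr0.
have dX v : d * dot v X = (v *m Q^T) 0 0 * - (x1 0 2%:R * y 0 1)
    + (v *m Q^T) 0 1 * (x1 0 2%:R * y 0 0) + (v *m Q^T) 0 2%:R * (x1 0 0 * y 0 1 - x1 0 1 * y 0 0).
  by rewrite -dE -/x1 -/y dotE; have [-> -> ->] := crossE x1 y; rewrite y3; ring.
have dY v : d * dot v Y = - ((v *m Q^T) 0 2%:R * W).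
  by rewrite -dE -/y1 -/y dotE; have [-> -> ->] := crossE y1 y; rewrite y3 y13 /W; ring.
have dm : d * m = x1 0 2%:R * W by rewrite dX -/y1 y13 /W; ring.
split => //.
- have := congr1 ( *%R d) H0; rewrite mulr0 => <-.
  rewrite ee c1e; transitivity (G * (d * dot c2 X) - 2 * (x1 0 0 * y 0 0 + x1 0 1 * y 0 1) * (d * m)); last by ring.
  by rewrite dX dm -/x2; ring.
- have := congr1 ( *%R d) H1; rewrite mulr0 => <-.
  rewrite ee e1e; transitivity (G * (d * dot c2 Y + d * dot e2 X) - 2 * (y1 0 0 * y 0 0 + y1 0 1 * y 0 1) * (d * m)); last by ring.
  by rewrite dX dY dm -/x2 -/y2 y23; ring.
- by move=> m0; apply/andP; rewrite -negb_or -mulf_eq0 -dm mulf_neq0.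
Qed.

(** Catalan's theorem for rulings.  On an interval D around t0 where m is
    nonzero, e'' . (e' x e) = 0 makes the direction of e' x e constant, and
    the scalar analysis of the pitch and the axis applies.  Each equation
    is then extended to the interior of I by the identity theorem, and to its
    endpoints by continuity. *)
Lemma ruling_in_helicoid I c e (t0 : R) : is_interval I -> nbhs t0 I -> analytic_curve I c -> analytic_curve I e ->
  (forall t, I t -> e t != 0) ->
  let X t := cross (dvec c t) (e t) in let Y t := cross (dvec e t) (e t) in
  let m t := dot (dvec e t) (X t) in
  (forall t : R, nbhs t I -> [/\ dot (e t) (e t) * dot (dvec (dvec c) t) (X t) - 2 * dot (dvec c t) (e t) * m t = 0,
     dot (e t) (e t) * (dot (dvec (dvec c) t) (Y t) + dot (dvec (dvec e) t) (X t)) - 2 * dot (dvec e t) (e t) * m t = 0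
     & dot (dvec (dvec e) t) (Y t) = 0]) ->
  m t0 != 0 ->
  exists (kap : R) Q b, [/\ 0 < kap, Q *m Q^T = 1%:M & forall t (u : R), I t -> helicoid_at kap Q b (c t + u *: e t)].
Proof.
move=> iI It0 cA eA e0 X Y m P012 mt0.
have cV t : nbhs t I -> analytic_vec c t := analytic_curve_vec cA.
have eV t : nbhs t I -> analytic_vec e t := analytic_curve_vec eA.
have dc t : nbhs t I -> vderiv c t (dvec c t) by move=> /cV; exact: analytic_vderiv.
have de t : nbhs t I -> vderiv e t (dvec e t) by move=> /eV; exact: analytic_vderiv.
have ddc t : nbhs t I -> vderiv (dvec c) t (dvec (dvec c) t) by move=> /cV /analytic_dvec; exact: analytic_vderiv.
have dde t : nbhs t I -> vderiv (dvec e) t (dvec (dvec e) t) by move=> /eV /analytic_dvec; exact: analytic_vderiv.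
have [r /= r0 rP] : \forall t \near t0, nbhs t I /\ m t != 0.
  have mc : m @ t0 --> m t0.
    have e1c : dvec e @ t0 --> dvec e t0 by apply: analytic_vec_cvg; exact: analytic_dvec (eV _ It0).
    have c1c : dvec c @ t0 --> dvec c t0 by apply: analytic_vec_cvg; exact: analytic_dvec (cV _ It0).
    exact: (cvg_dot _ e1c (cvg_cross _ c1c (analytic_vec_cvg (eV _ It0)))).
  near=> t; split; near: t; first exact: (near_join It0).
  exact: (@cvgr_neq0 _ _ _ _ _ m (m t0)).
pose D := [set t : R | `|t0 - t| < r].
have iD : is_interval D.
  move=> s t; rewrite /D/= !ltr_norml => /andP[s1 s2] /andP[t1 t2] q /andP[sq qt].
  by rewrite ltr_norml; apply/andP; split; lra.
have Dt0 : D t0 by rewrite /D/= subrr normr0.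
have DI t : D t -> nbhs t I by move=> /rP[].
have Dm t : D t -> m t != 0 by move=> /rP[].
have nearD : \forall t \near t0, D t by exists r.
have dot0r v : dot v 0 = 0 by rewrite dotE !mxE; ring.
have dotNr v w : dot v (- w) = - dot v w by rewrite -scaleN1r dotZr mulN1r.
have mE t : m t = - dot (dvec c t) (Y t) by rewrite /m dot_cross_cycle crossC dotNr.
have Y0 t : D t -> Y t != 0.
  by move=> Dt; apply: contra (Dm t Dt) => /eqP Yt; rewrite mE Yt dot0r oppr0.
have eY t : D t -> dot (e t) (Y t0) = 0.
  (* Y' = e'' x e is parallel to Y since e'' . Y = 0 *)
  move=> Dt; have H : cross (Y t0) (Y t) = 0.
    apply: (@constant_direction _ D Y (fun s => cross (dvec (dvec e) s) (e s)) t iD Dt _ t0 Dt0) => s Ds.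
    have Is := DI s Ds; split; first exact: Y0.
    - have := vderiv_cross (dde s Is) (de s Is); rewrite crossuu addr0; exact.
    - have [_ _ P2] := P012 s Is.
      by rewrite cross_cross_common dot_cross_cycle crossC dotNr -/(Y s) P2 !oppr0 scale0r.
  by rewrite (cross_eq0_parallel H (Y0 t Dt)) dotZr dot_crossr mulr0.
have Te t k : nbhs t I -> taylorable [set s : R | nbhs s I] (fun s => e s 0 k) t.
  by move=> It; exact: (interior_taylorable iI It (eV t It k)).
have Tc t k : nbhs t I -> taylorable [set s : R | nbhs s I] (fun s => c s 0 k) t.
  by move=> It; exact: (interior_taylorable iI It (cV t It k)).
have Tde t k : nbhs t I -> taylorable [set s : R | nbhs s I] (fun s => dvec e s 0 k) t.
  by move=> It; exact: (interior_taylorable iI It (analytic_dvec (eV t It) k)).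
have Tdc t k : nbhs t I -> taylorable [set s : R | nbhs s I] (fun s => dvec c s 0 k) t.
  by move=> It; exact: (interior_taylorable iI It (analytic_dvec (cV t It) k)).
have e00 : e t0 != 0 by apply: e0; exact: nbhs_singleton.
(* orients the axis so that the height increases at t0, which makes kap positive *)
pose sg := Num.sg (dot (dvec c t0) (Y t0)).
have cY0 : dot (dvec c t0) (Y t0) != 0 by have := mt0; rewrite mE oppr_eq0.
have sg2 : sg ^+ 2 = 1 by rewrite sqr_sg cY0.
have [Q [QQ Q0 Q1 Q2]] := orthonormal_frame e00 (Y0 t0 Dt0) (eY t0 Dt0) sg2.
pose x k t := (c t *m Q^T) 0 k; pose x1 k t := (dvec c t *m Q^T) 0 k; pose x2 k t := (dvec (dvec c) t *m Q^T) 0 k.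
pose y k t := (e t *m Q^T) 0 k; pose y1 k t := (dvec e t *m Q^T) 0 k; pose y2 k t := (dvec (dvec e) t *m Q^T) 0 k.
have dx k t : nbhs t I -> is_derive t (1 : R) (x k) (x1 k t) by move=> It; exact: (vderiv_mulmx_tr Q (dc t It)).
have dx1 k t : nbhs t I -> is_derive t (1 : R) (x1 k) (x2 k t) by move=> It; exact: (vderiv_mulmx_tr Q (ddc t It)).
have dy k t : nbhs t I -> is_derive t (1 : R) (y k) (y1 k t) by move=> It; exact: (vderiv_mulmx_tr Q (de t It)).
have dy1 k t : nbhs t I -> is_derive t (1 : R) (y1 k) (y2 k t) by move=> It; exact: (vderiv_mulmx_tr Q (dde t It)).
have y3 t : nbhs t I -> y 2%:R t = 0.
  apply: (identity_on_interior iI It0) => [s Is|]; first by apply: taylorable_mulmx_tr => j; exact: Te.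
  by apply: filterS nearD => s Ds; rewrite /y Q2 eY// mul0r mulr0.
have nearI (t : R) : nbhs t I -> \forall s \near t, nbhs (s : R) I by exact: nbhs_interior.
have y13 t : nbhs t I -> y1 2%:R t = 0.
  move=> It; apply: (near0_derive _ (dy 2%:R t It)).
  by apply: filterS (nearI t It) => s Is; exact: y3.
have y23 t : nbhs t I -> y2 2%:R t = 0.
  move=> It; apply: (near0_derive _ (dy1 2%:R t It)).
  by apply: filterS (nearI t It) => s Is; exact: y13.
pose W t := y 0 t * y1 1 t - y 1 t * y1 0 t.
pose G t := y 0 t * y 0 t + y 1 t * y 1 t.
have coef t (It : nbhs t I) := let: And3 H0 H1 _ := P012 t It in
  planar_coefficients QQ (y3 t It) (y13 t It) (y23 t It) H0 H1.
have GE t : nbhs t I -> dot (e t) (e t) = G t by move=> /coef[].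
have P0 t : nbhs t I -> G t * (x1 2%:R t * (x2 1 t * y 0 t - x2 0 t * y 1 t) - x2 2%:R t * (x1 1 t * y 0 t - x1 0 t * y 1 t))
    - 2 * (x1 0 t * y 0 t + x1 1 t * y 1 t) * (x1 2%:R t * W t) = 0 by move=> /coef[].
have P1 t : nbhs t I -> G t * (x1 2%:R t * (y 0 t * y2 1 t - y 1 t * y2 0 t) - x2 2%:R t * W t)
    - 2 * (y1 0 t * y 0 t + y1 1 t * y 1 t) * (x1 2%:R t * W t) = 0 by move=> /coef[].
have WD t : D t -> x1 2%:R t != 0 /\ W t != 0.
  by move=> Dt; have [_ _ _ H] := coef t (DI t Dt); exact: H (Dm t Dt).
have y00 : 0 < y 0 t0 by rewrite /y Q0 divr_gt0 ?sqrtr_gt0 ?dot_gt0.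
have y10 : y 1 t0 = 0 by rewrite /y Q1 dot_crossl mul0r.
have y110 : 0 < y1 1 t0.
  rewrite /y1 Q1 -dot_cross_cycle -/(Y t0) divr_gt0 ?mulr_gt0 ?sqrtr_gt0 ?dot_gt0//; exact: Y0.
have x120 : 0 < x1 2%:R t0.
  rewrite /x1 Q2 mulrA -normrEsg divr_gt0 ?normr_gt0 ?sqrtr_gt0 ?dot_gt0//; exact: Y0.
have W0 : 0 < W t0 by rewrite /W y10 mul0r subr0 mulr_gt0.
have G0 : 0 < G t0 by rewrite /G y10 mul0r addr0 mulr_gt0.
pose kap := W t0 / (G t0 * x1 2%:R t0).
have kap0 : 0 < kap by rewrite divr_gt0// mulr_gt0.
have GI t : nbhs t I -> G t != 0.
  by move=> It; rewrite -GE// dot_eq0 e0//; exact: nbhs_singleton.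
have zD t : D t -> x1 2%:R t != 0 by move=> /WD[].
have WD' t : D t -> y 0 t * y1 1 t - y 1 t * y1 0 t != 0 by move=> /WD[].
have pitchD t : D t -> kap * G t * x1 2%:R t - W t = 0.
  move=> Dt; have Gt := GI t (DI t Dt); have zt := zD t Dt.
  have E : W t / (G t * x1 2%:R t) = kap.
    exact: (constant_pitch iD (fun t Dt => dx1 2%:R t (DI t Dt)) (fun t Dt => dy 0 t (DI t Dt))
      (fun t Dt => dy1 0 t (DI t Dt)) (fun t Dt => dy 1 t (DI t Dt)) (fun t Dt => dy1 1 t (DI t Dt)) zD WD'
      (fun t Dt => P1 t (DI t Dt)) Dt Dt0).
  by rewrite -E; field; rewrite Gt zt.
have [q1 [q2 axisD]] := fixed_axis iD (fun t Dt => dx 0 t (DI t Dt)) (fun t Dt => dx1 0 t (DI t Dt))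
  (fun t Dt => dx 1 t (DI t Dt)) (fun t Dt => dx1 1 t (DI t Dt)) (fun t Dt => dy 0 t (DI t Dt))
  (fun t Dt => dy1 0 t (DI t Dt)) (fun t Dt => dy 1 t (DI t Dt)) (fun t Dt => dy1 1 t (DI t Dt)) zD WD'
  (fun t Dt => P0 t (DI t Dt)) (fun t Dt => P1 t (DI t Dt)) Dt0.
have Ty k t : nbhs t I -> taylorable [set s : R | nbhs s I] (y k) t.
  by move=> It; apply: taylorable_mulmx_tr => j; exact: Te.
have Tx k t : nbhs t I -> taylorable [set s : R | nbhs s I] (x k) t.
  by move=> It; apply: taylorable_mulmx_tr => j; exact: Tc.
have Ty1 k t : nbhs t I -> taylorable [set s : R | nbhs s I] (y1 k) t.
  by move=> It; apply: taylorable_mulmx_tr => j; exact: Tde.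
have Tx1 k t : nbhs t I -> taylorable [set s : R | nbhs s I] (x1 k) t.
  by move=> It; apply: taylorable_mulmx_tr => j; exact: Tdc.
have TB (E : set R) f g t : taylorable E f t -> taylorable E g t -> taylorable E (fun s => f s - g s) t.
  move=> fT gT; have := taylorableD fT (taylorableM (taylorable_cst E (-1) t) gT).
  by under eq_fun do rewrite mulN1r.
have pitch t : nbhs t I -> kap * G t * x1 2%:R t = W t.
  move=> It; apply/eqP; rewrite -subr_eq0; apply/eqP; move: t It.
  apply: (identity_on_interior (f := fun t => kap * G t * x1 2%:R t - W t) iI It0); last first.
    by apply: filterS nearD => s Ds; exact: pitchD.
  move=> t It; apply: (TB); last first.
    by apply: (TB); apply: taylorableM; (exact: Ty || exact: Ty1).
  apply: taylorableM; last exact: Tx1; apply: taylorableM; first exact: taylorable_cst.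
  by apply: taylorableD; apply: taylorableM; exact: Ty.
have axis t : nbhs t I -> (x 1 t - q2) * y 0 t - (x 0 t - q1) * y 1 t = 0.
  apply: (identity_on_interior (f := fun t => (x 1 t - q2) * y 0 t - (x 0 t - q1) * y 1 t) iI It0); last first.
    by apply: filterS nearD => s Ds; exact: axisD.
  move=> {}t It; apply: (TB); apply: taylorableM; do ?exact: Ty; apply: (TB); do ?exact: Tx; exact: taylorable_cst.
have iI' := interior_interval iI.
have angle t : nbhs t I -> y 0 t * sin (kap * (x 2%:R t - x 2%:R t0)) - y 1 t * cos (kap * (x 2%:R t - x 2%:R t0)) = 0.
  exact: (ruling_angle iI' It0 y10 (erefl (x 2%:R t0)) GI (dx 2%:R) (dy 0) (dy 1) pitch).
exists kap, Q, (vec3 q1 q2 (x 2%:R t0) *m Q); split => // t u It.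
have cc k : x k s @[s --> within I (nbhs t)] --> x k t.
  by apply: cvg_mulmx_tr; exact: (analytic_curve_cvg iI It0 cA It).
have ec k : y k s @[s --> within I (nbhs t)] --> y k t.
  by apply: cvg_mulmx_tr; exact: (analytic_curve_cvg iI It0 eA It).
apply: in_helicoid_at => //; first by rewrite gt_eqF.
- exact: e0.
- exact: (eq0_interior_extend (f := y 2%:R) iI It0 It (ec _)).
- apply: (eq0_interior_extend (f := fun t => (x 1 t - q2) * y 0 t - (x 0 t - q1) * y 1 t) iI It0 It) => //.
  apply: cvgB; apply: cvgM; do ?exact: ec; apply: cvgB; do ?exact: cc; exact: cvg_cst.
- apply: (eq0_interior_extend (f := fun t => y 0 t * sin (kap * (x 2%:R t - x 2%:R t0)) - y 1 t * cos (kap * (x 2%:R t - x 2%:R t0))) iI It0 It) => //.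
  have ac : kap * (x 2%:R s - x 2%:R t0) @[s --> within I (nbhs t)] --> kap * (x 2%:R t - x 2%:R t0).
    by apply: cvgM; [exact: cvg_cst|apply: cvgB; [exact: cc|exact: cvg_cst]].
  apply: cvgB; apply: cvgM; do ?exact: ec.
    exact: (continuous_cvg _ (@continuous_sin R _) ac).
  exact: (continuous_cvg _ (@continuous_cos R _) ac).
Unshelve. all: by end_near. Qed.
End HelicoidRulings.

(** * Analyticity of the helicoid *)

Section EntireFunctions.
Variable R : realType.
Implicit Types (A B : R -> R).

(** Expansions converging everywhere: the radius in the definition of
    analyticity can then be chosen at will. *)
Definition entire_at A (v0 : R) := exists a : R ^nat, forall h, pseries a h @ \oo --> A (v0 + h).

Lemma entire_atD A B v0 : entire_at A v0 -> entire_at B v0 -> entire_at (fun v => A v + B v) v0.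
Proof.
move=> [a aA] [b bB]; exists (fun k => a k + b k) => h.
rewrite (_ : pseries _ h = pseries a h + pseries b h); first by apply: cvgD; [exact: aA|exact: bB].
by apply/funext => n; rewrite /pseries/series/= fctE -big_split/=; apply: eq_bigr => k _; rewrite mulrDl.
Qed.

Lemma entire_atZ A (q : R) v0 : entire_at A v0 -> entire_at (fun v => q * A v) v0.
Proof.
move=> [a aA]; exists (fun k => q * a k) => h.
rewrite (_ : pseries _ h = (fun n => q * pseries a h n)); first by apply: cvgM; [exact: cvg_cst|exact: aA].
by apply/funext => n; rewrite /pseries/series/= mulr_sumr; apply: eq_bigr => k _; rewrite mulrA.
Qed.

Lemma entire_at_cst (q : R) v0 : entire_at (fun=> q) v0.
Proof.
exists (fun k => if k == 0%N then q else 0) => h; rewrite -cvg_shiftS; apply: cvg_near_cst; near=> n.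
rewrite /pseries/series/= big_nat_recl// big1 ?addr0 ?expr0 ?mulr1//.
by move=> k _; rewrite mul0r.
Unshelve. all: by end_near. Qed.

Lemma entire_at_id v0 : entire_at id v0.
Proof.
exists (fun k => if k == 0%N then v0 else if k == 1%N then 1 else 0) => h; rewrite -(cvg_shiftn 2); apply: cvg_near_cst; near=> n.
rewrite /pseries/series/= addn2 big_nat_recl// big_nat_recl// big1 ?addr0 ?expr0 ?mulr1 ?expr1 ?mul1r//.
by move=> k _; rewrite mul0r.
Unshelve. all: by end_near. Qed.

Lemma entire_at_cos0 h : pseries (fun n => (~~ odd n)%:R * (-1) ^+ n./2 * (n`!%:R)^-1) h @ \oo --> (cos h : R).
Proof. by rewrite cosE /pseries -cos_coeffE; exact: is_cvg_series_cos_coeff. Qed.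

Lemma entire_at_sin0 h : pseries (fun n => (odd n)%:R * (-1) ^+ n.-1./2 * (n`!%:R)^-1) h @ \oo --> (sin h : R).
Proof. by rewrite sinE /pseries -sin_coeffE; exact: is_cvg_series_sin_coeff. Qed.

Lemma entire_at_cos v0 : entire_at (@cos R) v0.
Proof.
have [a aP] : entire_at (fun v => cos v0 * cos v + - sin v0 * sin v) 0.
  apply: entire_atD; apply: entire_atZ; eexists => h; rewrite add0r; [exact: entire_at_cos0|exact: entire_at_sin0].
by exists a => h; rewrite cosD -mulNr; have := aP h; rewrite add0r.
Qed.

Lemma entire_at_sin v0 : entire_at (@sin R) v0.
Proof.
have [a aP] : entire_at (fun v => sin v0 * cos v + cos v0 * sin v) 0.
  apply: entire_atD; apply: entire_atZ; eexists => h; rewrite add0r; [exact: entire_at_cos0|exact: entire_at_sin0].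
by exists a => h; rewrite sinD; have := aP h; rewrite add0r.
Qed.

Lemma entire_at_analytic A v0 : entire_at A v0 -> analytic_within setT A v0.
Proof.
move=> [a aA]; exists a, 1; split => // t _ _.
have -> : A t = A (v0 + (t - v0)) by rewrite addrC subrK.
exact: aA.
Qed.

(** Coefficients of f + x g in the grading by total degree, when x has degree
    one. *)
Definition shift_add (f g : R ^nat) k := f k + (if k is j.+1 then g j else 0).

Lemma cvg_shift_add (f g : R ^nat) a b : series f @ \oo --> a -> series g @ \oo --> b ->
  series (shift_add f g) @ \oo --> a + b.
Proof.
move=> fa gb; rewrite -cvg_shiftS (_ : [sequence _]_n = fun n => series f n.+1 + series g n).
  by apply: cvgD => //; rewrite cvg_shiftS.
apply/funext => n; rewrite /series/= /shift_add big_split/=; congr (_ + _).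
by rewrite big_nat_recl//= add0r.
Qed.

Lemma sum_shift_add (F : nat -> nat -> R) k : (forall i j, (2 <= i)%N -> F i j = 0) ->
  \sum_(i < k.+1) F i (k - i)%N = shift_add (F 0%N) (F 1%N) k.
Proof.
move=> F0; rewrite big_ord_recl/= subn0 /shift_add; congr (_ + _).
case: k => [|k]; first by rewrite big_ord0.
rewrite big_ord_recl/= big1 ?addr0 /bump/= ?add1n ?subn1//= => i _.
by rewrite F0.
Qed.

(** A function affine in the first variable, such as the coordinates of a
    ruled parametrization: only two columns of coefficients are nonzero. *)
Lemma analytic_at2_affine A B (x0 : 'rV[R]_2) : entire_at A (x0 0 1) -> entire_at B (x0 0 1) ->
  analytic_at2 (fun x => A (x 0 1) + x 0 0 * B (x 0 1)) x0.
Proof.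
move=> AE BE; have [a aP] : entire_at (fun v => A v + x0 0 0 * B v) (x0 0 1).
  by apply: entire_atD => //; exact: entire_atZ.
have [b bP] := BE.
(* in powers of u - u0 the function is (A + u0 B) + (u - u0) B *)
pose c i j : R := if i == 0%N then a j else if i == 1%N then b j else 0.
exists c, 1; split => //.
- have E k : \sum_(i < k.+1) `|c i (k - i)%N| * 1 ^+ k = shift_add (fun k => `|a k| * 1 ^+ k) (fun k => `|b k| * 1 ^+ k) k.
    under eq_bigr do rewrite expr1n mulr1; rewrite (sum_shift_add (F := fun i j => `|c i j|)).
      by rewrite /shift_add/= expr1n mulr1; case: k => // k; rewrite expr1n mulr1.
    by move=> [|[|i]]// j _; rewrite /c/= normr0.
  under eq_fun do rewrite E.
  have C (q : R ^nat) g : (forall h, pseries q h @ \oo --> (g h : R)) -> cvgn (series (fun k => `|q k| * 1 ^+ k)).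
    move=> qP; apply: (@is_cvg_pseries_inside_norm _ q 2); last by rewrite normr1 ger0_norm// ltr1n.
    by apply/cvg_ex; exists (g 2); exact: qP.
  have /cvg_ex[la Ha] := C _ _ aP; have /cvg_ex[lb Hb] := C _ _ bP.
  by apply/cvg_ex; exists (la + lb); exact: cvg_shift_add.
move=> x _ _; set h0 := x 0 0 - _; set h1 := x 0 1 - _.
have E : (fun k => \sum_(i < k.+1) c i (k - i)%N * h0 ^+ i * h1 ^+ (k - i)) =
    shift_add (fun k => a k * h1 ^+ k) (fun k => h0 * (b k * h1 ^+ k)).
  apply/funext => k; rewrite (sum_shift_add (F := fun i j => c i j * h0 ^+ i * h1 ^+ j)).
    rewrite /shift_add/= /c/= expr0 mulr1; case: k => // k; rewrite expr1; congr (_ + _); ring.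
  by move=> [|[|i]]// j _; rewrite /c/= !mul0r.
rewrite E (_ : _ + _ = (A (x 0 1) + x0 0 0 * B (x 0 1)) + h0 * B (x 0 1)); last by rewrite /h0; ring.
have xE : x 0 1 = x0 0 1 + h1 by rewrite /h1 addrC subrK.
apply: cvg_shift_add; first by rewrite xE; exact: aP.
rewrite xE (_ : series _ = (fun n => h0 * pseries b h1 n)); first by apply: cvgM; [exact: cvg_cst|exact: bP].
by apply/funext => n; rewrite /pseries/series/= mulr_sumr.
Qed.

End EntireFunctions.

(** * The helicoid as an analytic ruled surface *)

Section HelicoidChart.
Variable R : realType.
Implicit Types (x y : 'rV[R]_2) (Q : 'M[R]_3) (b : 'rV[R]_3).

Lemma vec3_mulmx (p q r : R) Q k : (vec3 p q r *m Q) 0 k = p * Q 0 k + q * Q 1 k + r * Q 2%:R k.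
Proof. by rewrite mxE sum3E !mxE. Qed.

(** Differentiation commutes with the similarity. *)
Lemma partial_rigid (l : R) Q b (f0 f1 f2 : 'rV[R]_2 -> R) (d0 d1 d2 : R) i x :
  is_derive (0 : R) (1 : R) (fun h : R => f0 (h *: delta_mx 0 i + x)) d0 ->
  is_derive (0 : R) (1 : R) (fun h : R => f1 (h *: delta_mx 0 i + x)) d1 ->
  is_derive (0 : R) (1 : R) (fun h : R => f2 (h *: delta_mx 0 i + x)) d2 ->
  partial i (fun y => l *: (vec3 (f0 y) (f1 y) (f2 y) *m Q) + b) x = l *: (vec3 d0 d1 d2 *m Q).
Proof.
move=> D0 D1 D2; set phi := (fun y => _).
have phiE y k : phi y 0 k = l * (f0 y * Q 0 k + f1 y * Q 1 k + f2 y * Q 2%:R k) + b 0 k.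
  by rewrite -vec3_mulmx !mxE.
have H k : is_derive x (delta_mx 0 i : 'rV[R]_2) (fun y => phi y 0 k) (l * (d0 * Q 0 k + d1 * Q 1 k + d2 * Q 2%:R k)).
  have {1}-> : x = 0 *: delta_mx 0 i + x by rewrite scale0r add0r.
  apply: is_derive_line; under eq_fun do rewrite phiE.
  have cst (q : R) : is_derive (0 : R) (1 : R) (fun=> q) 0 by exact: is_derive_cst.
  apply: (is_derive_eq (is_derive_add (is_derive_mul (cst l) (is_derive_add (is_derive_add (is_derive_mul D0 (cst (Q 0 k)))
    (is_derive_mul D1 (cst (Q 1 k)))) (is_derive_mul D2 (cst (Q 2%:R k))))) (cst (b 0 k)))).
  by ring.
have [_ E] := derive_coord H.
by apply/rowP => k; rewrite [LHS]E [RHS]mxE vec3_mulmx.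
Qed.

Definition helicoid_map (l : R) Q b x := l *: (vec3 (x 0 0 * cos (x 0 1)) (x 0 0 * sin (x 0 1)) (x 0 1) *m Q) + b.

Lemma line0E (h : R) x : ((h *: delta_mx 0 0 + x) 0 0 = h + x 0 0 :> R) * ((h *: delta_mx 0 0 + x) 0 1 = x 0 1 :> R)
  * ((h *: delta_mx 0 1 + x) 0 0 = x 0 0 :> R) * ((h *: delta_mx 0 1 + x) 0 1 = h + x 0 1 :> R).
Proof. by split; [split; [split|]|]; rewrite !mxE/= ?mulr1 ?mulr0 ?add0r. Qed.

Let dcst (q : R) : is_derive (0 : R) (1 : R) (fun=> q) 0 := is_derive_cst _ _ _.

Lemma is_derive_shift (q : R) : is_derive (0 : R) (1 : R) (fun h : R => h + q) 1.
Proof. by apply: (is_derive_eq (is_derive_add (is_derive_id _ _) (dcst q))); rewrite addr0. Qed.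

Lemma is_derive_cos_shift (q : R) : is_derive (0 : R) (1 : R) (fun h : R => cos (h + q)) (- sin q).
Proof.
have := @is_derive1_comp _ cos (fun h => h + q) 0 _ _ (is_derive_cos _) (is_derive_shift q).
by rewrite add0r mulr1.
Qed.

Lemma is_derive_sin_shift (q : R) : is_derive (0 : R) (1 : R) (fun h : R => sin (h + q)) (cos q).
Proof.
have := @is_derive1_comp _ sin (fun h => h + q) 0 _ _ (is_derive_sin _) (is_derive_shift q).
by rewrite add0r mulr1.
Qed.

Definition helicoid_u (l : R) Q x := l *: (vec3 (cos (x 0 1)) (sin (x 0 1)) 0 *m Q).
Definition helicoid_v (l : R) Q x := l *: (vec3 (- (x 0 0 * sin (x 0 1))) (x 0 0 * cos (x 0 1)) 1 *m Q).
Definition helicoid_uv (l : R) Q x := l *: (vec3 (- sin (x 0 1)) (cos (x 0 1)) 0 *m Q).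
Definition helicoid_vv (l : R) Q x := l *: (vec3 (- (x 0 0 * cos (x 0 1))) (- (x 0 0 * sin (x 0 1))) 0 *m Q).

Lemma partial0_helicoid l Q b : partial 0 (helicoid_map l Q b) = helicoid_u l Q.
Proof.
apply/funext => x; apply: (@partial_rigid l Q b (fun x => x 0 0 * cos (x 0 1)) (fun x => x 0 0 * sin (x 0 1)) (fun x => x 0 1)).
- under eq_fun do rewrite !line0E.
  by apply: (is_derive_eq (is_derive_mul (is_derive_shift _) (dcst _))); ring.
- under eq_fun do rewrite !line0E.
  by apply: (is_derive_eq (is_derive_mul (is_derive_shift _) (dcst _))); ring.
- by under eq_fun do rewrite !line0E; exact: dcst.
Qed.

Lemma partial1_helicoid l Q b : partial 1 (helicoid_map l Q b) = helicoid_v l Q.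
Proof.
apply/funext => x; apply: (@partial_rigid l Q b (fun x => x 0 0 * cos (x 0 1)) (fun x => x 0 0 * sin (x 0 1)) (fun x => x 0 1)).
- under eq_fun do rewrite !line0E.
  by apply: (is_derive_eq (is_derive_mul (dcst _) (is_derive_cos_shift _))); ring.
- under eq_fun do rewrite !line0E.
  by apply: (is_derive_eq (is_derive_mul (dcst _) (is_derive_sin_shift _))); ring.
- by under eq_fun do rewrite !line0E; exact: is_derive_shift.
Qed.

Lemma partial00_helicoid l Q b x : partial 0 (partial 0 (helicoid_map l Q b)) x = 0.
Proof.
rewrite partial0_helicoid (_ : helicoid_u l Q = fun y => l *: (vec3 (cos (y 0 1)) (sin (y 0 1)) 0 *m Q) + 0); last first.
  by apply/funext => y; rewrite addr0.
apply: (etrans (@partial_rigid l Q 0 (fun x => cos (x 0 1)) (fun x => sin (x 0 1)) (fun=> 0) 0 0 0 _ _ _ _ _)); last first.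
- by apply/rowP => k; rewrite mxE vec3_mulmx !mul0r !addr0 mulr0 mxE.
- exact: dcst.
- by under eq_fun do rewrite !line0E; exact: dcst.
- by under eq_fun do rewrite !line0E; exact: dcst.
Qed.

Lemma partial10_helicoid l Q b x : partial 1 (partial 0 (helicoid_map l Q b)) x = helicoid_uv l Q x.
Proof.
rewrite partial0_helicoid (_ : helicoid_u l Q = fun y => l *: (vec3 (cos (y 0 1)) (sin (y 0 1)) 0 *m Q) + 0); last first.
  by apply/funext => y; rewrite addr0.
apply: (@partial_rigid l Q 0 (fun x => cos (x 0 1)) (fun x => sin (x 0 1)) (fun=> 0)).
- by under eq_fun do rewrite !line0E; exact: is_derive_cos_shift.
- by under eq_fun do rewrite !line0E; exact: is_derive_sin_shift.
- exact: dcst.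
Qed.

Lemma partial11_helicoid l Q b x : partial 1 (partial 1 (helicoid_map l Q b)) x = helicoid_vv l Q x.
Proof.
rewrite partial1_helicoid (_ : helicoid_v l Q = fun y => l *: (vec3 (- (y 0 0 * sin (y 0 1))) (y 0 0 * cos (y 0 1)) 1 *m Q) + 0); last first.
  by apply/funext => y; rewrite addr0.
apply: (@partial_rigid l Q 0 (fun x => - (x 0 0 * sin (x 0 1))) (fun x => x 0 0 * cos (x 0 1)) (fun=> 1)).
- under eq_fun do rewrite !line0E -mulNr.
  by apply: (is_derive_eq (is_derive_mul (dcst _) (is_derive_sin_shift _))); ring.
- under eq_fun do rewrite !line0E.
  by apply: (is_derive_eq (is_derive_mul (dcst _) (is_derive_cos_shift _))); ring.
- exact: dcst.
Qed.

Lemma helicoid_map_analytic l Q b U : analytic_map U (helicoid_map l Q b).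
Proof.
move=> x _ k.
rewrite (_ : (fun y => _) = fun y => (l * Q 2%:R k * y 0 1 + b 0 k) + y 0 0 * (l * Q 0 k * cos (y 0 1) + l * Q 1 k * sin (y 0 1))).
  apply: (@analytic_at2_affine _ (fun v => l * Q 2%:R k * v + b 0 k) (fun v => l * Q 0 k * cos v + l * Q 1 k * sin v)).
    by apply: entire_atD; [apply: entire_atZ; exact: entire_at_id|exact: entire_at_cst].
  by apply: entire_atD; apply: entire_atZ; [exact: entire_at_cos|exact: entire_at_sin].
by apply/funext => y; rewrite /helicoid_map mxE [X in X + _]mxE vec3_mulmx; ring.
Qed.

End HelicoidChart.

Section HelicoidSurface.
Variable R : realType.
Implicit Types (x y : 'rV[R]_2) (Q : 'M[R]_3) (b p : 'rV[R]_3).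

Lemma dot_rot (l l' : R) Q (u v : 'rV[R]_3) : Q *m Q^T = 1%:M ->
  dot (l *: (u *m Q)) (l' *: (v *m Q)) = l * l' * dot u v.
Proof.
move=> QQ; rewrite dotZl dotZr -mulrA; congr (_ * (_ * _)).
have := @dot_mulmx_tr R u v Q^T; rewrite trmxK; apply; exact: mulmx1C.
Qed.

Definition row2 (s t : R) : 'rV[R]_2 := \row_(i < 2) [:: s; t]`_i.

Definition helicoid_coord (l : R) Q b p :=
  let y := l^-1 *: ((p - b) *m Q^T) in
  row2 (y 0 0 * cos (y 0 2%:R) + y 0 1 * sin (y 0 2%:R)) (y 0 2%:R).

Lemma helicoid_coordK l Q b x : l != 0 -> Q *m Q^T = 1%:M -> helicoid_coord l Q b (helicoid_map l Q b x) = x.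
Proof.
move=> l0 QQ; rewrite /helicoid_coord /helicoid_map addrK -scalemxAl -mulmxA QQ mulmx1 scalerA mulVf// scale1r.
apply/rowP; apply: ord2P; rewrite !mxE//=.
transitivity (x 0 0 * (cos (x 0 1) ^+ 2 + sin (x 0 1) ^+ 2)); first by ring.
by rewrite cos2Dsin2 mulr1.
Qed.

(** The height determines the angle v, and then u is a projection; so
    the inverse of the parametrization is continuous on the whole space. *)
Lemma cvg_helicoid_coord (T : Type) (F : set_system T) (f : T -> 'rV[R]_3) l Q b p : Filter F ->
  f @ F --> p -> helicoid_coord l Q b (f t) @[t --> F] --> helicoid_coord l Q b p.
Proof.
move=> FF fp; pose y p k := (l^-1 *: ((p - b) *m Q^T)) 0 k.
have yC k : y (f t) k @[t --> F] --> y p k.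
  have E q : y q k = l^-1 * \sum_j (q 0 j - b 0 j) * Q k j.
    by rewrite /y mxE mulmx_trE; congr (_ * _); apply: eq_bigr => j _; rewrite !mxE.
  have C j : (f t 0 j - b 0 j) * Q k j @[t --> F] --> (p 0 j - b 0 j) * Q k j.
    by apply: cvgM; [apply: cvgB; [exact: cvg_coord|exact: cvg_cst]|exact: cvg_cst].
  under eq_fun do rewrite E sum3E; rewrite E sum3E; apply: cvgM; first exact: cvg_cst.
  by apply: cvgD; [apply: cvgD|]; exact: C.
have E0 q : helicoid_coord l Q b q 0 0 = y q 0 * cos (y q 2%:R) + y q 1 * sin (y q 2%:R) by exact: mxE.
have E1 q : helicoid_coord l Q b q 0 1 = y q 2%:R by exact: mxE.
apply: cvg_row; apply: ord2P.
  under eq_fun do rewrite E0; rewrite E0.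
  have C : cos (y (f t) 2%:R) @[t --> F] --> cos (y p 2%:R) by exact: (cvg_comp _ _ (yC 2%:R) (@continuous_cos R _)).
  have S : sin (y (f t) 2%:R) @[t --> F] --> sin (y p 2%:R) by exact: (cvg_comp _ _ (yC 2%:R) (@continuous_sin R _)).
  apply: cvgD; apply: cvgM; by [exact: yC|exact: C|exact: S].
by under eq_fun do rewrite E1; rewrite E1; exact: yC.
Qed.

Lemma helicoid_row_free l Q b x : l != 0 -> Q *m Q^T = 1%:M ->
  row_free (\matrix_(i < 2) partial i (helicoid_map l Q b) x).
Proof.
move=> l0 QQ; apply/row_freeP.
pose w0 := l^-1 *: (vec3 (cos (x 0 1)) (sin (x 0 1)) 0 *m Q); pose w1 := l^-1 *: (vec3 0 0 1 *m Q).
exists (\matrix_(k < 3, j < 2) [:: w0 0 k; w1 0 k]`_j).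
have E (i j : 'I_2) : ((\matrix_(i < 2) partial i (helicoid_map l Q b) x) *m (\matrix_(k < 3, j < 2) [:: w0 0 k; w1 0 k]`_j)) i j
   = dot (partial i (helicoid_map l Q b) x) (if j == 0 then w0 else w1).
  by rewrite mxE; apply: eq_bigr => k _; congr (_ * _); [exact: mxE|rewrite mxE; move: j; exact: ord2P].
have cs := cos2Dsin2 (x 0 1).
have sqE : cos (x 0 1) * cos (x 0 1) + sin (x 0 1) * sin (x 0 1) = 1 by rewrite -!expr2.
apply/matrixP; apply: ord2P; apply: ord2P; rewrite E [RHS]mxE/= ?partial0_helicoid ?partial1_helicoid
  dot_rot// mulfV// mul1r dotE !mxE/= ?mulr0 ?mul0r ?addr0 ?add0r ?mulr1//.
by ring.
Qed.

Lemma helicoid_chart l Q b : l != 0 -> Q *m Q^T = 1%:M ->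
  analytic_chart (range (helicoid_map l Q b)) setT setT (helicoid_map l Q b).
Proof.
move=> l0 QQ; split; [exact: openT|by left|exact: helicoid_map_analytic|by move=> x _; exact: helicoid_row_free|].
exists setT, (helicoid_coord l Q b); split; [exact: openT|by rewrite !setIT| |].
  by move=> x _; exact: helicoid_coordK.
by apply: continuous_subspaceT; move=> p; exact: (@cvg_helicoid_coord _ (nbhs p) id).
Qed.

Lemma helicoidE (H : set 'rV[R]_3) : helicoid H <-> exists (l : R) Q b, [/\ 0 < l, Q *m Q^T = 1%:M & H = range (helicoid_map l Q b)].
Proof.
have E l Q b : [set p | exists u v : R, p = l *: (vec3 (u * cos v) (u * sin v) v *m Q) + b] = range (helicoid_map l Q b).
  apply/seteqP; split => p /=.
    by move=> [u [v ->]]; exists (row2 u v) => //; rewrite /helicoid_map !mxE.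
  by move=> [x _ <-]; exists (x 0 0), (x 0 1).
split => -[l [Q [b [l0 QQ ->]]]]; exists l, Q, b; split => //; by rewrite E.
Qed.

Lemma cvg_helicoid_map (T : Type) (F : set_system T) (f : T -> 'rV[R]_2) l Q b x : Filter F ->
  f @ F --> x -> helicoid_map l Q b (f t) @[t --> F] --> helicoid_map l Q b x.
Proof.
move=> FF fx; apply: cvg_row => k.
have E y : helicoid_map l Q b y 0 k = l * (y 0 0 * cos (y 0 1) * Q 0 k + y 0 0 * sin (y 0 1) * Q 1 k + y 0 1 * Q 2%:R k) + b 0 k.
  by rewrite /helicoid_map mxE [X in X + _]mxE vec3_mulmx.
under eq_fun do rewrite E; rewrite E.
have c0 : f t 0 0 @[t --> F] --> x 0 0 by exact: cvg_coord.
have c1 : f t 0 1 @[t --> F] --> x 0 1 by exact: cvg_coord.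
have C : cos (f t 0 1) @[t --> F] --> cos (x 0 1) by exact: (cvg_comp _ _ c1 (@continuous_cos R _)).
have S : sin (f t 0 1) @[t --> F] --> sin (x 0 1) by exact: (cvg_comp _ _ c1 (@continuous_sin R _)).
apply: cvgD; last exact: cvg_cst.
apply: cvgM; first exact: cvg_cst.
by apply: cvgD; [apply: cvgD|]; apply: cvgM; rewrite //; try exact: cvg_cst; exact: cvgM.
Qed.

Lemma helicoid_connected l Q b : connected (range (helicoid_map l Q b)).
Proof.
have E : range (helicoid_map l Q b) =
    \bigcup_(x in @setT 'rV[R]_2) ((fun s : R => helicoid_map l Q b (s *: x)) @` `[0, 1]%classic).
  apply/seteqP; split => p.
    by move=> [x _ <-]; exists x => //; exists 1; rewrite ?scale1r//= in_itv/= ler01 lexx.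
  by move=> [x _ [s _ <-]]; exists (s *: x).
rewrite E; apply: bigcup_connected.
  exists (helicoid_map l Q b 0) => x _; exists 0; rewrite ?scale0r//= in_itv/= ler01 lexx//.
move=> x _; apply: connected_continuous_connected; first exact: segment_connected.
apply: continuous_subspaceT => s.
by apply: cvg_helicoid_map; exact: scalel_continuous.
Qed.

Lemma helicoid_ruled l Q b : l != 0 -> Q *m Q^T = 1%:M -> ruled (range (helicoid_map l Q b)).
Proof.
move=> l0 QQ.
exists setT, (fun=> setT), (fun t => l *: (vec3 0 0 t *m Q) + b), (fun t => l *: (vec3 (cos t) (sin t) 0 *m Q)); split.
- by move=> ? ? _ _ ? _.
- move=> t _ k; apply: entire_at_analytic.
  rewrite (_ : (fun t => _) = fun t => l * Q 2%:R k * t + b 0 k); last first.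
    by apply/funext => s; rewrite mxE [X in X + _]mxE vec3_mulmx; ring.
  by apply: entire_atD; [apply: entire_atZ; exact: entire_at_id|exact: entire_at_cst].
- move=> t _ k; apply: entire_at_analytic.
  rewrite (_ : (fun t => _) = fun t => l * Q 0 k * cos t + l * Q 1 k * sin t); last first.
    by apply/funext => s; rewrite mxE vec3_mulmx; ring.
  by apply: entire_atD; apply: entire_atZ; [exact: entire_at_cos|exact: entire_at_sin].
- move=> t _; split; [|by []|by exists 0, 1; split => //; rewrite eq_sym oner_eq0].
  rewrite -dot_eq0 dot_rot// dotE !mxE/= mulr0 addr0 -!expr2 cos2Dsin2 mulr1 expr2.
  by rewrite mulf_neq0.
apply/seteqP; split => p.
  move=> [x _ <-]; exists (x 0 1) => //; exists (x 0 0) => //.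
  by apply/rowP => k; rewrite /helicoid_map !mxE !sum3E !mxE/=; ring.
move=> [t _ [u _ <-]]; exists (row2 u t) => //.
by apply/rowP => k; rewrite /helicoid_map !mxE !sum3E !mxE/=; ring.
Qed.

Lemma helicoid_analytic_ruled (H : set 'rV[R]_3) : helicoid H -> analytic_ruled_surface H.
Proof.
move=> /helicoidE[l [Q [b [l0 QQ ->]]]]; have l0' : l != 0 by rewrite gt_eqF.
split; last exact: helicoid_ruled.
split; first exact: helicoid_connected.
move=> p [x _ <-]; exists setT, setT, (helicoid_map l Q b), x; split => //.
exact: helicoid_chart.
Qed.

End HelicoidSurface.

(** * Surfaces contained in a helicoid *)

Section HelicoidPiece.
Variable R : realType.
Implicit Types (S H : set 'rV[R]_3) (U M : set 'rV[R]_2) (phi : 'rV[R]_2 -> 'rV[R]_3) (Q : 'M[R]_3) (b n : 'rV[R]_3).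

(** The image under phi of a segment issued from x is a curve on S'. *)
Lemma chart_osculates S S' U M U' M' phi phi' x x' (h : 'rV[R]_2) : S `<=` S' ->
  analytic_chart S U M phi -> (U `&` M) x -> analytic_chart S' U' M' phi' -> (U' `&` M') x' -> phi' x' = phi x ->
  0 <= h 0 1 ->
  osculates (partial 0 phi' x') (partial 1 phi' x') (partial 0 (partial 0 phi') x')
    (partial 1 (partial 0 phi') x') (partial 1 (partial 1 phi') x')
    (h 0 0 *: partial 0 phi x + h 0 1 *: partial 1 phi x)
    (h 0 0 ^+ 2 *: partial 0 (partial 0 phi) x + (2 * h 0 0 * h 0 1) *: partial 1 (partial 0 phi) x
      + h 0 1 ^+ 2 *: partial 1 (partial 1 phi) x).
Proof.
move=> SS' ch UMx ch' UMx' xx' h1.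
have [oU MP phiA _ [V [psi [_ UMV _ _]]]] := ch.
have F0 := @at_right_dnbhs R 0.
apply: (@chart_curve_jet R _ _ _ _ _ (0 : R)^'+ (fun s : R => phi (s *: h + x)) 0 _ _ ch' UMx' _ F0).
- apply: filterS (chart_domain_segment oU MP UMx h1) => s UMs; apply: SS'.
  have : (S `&` V) (phi (s *: h + x)) by rewrite -UMV; exists (s *: h + x).
  by move=> [].
- by rewrite scale0r add0r xx'.
- by move=> k; exact: jet2_sub F0 (chart_line_jet h (phiA _ UMx.1) k).
Qed.

Lemma row2_0 (s t : R) : row2 s t 0 0 = s. Proof. exact: mxE. Qed.
Lemma row2_1 (s t : R) : row2 s t 0 1 = t. Proof. exact: mxE. Qed.

(** The 2-jets of the two charts are compared by [forms_pullback] on the two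
    coordinate directions and their sum, which all point into the half-plane. *)
Lemma subsurface_forms S S' U M U' M' phi phi' x x' : S `<=` S' ->
  analytic_chart S U M phi -> (U `&` M) x -> analytic_chart S' U' M' phi' -> (U' `&` M') x' -> phi' x' = phi x ->
  let a0 := partial 0 phi x in let a1 := partial 1 phi x in
  let b00 := partial 0 (partial 0 phi) x in let b01 := partial 1 (partial 0 phi) x in let b11 := partial 1 (partial 1 phi) x in
  let a0' := partial 0 phi' x' in let a1' := partial 1 phi' x' in
  let b00' := partial 0 (partial 0 phi') x' in let b01' := partial 1 (partial 0 phi') x' in let b11' := partial 1 (partial 1 phi') x' in
  exists2 d : R, cross a0 a1 = d *: cross a0' a1' &
    forall n, dot n a0' = 0 -> dot n a1' = 0 ->
    dot n b00 * dot a1 a1 - 2 * dot n b01 * dot a0 a1 + dot n b11 * dot a0 a0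
     = d ^+ 2 * (dot n b00' * dot a1' a1' - 2 * dot n b01' * dot a0' a1' + dot n b11' * dot a0' a0') /\
    dot n b00 * dot n b11 - dot n b01 ^+ 2 = d ^+ 2 * (dot n b00' * dot n b11' - dot n b01' ^+ 2).
Proof.
move=> SS' ch UMx ch' UMx' xx' a0 a1 b00 b01 b11 a0' a1' b00' b01' b11'.
have [_ _ _ phiF _] := ch'.
have osc (s t : R) : 0 <= t -> osculates a0' a1' b00' b01' b11' (s *: a0 + t *: a1)
    (s ^+ 2 *: b00 + (2 * s * t) *: b01 + t ^+ 2 *: b11).
  have := @chart_osculates _ _ _ _ _ _ _ _ _ _ (row2 s t) SS' ch UMx ch' UMx' xx'.
  by rewrite row2_0 row2_1.
(* velocities and accelerations along (1, 0), (0, 1) and (1, 1) *)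
have l10 (v w : 'rV[R]_3) : (1 : R) *: v + (0 : R) *: w = v by rewrite scale1r scale0r addr0.
have l01 (v w : 'rV[R]_3) : (0 : R) *: v + (1 : R) *: w = w by rewrite scale1r scale0r add0r.
have q10 (u v w : 'rV[R]_3) : (1 ^+ 2 : R) *: u + (2 * 1 * 0 : R) *: v + (0 ^+ 2 : R) *: w = u.
  by rewrite expr1n expr0n mulr0 scale1r !scale0r !addr0.
have q01 (u v w : 'rV[R]_3) : (0 ^+ 2 : R) *: u + (2 * 0 * 1 : R) *: v + (1 ^+ 2 : R) *: w = w.
  by rewrite expr1n expr0n mulr0 mul0r scale1r !scale0r !add0r.
have l11 (v w : 'rV[R]_3) : (1 : R) *: v + (1 : R) *: w = v + w by rewrite !scale1r.
have q11 (u v w : 'rV[R]_3) : (1 ^+ 2 : R) *: u + (2 * 1 * 1 : R) *: v + (1 ^+ 2 : R) *: w = u + 2 *: v + w.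
  by rewrite expr1n !mulr1 !scale1r.
apply: forms_pullback.
- by apply: (row_free_cross _ _ (phiF _ UMx'.1)) => k; exact: mxE.
- by have := osc 1 0 (lexx _); rewrite l10 q10.
- by have := osc 0 1 ler01; rewrite l01 q01.
- by have := osc 1 1 ler01; rewrite l11 q11.
Qed.

Lemma dot_mulmx_rot n Q (w : 'rV[R]_3) (l : R) : dot n (l *: (w *m Q)) = l * dot (n *m Q^T) w.
Proof.
rewrite dotZr; congr (_ * _).
have dE (a b : 'rV[R]_3) : dot a b = (a *m b^T) 0 0 :> R.
  by rewrite mxE; apply: eq_bigr => k _; rewrite [in RHS]mxE.
by rewrite !dE trmx_mul mulmxA.
Qed.

Lemma dot_vec3 n (p q r : R) : dot n (vec3 p q r) = n 0 0 * p + n 0 1 * q + n 0 2%:R * r.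
Proof. by rewrite dotE !mxE. Qed.

(** On a helicoid the coordinate directions are orthogonal and both asymptotic,
    so the trace vanishes and the determinant is the opposite of a square; this
    square is nonzero as otherwise n would be orthogonal to a basis. *)
Lemma helicoid_forms l Q b (x : 'rV[R]_2) n : l != 0 -> Q *m Q^T = 1%:M -> dot n n = 1 ->
  let phi := helicoid_map l Q b in let a0 := partial 0 phi x in let a1 := partial 1 phi x in
  let L := dot n (partial 0 (partial 0 phi) x) in
  let M := dot n (partial 1 (partial 0 phi) x) in
  let N := dot n (partial 1 (partial 1 phi) x) in
  dot n a0 = 0 -> dot n a1 = 0 ->
  L * dot a1 a1 - 2 * M * dot a0 a1 + N * dot a0 a0 = 0 /\ L * N - M ^+ 2 < 0.
Proof.
move=> l0 QQ nn phi a0 a1 L M N na0 na1; have cs := cos2Dsin2 (x 0 1).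
have -> : L = 0 by rewrite /L partial00_helicoid dotE !mxE !mulr0 !addr0.
pose m := n *m Q^T; pose C := cos (x 0 1); pose D := sin (x 0 1); pose u := x 0 0.
have E0 : m 0 0 * C + m 0 1 * D = 0.
  apply: (mulfI l0); rewrite mulr0 -[RHS]na0 /a0 partial0_helicoid dot_mulmx_rot dot_vec3.
  by rewrite /C /D /m; ring.
have E1 : u * (m 0 1 * C - m 0 0 * D) + m 0 2%:R = 0.
  apply: (mulfI l0); rewrite mulr0 -[RHS]na1 /a1 partial1_helicoid dot_mulmx_rot dot_vec3.
  by rewrite /C /D /m /u; ring.
have -> : N = 0.
  rewrite /N partial11_helicoid dot_mulmx_rot dot_vec3 -/m -/C -/D -/u.
  by transitivity (- l * u * (m 0 0 * C + m 0 1 * D)); [ring|rewrite E0 mulr0].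
have F : dot a0 a1 = 0.
  by rewrite /a0 /a1 partial0_helicoid partial1_helicoid dot_rot// dotE !mxE/=; ring.
(* if M = 0, then n is orthogonal to the ruling, to the turned ruling and to the axis *)
have M0 : M != 0.
  apply/eqP; rewrite /M partial10_helicoid dot_mulmx_rot dot_vec3 -/m -/C -/D => M0.
  have {M0} E2 : m 0 1 * C - m 0 0 * D = 0 by apply: (mulfI l0); rewrite mulr0 -[RHS]M0; ring.
  have m2 : m 0 2%:R = 0 by move: E1; rewrite E2 mulr0 add0r.
  have : dot m m = 1 by rewrite /m dot_mulmx_tr.
  have -> : dot m m = (m 0 0 * C + m 0 1 * D) ^+ 2 + (m 0 1 * C - m 0 0 * D) ^+ 2.
    rewrite dotE m2 mulr0 addr0 -[LHS]mulr1 -[X in _ * X]cs -/C -/D; ring.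
  by rewrite E0 E2 expr0n addr0 => /eqP; rewrite eq_sym oner_eq0.
have concl (E F' G M' : R) : F' = 0 -> M' != 0 -> 0 * G - 2 * M' * F' + 0 * E = 0 /\ 0 * 0 - M' ^+ 2 < 0.
  by move=> -> M'0; split; [ring|rewrite mul0r sub0r oppr_lt0 exprn_even_gt0].
exact: concl.
Qed.

Lemma opposite_roots (g D : R) : 0 < g -> D < 0 -> exists k1 k2 : R,
  [/\ (k1 + k2) * g = 0, k1 * k2 * g = D, k1 * k2 != 0 & k1 / k2 = -1].
Proof.
move=> g0 D0; have K : 0 < - D / g by rewrite divr_gt0// oppr_gt0.
have s0 : Num.sqrt (- D / g) != 0 by rewrite sqrtr_eq0 -ltNge.
have s2 : Num.sqrt (- D / g) ^+ 2 = - D / g by rewrite sqr_sqrtr// ltW.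
exists (Num.sqrt (- D / g)), (- Num.sqrt (- D / g)); split.
- by rewrite subrr mul0r.
- by rewrite mulrN -expr2 s2; field; rewrite gt_eqF.
- by rewrite mulrN oppr_eq0 mulf_neq0.
- by rewrite invrN mulrN mulfV.
Qed.

Lemma helicoid_part_ratio S H : analytic_surface S -> helicoid H -> S `<=` H -> constant_curvature_ratio S.
Proof.
move=> [_ Sch] /helicoidE[l [Q [b [l0 QQ HE]]]] SH.
have l0' : l != 0 by rewrite gt_eqF.
exists (-1); first by rewrite oppr_eq0 oner_eq0.
move=> p Sp; have [U [M [phi [x [ch UMx phix]]]]] := Sch _ Sp.
have : H p by exact: SH.
rewrite HE => -[y _ yp].
have SH' : S `<=` range (helicoid_map l Q b) by rewrite -HE.
have [|d cE dE] := @subsurface_forms _ _ _ _ _ _ _ _ _ y SH' ch UMx (helicoid_chart b l0' QQ) _ (etrans yp (esym phix)).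
  by [].
have [_ _ phiA phiF _] := ch.
have [g0 [nn n0 n1] [c cg nE] cpE] := chart_principal (phiA _ UMx.1) (phiF _ UMx.1).
have c0 : cross (partial 0 phi x) (partial 1 phi x) != 0.
  by apply: (row_free_cross _ _ (phiF _ UMx.1)) => k; exact: mxE.
have d0 : d != 0 by apply: contra c0 => /eqP d0; rewrite cE d0 scale0r.
have na0 : dot (unit_normal phi x) (partial 0 (helicoid_map l Q b) y) = 0.
  by rewrite nE cE dotZl dotZl [dot (cross _ _) _]dotC dot_crossl !mulr0.
have na1 : dot (unit_normal phi x) (partial 1 (helicoid_map l Q b) y) = 0.
  by rewrite nE cE dotZl dotZl [dot (cross _ _) _]dotC dot_crossr !mulr0.
have [tr de] := dE _ na0 na1.
have [tr0 de0] := helicoid_forms l0' QQ nn na0 na1.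
rewrite tr0 mulr0 in tr.
have D0 : dot (unit_normal phi x) (partial 0 (partial 0 phi) x) * dot (unit_normal phi x) (partial 1 (partial 1 phi) x)
    - dot (unit_normal phi x) (partial 1 (partial 0 phi) x) ^+ 2 < 0.
  by rewrite de pmulr_rlt0// exprn_even_gt0.
have [k1 [k2 [H1 H2 H3 H4]]] := opposite_roots g0 D0.
exists k1, k2; split => //; last by left.
by exists U, M, phi, x; split => //; apply/cpE; rewrite tr.
Qed.
End HelicoidPiece.

(** * Ruled surfaces with a constant ratio of principal curvatures *)

Section Classification.
Variable R : realType.
Implicit Types (S H : set 'rV[R]_3) (I : set R) (c e : R -> 'rV[R]_3).

Lemma helicoid_at_helicoid (kap : R) Q b : 0 < kap -> Q *m Q^T = 1%:M -> helicoid (helicoid_at kap Q b).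
Proof. by move=> k0 QQ; exists kap^-1, Q, b; split => //; rewrite invr_gt0. Qed.

Lemma ratio_opp (k1 k2 : R) : k1 * k2 != 0 -> k1 / k2 = -1 \/ k2 / k1 = -1 -> k1 + k2 = 0.
Proof.
rewrite mulf_eq0 negb_or => /andP[k10 k20].
have H (x y : R) : y != 0 -> x / y = -1 -> x + y = 0.
  by move=> y0 /(canRL (divfK y0)) ->; rewrite mulN1r addNr.
by case=> [/H ->//|/H H']; rewrite addrC H'.
Qed.

(** An interval without interior points has at most one element, and one ruling
    is not a surface. *)
Lemma ruled_interior S I (J : R -> set R) c e : analytic_surface S -> S !=set0 -> is_interval I ->
  (forall t, I t -> e t != 0) -> S = \bigcup_(t in I) [set c t + u *: e t | u in J t] ->
  exists t : R, nbhs t I.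
Proof.
move=> Ssurf S0 iI e0 SE; apply: contrapT => nI.
have I1 s t : I s -> I t -> s = t.
  move=> Is It; apply: contrapT => /eqP; rewrite neq_lt => /orP[st|ts]; apply: nI.
    exists ((s + t) / 2); apply: (nbhs_between iI Is It); apply/andP; split; lra.
  exists ((s + t) / 2); apply: (nbhs_between iI It Is); apply/andP; split; lra.
have [p] := S0; rewrite {1}SE => -[t It _].
apply: (surface_not_in_line (p0 := c t) (d := e t) Ssurf S0 (e0 t It)) => q.
rewrite SE => -[s Is [u _ <-]]; rewrite (I1 s t Is It) addrAC subrr add0r crossZl crossuu.
exact: scaler0.
Qed.

(** The degenerate alternative of [ruled_dichotomy] is excluded by
    [surface_not_in_line]; the other one is Catalan's theorem. *)
Lemma ruled_ratio_helicoid S : analytic_ruled_surface S -> constant_curvature_ratio S ->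
  (exists2 H, helicoid H & S `<=` H) /\ minimal S.
Proof.
move=> [Ssurf [I [J [c [e [iI cA eA IJ SE]]]]]] [a a0 Sa].
have [S0|/set0P S0] := eqVneq S set0.
  split; last by move=> p; rewrite S0.
  exists (helicoid_at 1 1%:M 0); last by rewrite S0.
  by apply: helicoid_at_helicoid => //; rewrite trmx1 mulmx1.
have e0 t : I t -> e t != 0 by move=> /IJ[].
have [t1 It1] := ruled_interior Ssurf S0 iI e0 SE.
have [P012 [[[t0 [It0 mt0]] a1]|XY0]] := ruled_dichotomy cA eA IJ SE a0 Sa.
  split.
    have [kap [Q [b [k0 QQ SH]]]] := ruling_in_helicoid iI It0 cA eA e0 P012 mt0.
    exists (helicoid_at kap Q b); first exact: helicoid_at_helicoid.
    by rewrite SE => _ [t It [u _ <-]]; exact: SH.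
  move=> p Sp; have [k1 [k2 [pc k12 ka]]] := Sa p Sp.
  by exists k1, k2; split=> //; rewrite a1 in ka; rewrite (ratio_opp k12 ka) mul0r.
exfalso; apply: (surface_not_in_line (p0 := c t1) (d := e t1) Ssurf S0 (e0 _ (nbhs_singleton It1))) => p.
rewrite SE => -[t It [u _ <-]].
exact: (ruling_in_line iI It1 cA eA e0 XY0).
Qed.

End Classification.

Theorem proposition15 (R : realType) :
  (forall S : set 'rV[R]_3, analytic_ruled_surface S ->
     (constant_curvature_ratio S <-> exists2 H, helicoid H & S `<=` H) /\
     (constant_curvature_ratio S -> minimal S)) /\
  (forall H : set 'rV[R]_3, helicoid H -> analytic_ruled_surface H).
Proof.
split; last exact: helicoid_analytic_ruled.
move=> S Sar; split; last by move=> /(ruled_ratio_helicoid Sar)[].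
split; first by move=> /(ruled_ratio_helicoid Sar)[].
by move=> [H Hh SH]; have [Ssurf _] := Sar; exact: helicoid_part_ratio Hh SH.
Qed.
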